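(* Let $n\ge 1$ be an integer and let $p,q\in[1,\infty]$. Suppose that for some real numbers $\alpha\ge 0$ and $s\ge 0$ there is a constant $K<\infty$ such that for every Schwartz function $G_0:\mathbb R^n\times\mathbb R^n\times\mathbb R^n\to\mathbb C$, with $G(t,x,y,z)=e^{\frac{it(\Delta_x+\Delta_y-\Delta_z)}{2}}G_0(x,y,z)$ for $t\in\mathbb R$ and $x,y,z\in\mathbb R^n$, one has $$\big\|\,|\nabla|_x^{\alpha}\big(G(t,x,x,x)\big)\big\|_{L^p(dt)L^q(dx)}\le K\,\|G_0\|_{H^s(dx\,dy\,dz)}.$$ Then $p\ge 2$ and $q\ge 2$.
   Context: The function $G(t,\cdot,\cdot,\cdot)=e^{\frac{it(\Delta_x+\Delta_y-\Delta_z)}{2}}G_0$ is the function on $\mathbb R^{n}\times\mathbb R^n\times\mathbb R^n$ whose Fourier transform in $(x,y,z)$, with dual variables $(\xi,\eta,\zeta)$ and the convention in which $\nabla_x,\nabla_y,\nabla_z$ correspond to multiplication by $i\xi,i\eta,i\zeta$ respectively, is $e^{-\frac{it(|\xi|^2+|\eta|^2-|\zeta|^2)}{2}}\widehat{G_0}(\xi,\eta,\zeta)$. For each $t$, $G(t,x,x,x)$ denotes the restriction to the diagonal $x=y=z$, a function of $x\in\mathbb R^n$, and $|\nabla|_x^{\alpha}$ is the Fourier multiplier on $\mathbb R^n$ with symbol $|\xi|^{\alpha}$, applied to the function $x\mapsto G(t,x,x,x)$. The mixed norm is $\|f\|_{L^p(dt)L^q(dx)}=\big\|\,\|f(t,\cdot)\|_{L^q(\mathbb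 R^n)}\big\|_{L^p(\mathbb R)}$ (with values in $[0,\infty]$), where $t$ ranges over all of $\mathbb R$. $H^s(dx\,dy\,dz)$ is the inhomogeneous $L^2$-based Sobolev space on $\mathbb R^{3n}$. *)

(* Defs.v *)
From HB Require Import structures.
From mathcomp Require Import all_boot all_order all_algebra.
From mathcomp Require Import complex.
From mathcomp Require Import all_classical all_reals all_analysis.

Set Implicit Arguments.
Unset Strict Implicit.
Unset Printing Implicit Defensive.

Import Order.TTheory GRing.Theory Num.Theory.
Import numFieldNormedType.Exports.

Local Open Scope classical_set_scope.
Local Open Scope ring_scope.
Local Open Scope complex_scope.

Definition rV_display : measure_display -> measure_display.
Proof. exact. Qed.

(* The product sigma-algebra on R^n, generated by the coordinates; it is the
   Borel sigma-algebra of R^n. *)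
Section rV_measurable.
Context {R : realType} (n : nat).

Let coords : 'I_n -> 'rV[R]_n -> R := fun i x => x ord0 i.

Let rV_set0 : g_sigma_preimage coords set0.
Proof. exact: sigma_algebra0. Qed.

Let rV_setC A : g_sigma_preimage coords A -> g_sigma_preimage coords (~` A).
Proof. exact: sigma_algebraC. Qed.

Let rV_bigcup (F : _^nat) : (forall i, g_sigma_preimage coords (F i)) ->
  g_sigma_preimage coords (\bigcup_i (F i)).
Proof. exact: sigma_algebra_bigcup. Qed.

HB.instance Definition _ := @isMeasurable.Build
  (rV_display default_measure_display) 'rV[R]_n (g_sigma_preimage coords)
  rV_set0 rV_setC rV_bigcup.

End rV_measurable.

Section rV_measurable_theory.
Context {R : realType}.

Lemma measurable_rV_coord n (i : 'I_n) :
  measurable_fun [set: 'rV[R]_n] (fun x : 'rV[R]_n => x ord0 i).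
Proof.
move=> _ Y mY; rewrite setTI; apply: sub_sigma_algebra => /=.
rewrite -bigcup_seq/=; exists i => /=; first by rewrite mem_index_enum.
by exists Y => //; rewrite setTI.
Qed.

Lemma measurable_fun_rVP d (T : measurableType d) n (f : T -> 'rV[R]_n) :
  (forall i, measurable_fun [set: T] (fun x => f x ord0 i)) ->
  measurable_fun [set: T] f.
Proof.
move=> mf _ Y mY; rewrite setTI.
suff: [set A | measurable (f @^-1` A)] Y by [].
move: Y mY; apply: smallest_sub.
  split=> /=; first by rewrite preimage_set0.
    by move=> A mA; rewrite setTD -preimage_setC; exact: measurableC.
  by move=> F mF; rewrite preimage_bigcup; exact: bigcupT_measurable.
rewrite -bigcup_seq/=; apply: bigcup_sub => i _ A [B mB <-] /=.
by rewrite setTI -comp_preimage -[X in measurable X]setTI; exact: mf.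
Qed.

Definition rV_cons n (p : R * 'rV[R]_n) : 'rV[R]_n.+1 := row_mx p.1%:M p.2.

Definition rV_uncons n (x : 'rV[R]_n.+1) : R * 'rV[R]_n :=
  (x ord0 ord0, \row_i x ord0 (lift ord0 i)).

Lemma rV_cons0 n (p : R * 'rV[R]_n) : rV_cons p ord0 ord0 = p.1.
Proof.
transitivity (rV_cons p ord0 (lshift n (ord0 : 'I_1))).
  by congr (rV_cons p ord0 _); exact/val_inj.
by rewrite [LHS](row_mxEl p.1%:M p.2 ord0 ord0) mxE eqxx.
Qed.

Lemma rV_consS n (p : R * 'rV[R]_n) i :
  rV_cons p ord0 (lift ord0 i) = p.2 ord0 i.
Proof.
transitivity (rV_cons p ord0 (rshift 1 i)).
  by congr (rV_cons p ord0 _); exact/val_inj.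
exact: (row_mxEr p.1%:M p.2 ord0 i).
Qed.

Lemma rV_consK n : cancel (@rV_cons n) (@rV_uncons n).
Proof.
move=> [a x]; rewrite /rV_uncons rV_cons0; congr pair.
by apply/rowP => i; rewrite mxE rV_consS.
Qed.

Lemma measurable_rV_cons n : measurable_fun [set: R * 'rV[R]_n] (@rV_cons n).
Proof.
apply: measurable_fun_rVP => i; have [j ->|->] := unliftP ord0 i.
  under eq_fun do rewrite rV_consS.
  exact: measurableT_comp (measurable_rV_coord j) measurable_snd.
by under eq_fun do rewrite rV_cons0; exact: measurable_fst.
Qed.

Lemma measurable_rV_uncons n : measurable_fun [set: 'rV[R]_n.+1] (@rV_uncons n).
Proof.
apply: measurable_fun_pair; first exact: measurable_rV_coord.
apply: measurable_fun_rVP => i.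
by under eq_fun do rewrite mxE; exact: measurable_rV_coord.
Qed.

End rV_measurable_theory.


(* The image of lebesgue_measure \x mu under (a, x) |-> (a, x_1, ..., x_n). *)
Section lebesgue_rV_step.
Local Open Scope ereal_scope.
Context {R : realType} (n : nat).
Variable mu : {sigma_finite_measure set 'rV[R]_n -> \bar R}.

Definition lebesgue_rV_step : set 'rV[R]_n.+1 -> \bar R :=
  pushforward (lebesgue_measure \x mu) (@rV_cons R n).

Let step0 : lebesgue_rV_step set0 = 0.
Proof. by rewrite /lebesgue_rV_step /pushforward preimage_set0 measure0. Qed.

Let step_ge0 A : 0 <= lebesgue_rV_step A.
Proof. by rewrite /lebesgue_rV_step /pushforward; exact: measure_ge0. Qed.

Let step_sigma_additive : semi_sigma_additive lebesgue_rV_step.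
Proof.
move=> F mF tF mUF; rewrite /lebesgue_rV_step /pushforward preimage_bigcup.
have mcons A : measurable A -> measurable (@rV_cons R n @^-1` A).
  by move=> mA; rewrite -[X in measurable X]setTI; exact: measurable_rV_cons.
apply: measure_semi_sigma_additive.
- by move=> k; exact: mcons.
- apply/trivIsetP => /= i j _ _ ij; rewrite -preimage_setI.
  by move/trivIsetP : tF => /(_ _ _ _ _ ij) ->//; rewrite preimage_set0.
- by rewrite -preimage_bigcup; exact: mcons.
Qed.

HB.instance Definition _ := isMeasure.Build _ _ _ lebesgue_rV_step
  step0 step_ge0 step_sigma_additive.

Let step_sigma_finite : sigma_finite setT lebesgue_rV_step.
Proof.
have /sigma_finiteP[F [FT ndF Foo]] := sigma_finiteT (@lebesgue_measure R).
have /sigma_finiteP[G [GT ndG Goo]] := sigma_finiteT mu.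
exists (fun k => @rV_uncons R n @^-1` (F k `*` G k)).
  rewrite -preimage_bigcup (_ : \bigcup_k _ = setT) ?preimage_setT//.
  apply/seteqP; split=> // -[a x] _.
  have [i _ Fia] : (\bigcup_i F i) a by rewrite -FT.
  have [j _ Gjx] : (\bigcup_i G i) x by rewrite -GT.
  exists (maxn i j) => //; split => /=.
    by move: a Fia; exact/subsetPset/ndF/leq_maxl.
  by move: x Gjx; exact/subsetPset/ndG/leq_maxr.
move=> k; have [mF Fk] := Foo k; have [mG Gk] := Goo k; split.
  rewrite -[X in measurable X]setTI; apply: measurable_rV_uncons => //.
  exact: measurableX.
rewrite /lebesgue_rV_step /pushforward -comp_preimage.
rewrite (_ : _ \o _ = id) ?preimage_id; last by apply/funext; exact: rV_consK.
by rewrite product_measure1E// lte_mul_pinfty// ge0_fin_numE.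
Qed.

HB.instance Definition _ := Measure_isSigmaFinite.Build _ _ _ lebesgue_rV_step
  step_sigma_finite.

End lebesgue_rV_step.

(* n-dimensional Lebesgue measure, by iterated products. *)
Fixpoint lebesgue_rV {R : realType} (n : nat) :
    {sigma_finite_measure set 'rV[R]_n -> \bar R} :=
  match n with
  | 0 => \d_(0 : 'rV[R]_0)
  | m.+1 => lebesgue_rV_step (lebesgue_rV m)
  end.

Lemma lebesgue_rV_box {R : realType} n (A : 'I_n -> set R) :
  (forall i, measurable (A i)) ->
  (lebesgue_rV n [set x | forall i, A i (x ord0 i)] =
   \prod_(i < n) lebesgue_measure (A i))%E.
Proof.
elim: n A => [|n IHn] A mA.
  by rewrite big_ord0 /= diracE mem_set// => -[].
rewrite big_ord_recl -IHn//= /lebesgue_rV_step /pushforward.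
rewrite (_ : _ @^-1` _ = A ord0 `*`
    [set x : 'rV[R]_n | forall i, A (lift ord0 i) (x ord0 i)]).
  rewrite product_measure1E//; first exact: mA.
  have -> : [set x : 'rV[R]_n | forall i, A (lift ord0 i) (x ord0 i)] =
      \bigcap_(i in [set: 'I_n])
        ((fun x : 'rV[R]_n => x ord0 i) @^-1` A (lift ord0 i)).
    by apply/seteqP; split=> [x xA i _|x xA i] /=; [exact: xA|exact: (xA i)].
  apply: fin_bigcap_measurable => // i _.
  by rewrite -[X in measurable X]setTI; exact: measurable_rV_coord.
apply/seteqP; split=> -[a x] /=.
  move=> H; split=> [|i]; first by have := H ord0; rewrite rV_cons0.
  by have := H (lift ord0 i); rewrite rV_consS.
move=> [Aa Ax] i; have [j ->|->] := unliftP ord0 i; last by rewrite rV_cons0.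
by rewrite rV_consS; exact: Ax.
Qed.

Section schwartz_functions.
Context {R : realType} {n : nat}.
Implicit Types (f : 'rV[R]_n -> R) (i : 'I_n) (s : seq 'I_n).

Definition pderiv i f : 'rV[R]_n -> R := fun x => 'D_(delta_mx ord0 i) f x.

Definition iter_pderiv s f : 'rV[R]_n -> R := foldr pderiv f s.

Definition smooth f := forall s,
  continuous (iter_pderiv s f) /\
  forall i x, derivable (iter_pderiv s f) x (delta_mx ord0 i).

Definition real_schwartz f := smooth f /\
  forall (b : 'I_n -> nat) s, exists C : R, forall x : 'rV[R]_n,
    `|(\prod_(i < n) x ord0 i ^+ b i) * iter_pderiv s f x| <= C.

(* f is Schwartz iff its real and imaginary parts are. *)
Definition schwartz (f : 'rV[R]_n -> R[i]) :=
  real_schwartz (fun x => complex.Re (f x)) /\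
  real_schwartz (fun x => complex.Im (f x)).

End schwartz_functions.

Section fourier_transform.
Context {R : realType}.

Definition dotv n (x y : 'rV[R]_n) : R := \sum_(i < n) x ord0 i * y ord0 i.

Definition enorm n (x : 'rV[R]_n) : R := Num.sqrt (dotv x x).

Definition expi (theta : R) : R[i] := cos theta +i* sin theta.

Definition complex_integral d (T : measurableType d)
    (mu : {measure set T -> \bar R}) (f : T -> R[i]) : R[i] :=
  (\int[mu]_x complex.Re (f x)) +i* (\int[mu]_x complex.Im (f x)).

(* Unitary normalisation, (2 pi)^(-n/2) in both directions; with the kernel
   exp(-i x.xi), the gradient corresponds to multiplication by i xi. *)
Definition fourier n (f : 'rV[R]_n -> R[i]) (xi : 'rV[R]_n) : R[i] :=
  ((2 * pi) `^ (- (n%:R / 2)))%:C *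
  complex_integral (lebesgue_rV n) (fun x => expi (- dotv x xi) * f x).

Definition inverse_fourier n (g : 'rV[R]_n -> R[i]) (x : 'rV[R]_n) : R[i] :=
  ((2 * pi) `^ (- (n%:R / 2)))%:C *
  complex_integral (lebesgue_rV n) (fun xi => expi (dotv x xi) * g xi).

Definition fourier_multiplier n (m f : 'rV[R]_n -> R[i]) : 'rV[R]_n -> R[i] :=
  inverse_fourier (fun xi => m xi * fourier f xi).

(* |nabla|^alpha; for alpha = 0 the symbol is identically 1, as 0 `^ 0 = 1. *)
Definition abs_grad n (alpha : R) : ('rV[R]_n -> R[i]) -> 'rV[R]_n -> R[i] :=
  fourier_multiplier (fun xi => (enorm xi `^ alpha)%:C).

Definition sobolev_norm n (s : R) (f : 'rV[R]_n -> R[i]) : \bar R :=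
  Lnorm (lebesgue_rV n) 2%:E (fun xi =>
    ((1 + enorm xi ^+ 2) `^ (s / 2) * Normc.normc (fourier f xi))%:E).

Definition mixed_norm n (p q : \bar R) (F : R -> 'rV[R]_n -> R[i]) : \bar R :=
  Lnorm lebesgue_measure p (fun t =>
    Lnorm (lebesgue_rV n) q (fun x => (Normc.normc (F t x))%:E)).

End fourier_transform.

Section evolution.
Context {R : realType} {n : nat}.

(* A function of (x, y, z) in R^n x R^n x R^n is a function on R^(n + (n + n)). *)
Definition triple (x y z : 'rV[R]_n) : 'rV[R]_(n + (n + n)) :=
  row_mx x (row_mx y z).

Definition schrodinger_symbol (t : R) (w : 'rV[R]_(n + (n + n))) : R[i] :=
  let xi := lsubmx w in
  let eta := lsubmx (rsubmx w) in
  let zeta := rsubmx (rsubmx w) in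
  expi (- (t * (enorm xi ^+ 2 + enorm eta ^+ 2 - enorm zeta ^+ 2) / 2)).

(* exp(i t (Delta_x + Delta_y - Delta_z) / 2) *)
Definition schrodinger_flow (t : R) (G0 : 'rV[R]_(n + (n + n)) -> R[i]) :
    'rV[R]_(n + (n + n)) -> R[i] :=
  fourier_multiplier (schrodinger_symbol t) G0.

End evolution.

(* Main.v *)
(* Let G0 be a sum of N Gaussian packets with signs. The parallelogram law gives
   signs for which the H^s norm is O(N^(1/2)). Each packet, evolved and restricted
   to the diagonal, is an explicit Gaussian in x that is of size one near one
   point of space-time and, after applying |nabla|^alpha, small away from it:
   its amplitude is a negative power of |t|, and its kernel tends to 0 in x by
   the Riemann-Lebesgue argument. Spreading the N focal points over distant times
   makes the mixed norm at least c N^(1/p), whatever q; spreading them over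
   distant places makes it at least c N^(1/q), whatever p. As N grows this forces
   1/p <= 1/2 and 1/q <= 1/2. *)

From HB Require Import structures.
Require Import Defs.
From mathcomp Require Import all_boot all_order all_algebra.
From mathcomp Require Import complex ring lra.
From mathcomp Require Import all_classical all_reals all_analysis measurable_realfun.

Set Implicit Arguments.
Unset Strict Implicit.
Unset Printing Implicit Defensive.

Import Order.TTheory GRing.Theory Num.Theory.
Import numFieldNormedType.Exports.

Local Open Scope classical_set_scope.
Local Open Scope ring_scope.
Local Open Scope complex_scope.

(** The symbol |xi|^alpha destroys the closed form of the diagonal Gaussian, whose frequency profile
    also varies with time. Two bounds keep it under control. The rate [decay t] of the profile is at
    least 1/3 for every t, so the kernels are bounded uniformly in time and a dispersed packet is
    small through its amplitude alone. For |t| <= 1, [decay] is at most 1 and |[twist t]| at most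
    |t|, so lower bounds near the focus and decay in space are uniform in t. No rate of decay is
    needed: packets may be as far apart as N requires, because neither the Sobolev bound nor the
    main term depends on their positions. Smallness c / (2 N) of each unwanted term is enough. The
    signs replace an estimate of the cross terms between packets in H^s. They depend on the
    positions, so positions are fixed first and the lower bounds hold for every choice of signs.
    Complex Gaussians are parametrised by a square root [l] of their quadratic coefficient, taken in
    the sector |arg l| < pi / 4. This settles the branch in the Gaussian integral, and moduli of
    products of roots are read off from even powers. *)

Section complex_exponential.
Context {R : realType}.
Implicit Types (a b : R) (z w : R[i]).

Definition cexp z : R[i] :=
  (expR (complex.Re z) * cos (complex.Im z)) +i*
  (expR (complex.Re z) * sin (complex.Im z)).

Lemma cexpD z w : cexp (z + w) = cexp z * cexp w.
Proof.
case: z w => [a b] [c d]; rewrite /cexp /=; simpc.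
by rewrite expRD cosD sinD; congr (_ +i* _); ring.
Qed.

Lemma cexp0 : cexp 0 = 1.
Proof. by rewrite /cexp /= expR0 cos0 sin0 mul1r mulr0. Qed.

Lemma cexp_sum I (r : seq I) (F : I -> R[i]) :
  cexp (\sum_(i <- r) F i) = \prod_(i <- r) cexp (F i).
Proof. exact: (big_morph cexp cexpD cexp0). Qed.

Lemma expiE a : expi a = cexp (0 +i* a).
Proof. by rewrite /cexp /= expR0 !mul1r. Qed.

Lemma cexp_real a : cexp a%:C = (expR a)%:C.
Proof. by rewrite /cexp /= cos0 sin0 mulr1 mulr0. Qed.

Lemma normcE_sqr z : Normc.normc z ^+ 2 = complex.Re z ^+ 2 + complex.Im z ^+ 2.
Proof. by case: z => a b /=; rewrite sqr_sqrtr// addr_ge0// sqr_ge0. Qed.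

Lemma normc_ge0 z : 0 <= Normc.normc z.
Proof. by case: z => a b; exact: sqrtr_ge0. Qed.

Lemma normc_eqr z a : 0 <= a ->
  complex.Re z ^+ 2 + complex.Im z ^+ 2 = a ^+ 2 -> Normc.normc z = a.
Proof.
by move=> a0 h; apply/eqP; rewrite -(eqrXn2 (n := 2))// ?normc_ge0// normcE_sqr h.
Qed.

Lemma normc_real a : Normc.normc a%:C = `|a|.
Proof. by apply: normc_eqr => //=; rewrite real_normK ?num_real// expr0n addr0. Qed.

Lemma normc_cexp z : Normc.normc (cexp z) = expR (complex.Re z).
Proof.
apply: normc_eqr; first exact: expR_ge0.
by rewrite /= !exprMn -mulrDr cos2Dsin2 mulr1.
Qed.

Lemma normr_Re_normc z : `|complex.Re z| <= Normc.normc z.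
Proof.
rewrite -(ler_pXn2r (n := 2)) ?nnegrE ?normc_ge0// normcE_sqr.
by rewrite real_normK ?num_real// lerDl sqr_ge0.
Qed.

Lemma normr_Im_normc z : `|complex.Im z| <= Normc.normc z.
Proof.
rewrite -(ler_pXn2r (n := 2)) ?nnegrE ?normc_ge0// normcE_sqr.
by rewrite real_normK ?num_real// lerDr sqr_ge0.
Qed.

Lemma normc_le_ReIm z : Normc.normc z <= `|complex.Re z| + `|complex.Im z|.
Proof.
rewrite -(ler_pXn2r (n := 2)) ?nnegrE ?normc_ge0 ?addr_ge0// normcE_sqr.
rewrite sqrrD !real_normK ?num_real// -addrA lerD2l -[leLHS]add0r lerD2r.
by rewrite mulrn_wge0// mulr_ge0.
Qed.

Lemma normc_prod I (r : seq I) (F : I -> R[i]) :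
  Normc.normc (\prod_(i <- r) F i) = \prod_(i <- r) Normc.normc (F i).
Proof. by rewrite (big_morph _ (@Normc.normcM R) (@Normc.normc1 R)). Qed.

Lemma normc_sum I (r : seq I) (P : pred I) (F : I -> R[i]) :
  Normc.normc (\sum_(i <- r | P i) F i) <= \sum_(i <- r | P i) Normc.normc (F i).
Proof.
elim/big_ind2 : _ => [|x1 x2 y1 y2 h1 h2|//]; first by rewrite Normc.normc0.
by apply: (le_trans (le_normcD _ _)); exact: lerD.
Qed.

Lemma cReD z w : complex.Re (z + w) = complex.Re z + complex.Re w.
Proof. by case: z; case: w. Qed.
Lemma cImD z w : complex.Im (z + w) = complex.Im z + complex.Im w.
Proof. by case: z; case: w. Qed.
Lemma cReM z w : complex.Re (z * w) =
  complex.Re z * complex.Re w - complex.Im z * complex.Im w.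
Proof. by case: z; case: w. Qed.
Lemma cImM z w : complex.Im (z * w) =
  complex.Re z * complex.Im w + complex.Im z * complex.Re w.
Proof. by case: z; case: w. Qed.

End complex_exponential.

(** * One-dimensional Gaussian integrals with complex parameters *)

Section gaussian_path.
Context {R : realType}.
Variables u v r w p1 p2 : R.

Let U s : R := 1 + s * (u - 1).
Let V s : R := s * v.
Let X s y : R := U s * y + s * r.
Let Y s y : R := V s * y + s * w.
Let dX y : R := (u - 1) * y + r.
Let dY y : R := v * y + w.
Let E s y : R := expR (- (X s y ^+ 2 - Y s y ^+ 2) / 2).
Let Q s y : R := X s y * Y s y.

Let osc a b s y : R := E s y * (a * cos (Q s y) + b * sin (Q s y)).

(* With z = (1 + s (l - 1)) y + s m, l = u + i v and m = r + i w, this is the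
   real part of (p1 + i p2) (dz/dy) exp(- z^2 / 2): the integrals over the lines
   joining R (s = 0) to l R + m (s = 1) agree by Cauchy's theorem, which amounts
   to the s-derivative [dgpath] being the y-derivative of [gpath_prim]. *)
Definition gpath s y : R :=
  osc (p1 * U s - p2 * V s) (p1 * V s + p2 * U s) s y.
Definition gpath_prim s y : R :=
  osc (p1 * dX y - p2 * dY y) (p1 * dY y + p2 * dX y) s y.

Let c1 s y : R := (u - 1) - (U s * (X s y * dX y - Y s y * dY y)
                             - V s * (X s y * dY y + Y s y * dX y)).
Let c2 s y : R := v - (U s * (X s y * dY y + Y s y * dX y)
                             + V s * (X s y * dX y - Y s y * dY y)).
Definition dgpath s y : R :=
  osc (p1 * c1 s y - p2 * c2 s y) (p1 * c2 s y + p2 * c1 s y) s y.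

Lemma is_derive_gpath (s y : R) : is_derive s (1 : R) (gpath ^~ y) (dgpath s y).
Proof.
rewrite /gpath /dgpath /osc /c1 /c2 /Q /E /X /Y /dX /dY /U /V.
apply: is_derive_eq; rewrite /GRing.scale /=.
set C := cos _; set S := sin _; set Ex := expR _.
by field.
Qed.

Lemma is_derive_gpath_prim (s y : R) :
  is_derive y (1 : R) (gpath_prim s) (dgpath s y).
Proof.
rewrite /gpath_prim /dgpath /osc /c1 /c2 /Q /E /X /Y /dX /dY /U /V.
apply: is_derive_eq; rewrite /GRing.scale /=.
set C := cos _; set S := sin _; set Ex := expR _.
by field.
Qed.

Let nM (a b A B : R) : `|a| <= A -> `|b| <= B -> `|a * b| <= A * B.
Proof. by move=> ha hb; rewrite normrM ler_pM. Qed.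
Let nD (a b A B : R) : `|a| <= A -> `|b| <= B -> `|a + b| <= A + B.
Proof. by move=> ha hb; apply: (le_trans (ler_normD _ _)); exact: lerD. Qed.
Let nB (a b A B : R) : `|a| <= A -> `|b| <= B -> `|a - b| <= A + B.
Proof. by move=> ha hb; apply: (le_trans (ler_normB _ _)); exact: lerD. Qed.

Let osc_le a b s y A : `|a| <= A -> `|b| <= A ->
  `|osc a b s y| <= E s y * (A + A).
Proof.
move=> ha hb; rewrite /osc normrM ger0_norm ?expR_ge0//.
apply: ler_wpM2l; first exact: expR_ge0.
rewrite -{1}[A]mulr1 -{2}[A]mulr1; apply: nD; apply: nM => //.
  by rewrite ler_norml cos_geN1 cos_le1.
by rewrite ler_norml sin_geN1 sin_le1.
Qed.

(** The leading coefficient of Re z^2 in y is U^2 - V^2 >= m^2. Half of the resulting decay exp(-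
    m^2 y^2 / 2) absorbs the linear terms and the polynomial prefactors. The constant is free of s,
    as differentiation under the integral requires. *)
Lemma gpath_dominated (m : R) : 0 < m -> exists2 C : R, 0 <= C &
  forall s y, `|s| <= 2 -> m <= U s - `|V s| ->
  [/\ `|gpath s y| <= C * expR (- (m * y) ^+ 2 / 4),
      `|gpath_prim s y| <= C * expR (- (m * y) ^+ 2 / 4) &
      `|dgpath s y| <= C * expR (- (m * y) ^+ 2 / 4)].
Proof.
move=> m0.
(* [B] bounds U and V, and B (1 + |y|) bounds X, Y and their s-derivatives; the factor 3 makes room
   for |s| <= 2. *)
pose B : R := 3 * (2 + `|u| + `|v| + `|r| + `|w|).
pose P : R := 1 + `|p1| + `|p2|.
have [u0 v0 r0 w0] : [/\ 0 <= `|u|, 0 <= `|v|, 0 <= `|r| & 0 <= `|w|] by split.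
have [p10 p20] : 0 <= `|p1| /\ 0 <= `|p2| by split.
have B1 : 1 <= B by rewrite /B; lra.
have B0 : 0 <= B by lra.
have hr3 : `|r| <= B / 3 by rewrite /B; lra.
have hw3 : `|w| <= B / 3 by rewrite /B; lra.
have P1 : 1 <= P by rewrite /P; lra.
have P0 : 0 <= P by lra.
(* Total linear growth of the exponent: 4 B^2 |y| from the cross terms of Re z^2 / 2, and 2 |y| from
   (1 + |y|)^2 <= exp(2 |y|). *)
pose K : R := 4 * B ^+ 2 + 2.
pose C0 : R := P * (B + 4 * B ^+ 3) * 4.
exists (C0 * expR (K ^+ 2 / m ^+ 2 + 4 * B ^+ 2)).
  by rewrite mulr_ge0 ?expR_ge0// !mulr_ge0// addr_ge0// mulr_ge0// exprn_ge0.
move=> s y s2 mUV.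
pose T := 1 + `|y|.
have y0 : 0 <= `|y| by [].
have T1 : 1 <= T by rewrite /T; lra.
have T0 : 0 <= T by lra.
have hs : s <= 2 /\ - 2 <= s by move: s2; rewrite ler_norml => /andP[].
have hu1 : `|u - 1| <= `|u| + 1 by apply: nB; rewrite ?normr1.
have hU : `|U s| <= B.
  have : `|U s| <= 1 + 2 * (`|u| + 1) by apply: nD; [rewrite normr1|exact: nM].
  move=> /le_trans; apply; rewrite /B; lra.
have hV : `|V s| <= B.
  have : `|V s| <= 2 * `|v| by apply: nM.
  move=> /le_trans; apply; rewrite /B; lra.
have hX : `|X s y| <= (1 + 2 * (`|u| + 1)) * `|y| + 2 * `|r|.
  apply: nD; last exact: nM.
  by apply: nM => //; apply: nD; [rewrite normr1|exact: nM].
have {}hX : `|X s y| <= B * T.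
  apply: (le_trans hX); rewrite /B /T; nra.
have hY : `|Y s y| <= (2 * `|v|) * `|y| + 2 * `|w|.
  by apply: nD; [apply: nM => //; exact: nM | exact: nM].
have {}hY : `|Y s y| <= B * T by apply: (le_trans hY); rewrite /B /T; nra.
have hdX : `|dX y| <= B * T.
  have : `|dX y| <= (`|u| + 1) * `|y| + `|r| by apply: nD => //; exact: nM.
  by move/le_trans; apply; rewrite /B /T; nra.
have hdY : `|dY y| <= B * T.
  have : `|dY y| <= `|v| * `|y| + `|w| by apply: nD => //; exact: nM.
  by move/le_trans; apply; rewrite /B /T; nra.
have hp1 : `|p1| <= P by rewrite /P; lra.
have hp2 : `|p2| <= P by rewrite /P; lra.
pose A := (B + 4 * B ^+ 3) * T ^+ 2.
have T2 : 1 <= T ^+ 2 by rewrite expr2; nra.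
have TT2 : T <= T ^+ 2 by rewrite expr2; nra.
have B3 : 0 <= B ^+ 3 by rewrite exprn_ge0.
have BA : B <= A by rewrite /A; nra.
have BTA : B * T <= A.
  apply: (@le_trans _ _ (B * T ^+ 2)); first by rewrite ler_wpM2l.
  rewrite /A ler_wpM2r ?lerDl ?mulr_ge0//; lra.
have hc1 : `|c1 s y| <= A.
  have hu2 : `|u - 1| <= B by apply: (le_trans hu1); rewrite /B; lra.
  have : `|c1 s y| <= B + (B * (B * T * (B * T) + B * T * (B * T)) +
                    B * (B * T * (B * T) + B * T * (B * T))).
    apply: nB => //; apply: nB; apply: nM => //.
      by apply: nB; apply: nM.
    by apply: nD; apply: nM.
  move/le_trans; apply.
  rewrite /A [leRHS](_ : _ = B * T ^+ 2 + 4 * B ^+ 3 * T ^+ 2); last by ring.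
  rewrite [leLHS](_ : _ = B + 4 * B ^+ 3 * T ^+ 2); last by ring.
  by rewrite lerD2r ler_peMr.
have hc2 : `|c2 s y| <= A.
  have hu2 : `|v| <= B by rewrite /B; lra.
  have : `|c2 s y| <= B + (B * (B * T * (B * T) + B * T * (B * T)) +
                    B * (B * T * (B * T) + B * T * (B * T))).
    apply: nB => //; apply: nD; apply: nM => //.
      by apply: nD; apply: nM.
    by apply: nB; apply: nM.
  move/le_trans; apply.
  rewrite /A [leRHS](_ : _ = B * T ^+ 2 + 4 * B ^+ 3 * T ^+ 2); last by ring.
  rewrite [leLHS](_ : _ = B + 4 * B ^+ 3 * T ^+ 2); last by ring.
  by rewrite lerD2r ler_peMr.
have A0 : 0 <= A by apply: le_trans BA.
suff main : E s y * ((P * A + P * A) + (P * A + P * A)) <=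
    C0 * expR (K ^+ 2 / m ^+ 2 + 4 * B ^+ 2) * expR (- (m * y) ^+ 2 / 4).
  split; apply: (le_trans _ main); apply: osc_le.
  - by apply: nB; apply: nM => //; apply: (le_trans _ BA).
  - by apply: nD; apply: nM => //; apply: (le_trans _ BA).
  - by apply: nB; apply: nM => //; apply: (le_trans _ BTA).
  - by apply: nD; apply: nM => //; apply: (le_trans _ BTA).
  - by apply: nB; apply: nM.
  - by apply: nD; apply: nM.
have -> : (P * A + P * A) + (P * A + P * A) = C0 * T ^+ 2 by rewrite /C0 /A; ring.
rewrite mulrCA -mulrA.
have C00 : 0 <= C0 by rewrite /C0 !mulr_ge0// addr_ge0// mulr_ge0.
apply: ler_wpM2l => //.
have hT : T ^+ 2 <= expR (2 * `|y|).
  rewrite expRM_natl.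
  by rewrite ler_pXn2r ?nnegrE ?expR_ge0//; exact: expR_ge1Dx.
apply: (@le_trans _ _ (E s y * expR (2 * `|y|))).
  by apply: ler_wpM2l => //; exact: expR_ge0.
rewrite /E -!expRD ler_expR.
have hXY : m ^+ 2 * y ^+ 2 - 8 * B ^+ 2 * `|y| - 8 * B ^+ 2 <= X s y ^+ 2 - Y s y ^+ 2.
  have -> : X s y ^+ 2 - Y s y ^+ 2 = (U s ^+ 2 - V s ^+ 2) * y ^+ 2 +
     2 * (s * (U s * r - V s * w)) * y + s ^+ 2 * (r ^+ 2 - w ^+ 2).
    by rewrite /X /Y; ring.
  have h1 : m ^+ 2 * y ^+ 2 <= (U s ^+ 2 - V s ^+ 2) * y ^+ 2.
    apply: ler_wpM2r; first exact: sqr_ge0.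
    rewrite -[V s ^+ 2]real_normK ?num_real// subr_sqr expr2.
    apply: ler_pM => //; [exact: ltW|exact: ltW|].
    by apply: (le_trans mUV); rewrite lerD2l (ge0_cp (normr_ge0 _)).2.
  have h2 : `|2 * (s * (U s * r - V s * w)) * y| <= 2 * (2 * (B * (B / 3) + B * (B / 3))) * `|y|.
    apply: nM => //; apply: nM; first by rewrite ger0_norm.
    by apply: nM => //; apply: nB; apply: nM.
  have h3 : `|s ^+ 2 * (r ^+ 2 - w ^+ 2)| <= (2 * 2) * (B / 3 * (B / 3) + B / 3 * (B / 3)).
    by rewrite !expr2; apply: nM; [exact: nM|apply: nB; apply: nM].
  move: h2 h3; rewrite !ler_norml => /andP[h2 _] /andP[h3 _].
  have : 0 <= B ^+ 2 * `|y| by rewrite mulr_ge0 ?sqr_ge0.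
  have : 0 <= B ^+ 2 by rewrite sqr_ge0.
  nra.
(* This spends half of the available m^2 y^2 / 2. *)
have hK : K * `|y| <= (m * y) ^+ 2 / 4 + K ^+ 2 / m ^+ 2.
  have := sqr_ge0 (m * `|y| / 2 - K / m).
  rewrite sqrrB [m * _ / 2 * (K / m)](_ : _ = K * `|y| / 2); last first.
    by field; rewrite gt_eqF.
  rewrite !expr_div_n !exprMn real_normK ?num_real// -mulr_natr => h.
  lra.
rewrite exprMn in hK *.
rewrite /K in hK *.
move: hK; set y2 := y ^+ 2; set m2 := m ^+ 2.
move: hXY; rewrite -/y2 -/m2; set kk := (_ / m2).
move=> h4 h5.
lra.
Qed.
End gaussian_path.

(** * Integrals of derivatives over the real line *)

Section whole_line.
Context {R : realType}.
Notation mu := (@lebesgue_measure R).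

Lemma is_derive_continuous (f df : R -> R) :
  (forall y : R, is_derive y (1 : R) f (df y)) -> continuous f.
Proof.
move=> h y; apply: differentiable_continuous; apply/derivable1_diffP.
exact: ex_derive.
Qed.

(** Up to a constant, this is the normal density of standard deviation sqrt 2 / m. *)
Lemma integrable_gauss_bound (C m : R) : 0 < m ->
  mu.-integrable setT (EFin \o (fun y => C * expR (- (m * y) ^+ 2 / 4))).
Proof.
move=> m0; pose s := Num.sqrt 2 / m.
have s0 : s != 0 by rewrite gt_eqF// divr_gt0// sqrtr_gt0.
have := integrableZl measurableT (C / normal_peak s) (integrable_normal_pdf 0 s).
apply: eq_integrable => // y _ /=; rewrite -EFinM normal_pdfE// mulrA divfK; last first.
  by rewrite gt_eqF// normal_peak_gt0.
rewrite /normal_fun subr0 -[_ *+ 2]mulr_natr exprMn exprVn sqr_sqrtr//.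
by congr (_ * expR _)%:E; field; rewrite gt_eqF.
Qed.

(** The fundamental theorem of calculus on [-n, n], then dominated convergence with |f| itself as
    the dominating function. *)
Lemma Rintegral_derive_eq0 (F f : R -> R) :
  (forall y : R, is_derive y (1 : R) F (f y)) -> continuous f ->
  mu.-integrable setT (EFin \o f) ->
  F n%:R @[n --> \oo] --> 0 -> F (- n%:R) @[n --> \oo] --> 0 ->
  \int[mu]_y f y = 0.
Proof.
move=> dF cf intf Fy FNy.
have cF : continuous F by exact: is_derive_continuous dF.
have mf : measurable_fun setT f by exact: continuous_measurable_fun.
pose f_ (n : nat) : R -> \bar R := (EFin \o f) \_ `[(- n%:R), n%:R].
have [|||||_ _ +] := @dominated_convergence _ _ R mu setT measurableT f_
    (EFin \o f) (abse \o (EFin \o f)).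
- move=> n; apply: (measurable_int mu); rewrite /f_.
  have mI : measurable `[(- n%:R : R), n%:R]%classic by [].
  have h : mu.-integrable `[(- n%:R : R), n%:R]%classic (EFin \o f).
    exact: (integrableS measurableT).
  have := iffLR (@integrable_mkcond _ _ R mu _ (EFin \o f) mI) h.

  exact.
- exact/measurable_EFinP.
- apply: nearW => y _; apply: cvg_near_cst.
  have [N hN] : exists N : nat, `|y| <= N%:R by exists (Num.truncn `|y|).+1; exact/ltW/truncnS_gt.
  exists N => // n /= Nn; rewrite /f_ patchE mem_set//= in_itv/= -ler_norml.
  by rewrite (le_trans hN)// ler_nat.
- exact: integrable_abse.
- apply: nearW => y n _; rewrite /f_ patchE; case: ifP => //= _.
  by rewrite normr0 lee_fin.
move=> h.
have {}h : (F n%:R - F (- n%:R))%:E @[n --> \oo] --> (\int[mu]_y (f y)%:E)%E.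
  apply: cvg_trans h; apply: near_eq_cvg; exists 1%N => // n /= n1.
  rewrite -integral_mkcond (@continuous_FTC2 _ f F)//.
  - by rewrite gtrN// ltr0n.
  - exact: continuous_subspaceT.
  - split.
    + by move=> y _; exact: ex_derive.
    + exact/cvg_at_right_filter/cF.
    + exact/cvg_at_left_filter/cF.
  - by move=> y _; rewrite derive1E; exact: derive_val.
have h0 : (F n%:R - F (- n%:R))%:E @[n --> \oo] --> 0%:E.
  by apply: cvg_EFin; [exact: nearW|]; rewrite -[X in _ --> X](subrr (0:R)); exact: cvgB.
by rewrite /Rintegral (cvg_unique _ h h0).
Qed.

End whole_line.

(** * Moving the line of integration *)

Section gaussian_path_integral.
Context {R : realType}.
Notation mu := (@lebesgue_measure R).
Variables u v r w p1 p2 : R.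
Hypothesis uv : `|v| < u.

Let f := gpath u v r w p1 p2.

(** On [0, 1] the quantity is a convex combination of 1 and u - |v|, hence at least [m0]; its
    variation has rate below [k], so [m0 / 2] survives on a slightly larger open interval. Openness
    is needed to differentiate in s at the endpoints 0 and 1, and e <= 1 ensures |s| <= 2. *)
Let cone : exists2 m : R, 0 < m & exists2 e : R, 0 < e <= 1 &
  forall s, - e < s < 1 + e -> m <= 1 + s * (u - 1) - `|s * v|.
Proof.
pose m0 := Num.min 1 (u - `|v|).
have m00 : 0 < m0 by rewrite lt_min ltr01 subr_gt0.
have m01 : m0 <= 1 by rewrite ge_min lexx.
have m0u : m0 <= u - `|v| by rewrite ge_min lexx orbT.
pose k := `|u - 1| + `|v| + 1.
have k1 : 1 <= k by rewrite /k lerDr addr_ge0.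
exists (m0 / 2); first by rewrite divr_gt0.
have k0 : 0 < k by apply: lt_le_trans k1.
have ek : m0 / 2 / k * k = m0 / 2 by rewrite divfK// gt_eqF.
have e0 : 0 < m0 / 2 / k by rewrite !divr_gt0.
have e1 : m0 / 2 / k <= 1.
  rewrite ler_pdivrMr// mul1r; apply: le_trans k1; lra.
exists (m0 / 2 / k); first by rewrite e0.
move: ek e0 e1; set e := m0 / 2 / k => ek e0 e1 s /andP[s1 s2].
have tk t : 0 <= t -> t <= e -> t * `|u - 1| + t * `|v| <= m0 / 2.
  move=> t0 te; rewrite -ek.
  have : t * k <= e * k by rewrite ler_wpM2r// ltW.
  by rewrite /k !mulrDr mulr1; move: (m0) => ? ?; lra.
have [s0|s0] := lerP 0 s; last first.
  have := tk (- s); rewrite oppr_ge0 (ltW s0) => /(_ isT).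
  have -> : - s <= e by rewrite lerNl ltW.
  move=> /(_ isT).
  have : s * (u - 1) >= - (- s * `|u - 1|).
    rewrite mulNr opprK ler_wnM2l ?ler_norm//; exact: ltW.
  rewrite normrM (ltr0_norm s0); move: (s * (u - 1)) (- s * _) (- s * _) m01 => *.
  lra.
have [s3|s3] := lerP s 1.
  rewrite normrM ger0_norm//.
  have h1 : (1 - s) * m0 <= 1 - s by rewrite ler_piMr// subr_ge0.
  have h2 : s * m0 <= s * (u - `|v|) by rewrite ler_wpM2l.
  nra.
have := tk (s - 1); rewrite subr_ge0 (ltW s3) => /(_ isT).
have -> : s - 1 <= e by rewrite lerBlDl ltW.
move=> /(_ isT).
have : (s - 1) * (u - 1) >= - ((s - 1) * `|u - 1|).
  rewrite -mulrN ler_wpM2l//; first by rewrite subr_ge0 ltW.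
  by rewrite lerNl -normrN ler_norm.
rewrite normrM (ger0_norm s0).
set a := (s - 1) * _; set b := (s - 1) * (u - 1); set c := (s - 1) * `|v|.
have -> : s * (u - 1) = u - 1 + b by rewrite /b; ring.
have -> : s * `|v| = `|v| + c by rewrite /c; ring.
by move=> ? ?; lra.
Qed.

Let continuous_y s : continuous (f s).
Proof.
suff /is_derive_continuous : forall y : R, is_derive y (1 : R) (f s) ('D_1 (f s) y) by [].
move=> y; exact: DeriveDef.
Qed.

Let continuous_dgpath s : continuous (dgpath u v r w p1 p2 s).
Proof.
suff /is_derive_continuous : forall y : R,
  is_derive y (1 : R) (dgpath u v r w p1 p2 s) ('D_1 (dgpath u v r w p1 p2 s) y) by [].
move=> y; exact: DeriveDef.
Qed.

Local Opaque gpath gpath_prim dgpath.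

Let gauss_cvg0 (C m : R) (F : R -> R) (t : nat -> R) : 0 < m ->
  (forall n, t n ^+ 2 = n%:R ^+ 2) ->
  (forall y, `|F y| <= C * expR (- (m * y) ^+ 2 / 4)) ->
  F (t n) @[n --> \oo] --> 0.
Proof.
move=> m0 tn FC.
(* Small enough for c (x + 1) <= 1 + m^2 x^2 / 4, which compares the Gaussian at x = n with the
   harmonic sequence. *)
pose c := Num.min 1 (m ^+ 2 / 4) / 2.
have c0 : 0 < c by rewrite divr_gt0// lt_min ltr01 divr_gt0// exprn_gt0.
have c1 : c * 2 <= 1 by rewrite divfK// ge_min lexx.
have c2 : c * 2 <= m ^+ 2 / 4 by rewrite divfK// ge_min lexx orbT.
clearbody c.
have C0 : 0 <= C.
  have := le_trans (normr_ge0 _) (FC 0).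
  by rewrite pmulr_lge0 ?expR_gt0.
have hb n : `|F (t n)| <= C / c * n.+1%:R^-1.
  apply: (le_trans (FC _)); rewrite -mulrA; apply: ler_wpM2l => //.
  rewrite -invfM mulNr expRN lef_pV2 ?posrE ?expR_gt0 ?mulr_gt0//.
  apply: le_trans (expR_ge1Dx _); rewrite exprMn tn -natr1.
  have : 0 <= n%:R :> R by [].
  move: (n%:R : R) => x x0; nra.
have h : C / c * n.+1%:R^-1 @[n --> \oo] --> (0 : R).
  rewrite -[X in _ --> X](mulr0 (C / c)); apply: cvgM; first exact: cvg_cst.
  exact: cvg_harmonic.
apply/norm_cvg0P; apply: (squeeze_cvgr _ (cvg_cst (0 : R)) h).
by apply: nearW => n; rewrite normr_ge0 hb.
Qed.

Lemma integrable_gpath s : 0 <= s <= 1 -> mu.-integrable setT (EFin \o f s).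
Proof.
move=> /andP[s0 s1]; have [m m0 [e /andP[e0 e1] he]] := cone.
have [C C0 hC] := gpath_dominated u v r w p1 p2 m0.
have mI := @integrable_gauss_bound R C m m0.
apply: (le_integrable measurableT _ _ mI).
  by apply/measurable_EFinP; apply: continuous_measurable_fun; exact: continuous_y.
move=> y _ /=; rewrite lee_fin.
rewrite [leRHS]ger0_norm ?mulr_ge0 ?expR_ge0//.
have [] // := hC s y; first by rewrite ger0_norm//; lra.
by apply: he; apply/andP; split; lra.
Qed.

Lemma Rintegral_dgpath s : 0 <= s <= 1 -> \int[mu]_y dgpath u v r w p1 p2 s y = 0.
Proof.
move=> /andP[s0 s1]; have [m m0 [e /andP[e0 e1] he]] := cone.
have [C C0 hC] := gpath_dominated u v r w p1 p2 m0.
have hs y : [/\ `|f s y| <= C * expR (- (m * y) ^+ 2 / 4),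
      `|gpath_prim u v r w p1 p2 s y| <= C * expR (- (m * y) ^+ 2 / 4) &
      `|dgpath u v r w p1 p2 s y| <= C * expR (- (m * y) ^+ 2 / 4)].
  by apply: hC; [rewrite ger0_norm//; lra|apply: he; apply/andP; split; lra].
apply: (@Rintegral_derive_eq0 _ (gpath_prim u v r w p1 p2 s)).
- by move=> y; exact: is_derive_gpath_prim.
- exact: continuous_dgpath.
- apply: (le_integrable measurableT _ _ (@integrable_gauss_bound R C m m0)).
    by apply/measurable_EFinP; apply: continuous_measurable_fun; exact: continuous_dgpath.
  move=> y _ /=; rewrite lee_fin.
  by rewrite [leRHS]ger0_norm ?mulr_ge0 ?expR_ge0//; have [] := hs y.
- by apply: (@gauss_cvg0 C m) => // y; have [] := hs y.
- by apply: (@gauss_cvg0 C m) => // [n|y]; [rewrite sqrrN|have [] := hs y].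
Qed.

(** Differentiating under the integral gives the integral of [dgpath], which vanishes because
    [dgpath] is also the y-derivative of a function tending to 0 at both ends. The mean value
    theorem then compares s = 0 and s = 1. *)
Lemma Rintegral_gpath : \int[mu]_y f 1 y = \int[mu]_y f 0 y.
Proof.
have [m m0 [e /andP[e0 e1] he]] := cone.
have [C C0 hC] := gpath_dominated u v r w p1 p2 m0.
have hs s y : - e < s < 1 + e -> [/\ `|f s y| <= C * expR (- (m * y) ^+ 2 / 4),
      `|gpath_prim u v r w p1 p2 s y| <= C * expR (- (m * y) ^+ 2 / 4) &
      `|dgpath u v r w p1 p2 s y| <= C * expR (- (m * y) ^+ 2 / 4)].
  move=> /[dup] /he hm /andP[s0 s1]; apply: hC => //.
  by rewrite ler_norml; apply/andP; split; lra.
have mI := @integrable_gauss_bound R C m m0.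
have G0 y : 0 <= C * expR (- (m * y) ^+ 2 / 4) by rewrite mulr_ge0 ?expR_ge0.
have intf s : `](- e), (1 + e)[%classic s -> mu.-integrable setT (EFin \o f s).
  rewrite /= in_itv /= => hse; apply: (le_integrable measurableT _ _ mI).
    by apply/measurable_EFinP; apply: continuous_measurable_fun; exact: continuous_y.
  move=> y _ /=; rewrite lee_fin [leRHS]ger0_norm//.
  by have [] := hs s y hse.
have derf s y : `](- e), (1 + e)[%classic s -> [set: R] y -> derivable (f ^~ y) s 1.
  by move=> _ _; exact: (@ex_derive _ _ _ _ _ _ _ (is_derive_gpath u v r w p1 p2 s y)).
have p1f s y : partial1of2 f s y = dgpath u v r w p1 p2 s y.
  by rewrite partial1of2E; exact: (@derive_val _ _ _ _ _ _ _ (is_derive_gpath u v r w p1 p2 s y)).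
have ub s y : `](- e), (1 + e)[%classic s -> [set: R] y ->
    `|partial1of2 f s y| <= C * expR (- (m * y) ^+ 2 / 4).
  by rewrite /= in_itv /= p1f => hse _; have [] := hs s y hse.
have sub s : 0 <= s <= 1 -> `](- e), (1 + e)[%classic s.
  by move=> /andP[? ?]; rewrite /= in_itv /=; apply/andP; split; lra.
have dPhi (s : R) : 0 <= s <= 1 -> is_derive s (1 : R) (fun s => \int[mu]_y f s y) 0.
  move=> s01; apply: DeriveDef.
    exact: (derivable_under_integral measurableT (sub s s01) intf derf G0 mI ub).
  rewrite -derive1E (differentiation_under_integral measurableT (sub s s01) intf derf G0 mI ub).
  rewrite -[RHS](Rintegral_dgpath s01).
  by apply: eq_Rintegral => y _; exact: p1f.
have [||c c01] := @MVT_segment R (fun s => \int[mu]_y f s y) (fun=> 0) 0 1 ler01.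
- move=> s; rewrite in_itv/= => /andP[? ?]; apply: dPhi; apply/andP; split; lra.
- apply/continuous_in_subspaceT => s; rewrite inE/= in_itv/= => s01.
  apply: differentiable_continuous; apply/derivable1_diffP.
  exact: (@ex_derive _ _ _ _ _ _ _ (dPhi s s01)).
- by rewrite mul0r => /eqP; rewrite subr_eq0 => /eqP.
Qed.

End gaussian_path_integral.

(** * Integrals of complex-valued functions *)

Section complex_measurable.
Context d (T : measurableType d) {R : realType}.
Implicit Types (f g : T -> R[i]).

Definition cmeasurable f :=
  measurable_fun [set: T] (fun x => complex.Re (f x)) /\
  measurable_fun [set: T] (fun x => complex.Im (f x)).

Lemma cmeasurable_cst c : cmeasurable (fun=> c).
Proof. by split; exact: measurable_cst. Qed.

Lemma cmeasurable_real (h : T -> R) : measurable_fun [set: T] h ->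
  cmeasurable (fun x => (h x)%:C).
Proof. by move=> mh; split => //=; exact: measurable_cst. Qed.

Lemma cmeasurableD f g : cmeasurable f -> cmeasurable g ->
  cmeasurable (fun x => f x + g x).
Proof.
move=> [f1 f2] [g1 g2]; split.
  by under eq_fun do rewrite cReD; exact: measurable_funD.
by under eq_fun do rewrite cImD; exact: measurable_funD.
Qed.

Lemma cmeasurableM f g : cmeasurable f -> cmeasurable g ->
  cmeasurable (fun x => f x * g x).
Proof.
move=> [f1 f2] [g1 g2]; split.
  by under eq_fun do rewrite cReM; apply: measurable_funB; exact: measurable_funM.
by under eq_fun do rewrite cImM; apply: measurable_funD; exact: measurable_funM.
Qed.

Lemma cmeasurable_sum I (r : seq I) (F : I -> T -> R[i]) :
  (forall i, cmeasurable (F i)) -> cmeasurable (fun x => \sum_(i <- r) F i x).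
Proof.
move=> mF; elim: r => [|i r ih].
  by under eq_fun do rewrite big_nil; exact: cmeasurable_cst.
by under eq_fun do rewrite big_cons; exact: cmeasurableD.
Qed.

Lemma cmeasurable_cexp f : cmeasurable f -> cmeasurable (fun x => cexp (f x)).
Proof.
move=> [f1 f2]; split; rewrite /cexp /=; apply: measurable_funM.
- exact: (measurableT_comp (@measurable_expR R)).
- exact: (measurableT_comp (continuous_measurable_fun (@continuous_cos R))).
- exact: (measurableT_comp (@measurable_expR R)).
- exact: (measurableT_comp (continuous_measurable_fun (@continuous_sin R))).
Qed.

Lemma measurable_normc f : cmeasurable f ->
  measurable_fun [set: T] (fun x => Normc.normc (f x)).
Proof.
move=> [f1 f2]; have -> : (fun x => Normc.normc (f x)) =
  (fun x => Num.sqrt (complex.Re (f x) ^+ 2 + complex.Im (f x) ^+ 2)).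
  by apply/funext => x; case: (f x).
apply: (measurableT_comp (continuous_measurable_fun (@sqrt_continuous R))).
by apply: measurable_funD; exact: measurable_funX.
Qed.

End complex_measurable.

Section complex_integrable.
Context d (T : measurableType d) {R : realType}.
Variable mu : {measure set T -> \bar R}.
Implicit Types (f g : T -> R[i]).

Definition cintegrable f :=
  mu.-integrable [set: T] (EFin \o (fun x => complex.Re (f x))) /\
  mu.-integrable [set: T] (EFin \o (fun x => complex.Im (f x))).

Lemma eq_complex_integral f g : f =1 g ->
  complex_integral mu f = complex_integral mu g.
Proof. by move=> /funext ->. Qed.

Lemma cintegrable_measurable f : cintegrable f -> cmeasurable f.
Proof.
by move=> [f1 f2]; split; apply/measurable_EFinP; exact: measurable_int (f1) || exact: measurable_int (f2).
Qed.

Lemma cintegrable_dominated f (g : T -> R) : cmeasurable f ->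
  mu.-integrable [set: T] (EFin \o g) -> (forall x, Normc.normc (f x) <= g x) ->
  cintegrable f.
Proof.
move=> [f1 f2] ig fg; split; apply: (le_integrable measurableT _ _ ig).
- exact/measurable_EFinP.
- move=> x _ /=; rewrite lee_fin (le_trans (normr_Re_normc _))//.
  exact: le_trans (fg x) (ler_norm _).
- exact/measurable_EFinP.
- move=> x _ /=; rewrite lee_fin (le_trans (normr_Im_normc _))//.
  exact: le_trans (fg x) (ler_norm _).
Qed.

Lemma cintegrable_normc f : cintegrable f ->
  mu.-integrable [set: T] (EFin \o (fun x => Normc.normc (f x))).
Proof.
move=> /[dup] /cintegrable_measurable mf [f1 f2].
have := integrableD measurableT (integrable_abse f1) (integrable_abse f2).
apply: le_integrable => //; first exact/measurable_EFinP/measurable_normc.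
move=> x _ /=; rewrite lee_fin ger0_norm ?normc_ge0//.
by rewrite [leRHS]ger0_norm ?addr_ge0// normc_le_ReIm.
Qed.

Lemma cintegrableD f g : cintegrable f -> cintegrable g ->
  cintegrable (fun x => f x + g x).
Proof.
move=> [f1 f2] [g1 g2]; split.
  have := integrableD measurableT f1 g1.
  by apply: eq_integrable => // x _ /=; rewrite cReD EFinD.
have := integrableD measurableT f2 g2.
by apply: eq_integrable => // x _ /=; rewrite cImD EFinD.
Qed.

Lemma complex_integralD f g : cintegrable f -> cintegrable g ->
  complex_integral mu (fun x => f x + g x) =
  complex_integral mu f + complex_integral mu g.
Proof.
move=> [f1 f2] [g1 g2]; rewrite /complex_integral; simpc; congr (_ +i* _).
  by rewrite -RintegralD//; apply: eq_Rintegral => x _; rewrite cReD.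
by rewrite -RintegralD//; apply: eq_Rintegral => x _; rewrite cImD.
Qed.

Lemma cintegrableZ c f : cintegrable f -> cintegrable (fun x => c * f x).
Proof.
move=> [f1 f2]; split.
  have := integrableB measurableT (integrableZl measurableT (complex.Re c) f1)
    (integrableZl measurableT (complex.Im c) f2).
  by apply: eq_integrable => // x _ /=; rewrite cReM EFinB.
have := integrableD measurableT (integrableZl measurableT (complex.Re c) f2)
  (integrableZl measurableT (complex.Im c) f1).
by apply: eq_integrable => // x _ /=; rewrite cImM EFinD.
Qed.

Lemma complex_integralZ c f : cintegrable f ->
  complex_integral mu (fun x => c * f x) = c * complex_integral mu f.
Proof.
case: c => a b [f1 f2]; rewrite /complex_integral; simpc.
have h (k : R) (h : T -> R) : mu.-integrable [set: T] (EFin \o h) ->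
    mu.-integrable [set: T] (EFin \o (fun x => k * h x)).
  move=> ih; have := integrableZl measurableT k ih.
  exact: eq_integrable.
congr (_ +i* _); rewrite -!RintegralZl// -?RintegralB -?RintegralD//; try exact: h.
  by apply: eq_Rintegral => x _; rewrite cReM.
by apply: eq_Rintegral => x _; rewrite cImM.
Qed.

Lemma complex_integral0 : complex_integral mu (fun=> 0) = 0.
Proof. by rewrite /complex_integral /= /Rintegral integral0. Qed.

Lemma cintegrable0 : cintegrable (fun=> 0).
Proof. by split; exact: integrable0. Qed.

Lemma cintegrable_sum I (r : seq I) (F : I -> T -> R[i]) :
  (forall i, cintegrable (F i)) -> cintegrable (fun x => \sum_(i <- r) F i x).
Proof.
move=> iF; elim: r => [|i r ih].
  by under eq_fun do rewrite big_nil; exact: cintegrable0.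
by under eq_fun do rewrite big_cons; exact: cintegrableD.
Qed.

Lemma complex_integral_sum I (r : seq I) (F : I -> T -> R[i]) :
  (forall i, cintegrable (F i)) ->
  complex_integral mu (fun x => \sum_(i <- r) F i x) =
  \sum_(i <- r) complex_integral mu (F i).
Proof.
move=> iF; elim: r => [|i r ih].
  by rewrite big_nil -[RHS]complex_integral0; apply: eq_complex_integral => x; rewrite big_nil.
rewrite big_cons -ih -complex_integralD//; last exact: cintegrable_sum.
by apply: eq_complex_integral => x; rewrite big_cons.
Qed.

(** The factor 2 is the cost of bounding real and imaginary parts separately. *)
Lemma normc_complex_integral f (g : T -> R) : cintegrable f ->
  mu.-integrable [set: T] (EFin \o g) -> (forall x, Normc.normc (f x) <= g x) ->
  Normc.normc (complex_integral mu f) <= 2 * \int[mu]_x g x.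
Proof.
move=> [f1 f2] ig fg; apply: (le_trans (normc_le_ReIm _)).
rewrite /complex_integral /= mulr2n mulrDl !mul1r; apply: lerD.
  apply: (le_trans (le_normr_Rintegral _ _)) => //.
  apply: le_Rintegral => //; first exact: integrable_abse f1.
  by move=> x _; exact: le_trans (normr_Re_normc _) (fg x).
apply: (le_trans (le_normr_Rintegral _ _)) => //.
apply: le_Rintegral => //; first exact: integrable_abse f2.
by move=> x _; exact: le_trans (normr_Im_normc _) (fg x).
Qed.

End complex_integrable.

(** * Gaussian integrals along complex lines *)

Section gaussian_integral.
Context {R : realType}.
Notation mu := (@lebesgue_measure R).

Let gpath0 (u v r w p1 p2 y : R) :
  gpath u v r w p1 p2 0 y = p1 * Num.sqrt (2 * pi) * normal_pdf 0 1 y.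
Proof.
rewrite /gpath !(mul0r, mulr0, mul1r, mulr1, addr0, add0r, subr0, expr0n).
rewrite cos0 sin0 !(mulr1, mulr0, addr0, subr0) normal_pdfE ?oner_eq0// /normal_peak /normal_fun.
rewrite !expr1n mul1r subr0 mulr_natl.
rewrite -[p1 * _ * _]mulrA [_ * (_ * _)](_ : _ = p1 * expR (- y ^+ 2 / 2)).
  by rewrite mulrC.
by rewrite mulVKf// gt_eqF// sqrtr_gt0 mulrn_wgt0// pi_gt0.
Qed.

Lemma Rintegral_gpath1 (u v r w p1 p2 : R) : `|v| < u ->
  \int[mu]_y gpath u v r w p1 p2 1 y = p1 * Num.sqrt (2 * pi).
Proof.
move=> uv; rewrite Rintegral_gpath//.
under eq_Rintegral do rewrite gpath0.
rewrite RintegralZl//; last exact: integrable_normal_pdf.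
by rewrite /Rintegral integral_normal_pdf mulr1.
Qed.

Implicit Types (l m k : R[i]).

Let ReE (l m k : R[i]) (y : R) :
  complex.Re (k * l * cexp (- (l * y%:C + m) ^+ 2 / 2)) =
  gpath (complex.Re l) (complex.Im l) (complex.Re m) (complex.Im m)
    (complex.Re k) (complex.Im k) 1 y.
Proof.
case: l m k => [u v] [r w] [p1 p2]; rewrite /gpath.
have -> : - ((u +i* v) * y%:C + (r +i* w)) ^+ 2 / 2 =
   (- ((u * y + r) ^+ 2 - (v * y + w) ^+ 2) / 2) +i*
   (- ((u * y + r) * (v * y + w))).
  have -> : (2 : R[i])^-1 = (2^-1)%:C by rewrite fmorphV rmorph_nat.
  by rewrite expr2; simpc; congr (_ +i* _); field.
rewrite /cexp /=; rewrite cosN sinN; simpc; rewrite /= ?mul1r.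
have -> : 1 + (u - 1) = u by ring.
by ring.
Qed.

Local Opaque gpath.

(** In [ReE], k = 1 / l cancels dz/dy = l and gives the real part; k = - i / l gives the imaginary
    part, since Im w = Re (- i w). The value at s = 0 is the normal integral times Re k, whence the
    factor 1 / l. *)
Lemma gaussian_shift (l m : R[i]) : `|complex.Im l| < complex.Re l ->
  cintegrable mu (fun y => cexp (- (l * y%:C + m) ^+ 2 / 2)) /\
  complex_integral mu (fun y => cexp (- (l * y%:C + m) ^+ 2 / 2)) =
  (Num.sqrt (2 * pi))%:C / l.
Proof.
move=> lc; have l0 : l != 0.
  apply: contraTneq lc => -> /=; rewrite normr0 ltxx//.
have E1 y : complex.Re (cexp (- (l * y%:C + m) ^+ 2 / 2)) =
    gpath (complex.Re l) (complex.Im l) (complex.Re m) (complex.Im m)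
    (complex.Re l^-1) (complex.Im l^-1) 1 y by rewrite -ReE mulVf// mul1r.
have E2 y : complex.Im (cexp (- (l * y%:C + m) ^+ 2 / 2)) =
    gpath (complex.Re l) (complex.Im l) (complex.Re m) (complex.Im m)
    (complex.Im l^-1) (- complex.Re l^-1) 1 y.
  have -> : complex.Im l^-1 = complex.Re (- 'i * l^-1) by case: l^-1 => a b; simpc.
  have -> : - complex.Re l^-1 = complex.Im (- 'i * l^-1) by case: l^-1 => a b; simpc.
  rewrite -ReE mulfVK//; case: cexp => a b; by simpc.
have h01 : 0 <= (1 : R) <= 1 by rewrite ler01 lexx.
split.
  split.
    by move/funext : E1 => ->; exact: integrable_gpath.
  by move/funext : E2 => ->; exact: integrable_gpath.
rewrite /complex_integral; under eq_Rintegral do rewrite E1.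
under [X in _ +i* X]eq_Rintegral do rewrite E2.
rewrite !Rintegral_gpath1//; case: l^-1 => a b; simpc; congr (_ +i* _).
  by rewrite mulrC.
by rewrite mulrC.
Qed.

End gaussian_integral.

Section gaussian_transform.
Context {R : realType}.
Notation mu := (@lebesgue_measure R).

(** Completing the square, with centre b / l^2. *)
Lemma gaussian_transform (l b : R[i]) : `|complex.Im l| < complex.Re l ->
  cintegrable mu (fun y => cexp (- l ^+ 2 / 2 * y%:C ^+ 2 + b * y%:C)) /\
  complex_integral mu (fun y => cexp (- l ^+ 2 / 2 * y%:C ^+ 2 + b * y%:C)) =
  (Num.sqrt (2 * pi))%:C / l * cexp (b ^+ 2 / (2 * l ^+ 2)).
Proof.
move=> lc; have l0 : l != 0.
  by apply: contraTneq lc => -> /=; rewrite normr0 ltxx.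
have [i1 i2] := gaussian_shift (- b / l) lc.
have E y : cexp (- l ^+ 2 / 2 * y%:C ^+ 2 + b * y%:C) =
    cexp (b ^+ 2 / (2 * l ^+ 2)) * cexp (- (l * y%:C + - b / l) ^+ 2 / 2).
  by rewrite -cexpD; congr cexp; field.
move/funext : E => ->; split; first exact: cintegrableZ.
by rewrite complex_integralZ// i2 mulrC.
Qed.

End gaussian_transform.

(** * Gaussians on R^n and their Fourier transforms *)

Section lebesgue_rV_integral.
Context {R : realType}.
Notation mu := (@lebesgue_measure R).

Let mrV_cons n : measurable_fun [set: measurableTypeR R * 'rV[R]_n] (@rV_cons R n)
  := @measurable_rV_cons R n.

Lemma integrable_rV_cons n (f : 'rV[R]_n.+1 -> \bar R) :
  measurable_fun [set: 'rV[R]_n.+1] f ->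
  (mu \x lebesgue_rV n)%E.-integrable [set: measurableTypeR R * 'rV[R]_n] (f \o @rV_cons R n) ->
  (lebesgue_rV n.+1).-integrable [set: 'rV[R]_n.+1] f.
Proof.
move=> mf intf.
exact: (@integrable_pushforward _ _ _ _ R _ (@mrV_cons n) (mu \x lebesgue_rV n)%E setT f mf intf measurableT).
Qed.

Lemma integral_rV_cons n (f : 'rV[R]_n.+1 -> \bar R) :
  measurable_fun [set: 'rV[R]_n.+1] f ->
  (mu \x lebesgue_rV n)%E.-integrable [set: measurableTypeR R * 'rV[R]_n] (f \o @rV_cons R n) ->
  (\int[lebesgue_rV n.+1]_x f x =
   \int[(mu \x lebesgue_rV n)]_z f (rV_cons z))%E.
Proof.
move=> mf intf.
exact: (@integral_pushforward _ _ _ _ R _ (@mrV_cons n) (mu \x lebesgue_rV n)%E setT f mf intf measurableT).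
Qed.

Lemma integral_rV0 (f : 'rV[R]_0 -> \bar R) :
  measurable_fun [set: 'rV[R]_0] f -> (\int[lebesgue_rV 0]_x f x)%E = f 0.
Proof.
by move=> mf; rewrite [LHS](integral_dirac (0 : 'rV[R]_0) measurableT mf) diracT mul1e.
Qed.

End lebesgue_rV_integral.

(** * Integrals of tensor products *)

Section product_integral.
Context d1 d2 (T1 : measurableType d1) (T2 : measurableType d2) {R : realType}.
Variables (m1 : {sigma_finite_measure set T1 -> \bar R})
          (m2 : {sigma_finite_measure set T2 -> \bar R}).

Lemma integrable_tensor (f : T1 -> R) (g : T2 -> R) :
  m1.-integrable [set: T1] (EFin \o f) -> m2.-integrable [set: T2] (EFin \o g) ->
  (m1 \x m2)%E.-integrable [set: T1 * T2] (EFin \o (fun z => f z.1 * g z.2)).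
Proof.
move=> intf intg.
have mf : measurable_fun [set: T1] f by apply/measurable_EFinP; exact: measurable_int intf.
have mg : measurable_fun [set: T2] g by apply/measurable_EFinP; exact: measurable_int intg.
have mfg : measurable_fun [set: T1 * T2] (EFin \o (fun z => f z.1 * g z.2)).
  apply/measurable_EFinP; apply: measurable_funM; exact: measurableT_comp.
apply/(integrable12ltyP _ _ mfg) => /=.
have /integrableP[_ fo] := intf; have /integrableP[_ go] := intg.
under eq_integral => x _.
  under eq_integral do rewrite normrM EFinM.
  rewrite ge0_integralZl//; last by apply/measurable_EFinP; exact: measurableT_comp.
  over.
rewrite /= ge0_integralZr//.
- have f_ge0 : (0 <= \int[m1]_x `|f x|%:E)%E by exact: integral_ge0.
  by apply: lte_mul_pinfty => //; rewrite ge0_fin_numE.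
- by apply/measurable_EFinP; exact: measurableT_comp.
- exact: integral_ge0.
Qed.

Lemma Rintegral_tensor (f : T1 -> R) (g : T2 -> R) :
  m1.-integrable [set: T1] (EFin \o f) -> m2.-integrable [set: T2] (EFin \o g) ->
  \int[(m1 \x m2)%E]_z (f z.1 * g z.2) = \int[m1]_x f x * \int[m2]_y g y.
Proof.
move=> intf intg; have intfg := integrable_tensor intf intg.
rewrite /Rintegral -(integral12_prod_meas1 intfg) /fubini_F /=.
under eq_integral => x _.
  under eq_integral do rewrite EFinM.
  rewrite integralZl//.
  rewrite -[X in (_ * X)%E]fineK; last exact: integrable_fin_num.
  over.
rewrite integralZr// fineM//; exact: integrable_fin_num.
Qed.

Lemma cintegrable_tensor (f : T1 -> R[i]) (g : T2 -> R[i]) :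
  cintegrable m1 f -> cintegrable m2 g ->
  cintegrable (m1 \x m2)%E (fun z => f z.1 * g z.2).
Proof.
move=> [f1 f2] [g1 g2]; split.
  have := integrableB measurableT (integrable_tensor f1 g1) (integrable_tensor f2 g2).
  by apply: eq_integrable => // z _ /=; rewrite cReM EFinB.
have := integrableD measurableT (integrable_tensor f1 g2) (integrable_tensor f2 g1).
by apply: eq_integrable => // z _ /=; rewrite cImM EFinD.
Qed.

Lemma complex_integral_tensor (f : T1 -> R[i]) (g : T2 -> R[i]) :
  cintegrable m1 f -> cintegrable m2 g ->
  complex_integral (m1 \x m2)%E (fun z => f z.1 * g z.2) =
  complex_integral m1 f * complex_integral m2 g.
Proof.
move=> [f1 f2] [g1 g2]; rewrite /complex_integral; simpc.
have [i11 i22] := (integrable_tensor f1 g1, integrable_tensor f2 g2).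
have [i12 i21] := (integrable_tensor f1 g2, integrable_tensor f2 g1).
rewrite -!Rintegral_tensor// -RintegralB// -RintegralD//.
congr (_ +i* _); apply: eq_Rintegral => z _; first by rewrite cReM.
by rewrite cImM.
Qed.

End product_integral.

Section tensor_rV.
Context {R : realType}.
Notation mu := (@lebesgue_measure R).

Lemma cmeasurable_prod_rV n (F : 'I_n -> R -> R[i]) :
  (forall i, cmeasurable (F i)) ->
  cmeasurable (fun x : 'rV[R]_n => \prod_(i < n) F i (x ord0 i)).
Proof.
move=> mF.
have h (r : seq 'I_n) : cmeasurable (fun x : 'rV[R]_n => \prod_(i <- r) F i (x ord0 i)).
  elim: r => [|i r ih]; first by under eq_fun do rewrite big_nil; exact: cmeasurable_cst.
  under eq_fun do rewrite big_cons; apply: cmeasurableM => //.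
  have [m1 m2] := mF i; split.
    exact: (measurableT_comp m1 (measurable_rV_coord i)).
  exact: (measurableT_comp m2 (measurable_rV_coord i)).
exact: h.
Qed.

(** Induction on n: [rV_cons] splits off the first coordinate, where Fubini applies. On R^0 the
    measure is a Dirac mass and the empty product is 1. *)
Lemma cintegrable_rV_prod n (F : 'I_n -> R -> R[i]) :
  (forall i, cintegrable mu (F i)) ->
  cintegrable (lebesgue_rV n) (fun x => \prod_(i < n) F i (x ord0 i)) /\
  complex_integral (lebesgue_rV n) (fun x => \prod_(i < n) F i (x ord0 i)) =
  \prod_(i < n) complex_integral mu (F i).
Proof.
elim: n F => [|n ih] F iF.
  have -> : (fun x : 'rV[R]_0 => \prod_(i < 0) F i (x ord0 i)) = fun=> 1.
    by apply/funext => x; rewrite big_ord0.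
  rewrite big_ord0; split.
    by split; apply/integrableP; (split; first exact: measurable_cst);
      rewrite integral_rV0 ?ltry//; exact: measurable_cst.
  by rewrite /complex_integral /Rintegral !integral_rV0//; exact: measurable_cst.
have [ih1 ih2] := ih (fun i => F (lift ord0 i)) (fun i => iF _).
have mF : cmeasurable (fun x : 'rV[R]_n.+1 => \prod_(i < n.+1) F i (x ord0 i)).
  by apply: cmeasurable_prod_rV => i; exact: cintegrable_measurable (iF i).
have E (z : measurableTypeR R * 'rV[R]_n) : \prod_(i < n.+1) F i (rV_cons z ord0 i) =
    F ord0 z.1 * \prod_(i < n) F (lift ord0 i) (z.2 ord0 i).
  rewrite big_ord_recl rV_cons0; congr (_ * _).
  by apply: eq_bigr => i _; rewrite rV_consS.
have [j1 j2] := cintegrable_tensor (iF ord0) ih1.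
have [m1 m2] := mF.
have k1 : (mu \x lebesgue_rV n)%E.-integrable [set: measurableTypeR R * 'rV[R]_n]
   ((EFin \o (fun x : 'rV[R]_n.+1 => complex.Re (\prod_(i < n.+1) F i (x ord0 i)))) \o @rV_cons R n).
  by apply: eq_integrable j1 => // z _ /=; rewrite E.
have k2 : (mu \x lebesgue_rV n)%E.-integrable [set: measurableTypeR R * 'rV[R]_n]
   ((EFin \o (fun x : 'rV[R]_n.+1 => complex.Im (\prod_(i < n.+1) F i (x ord0 i)))) \o @rV_cons R n).
  by apply: eq_integrable j2 => // z _ /=; rewrite E.
have M1 := iffRL (measurable_EFinP _ _) m1.
have M2 := iffRL (measurable_EFinP _ _) m2.
split.
  by split; apply: integrable_rV_cons.
rewrite big_ord_recl -ih2 -complex_integral_tensor//.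
rewrite /complex_integral /Rintegral.
rewrite (integral_rV_cons M1 k1) (integral_rV_cons M2 k2) /=.
by congr (fine _ +i* fine _); apply: eq_integral => z _; rewrite E.
Qed.

End tensor_rV.

Section gaussian_rV.
Context {R : realType}.
Notation mu := (@lebesgue_measure R).
Implicit Types n : nat.

(* The exponent must be written with a product over coordinates, since
   Lebesgue measure on R^n is an iterated product. *)
Definition gaussian n (l b : 'I_n -> R[i]) (x : 'rV[R]_n) : R[i] :=
  \prod_(i < n) cexp (- l i ^+ 2 / 2 * (x ord0 i)%:C ^+ 2 + b i * (x ord0 i)%:C).

(** The sector |arg l| < pi / 4: the right half-plane roots of the numbers with positive real part.
    It is stable under inversion, hence under the Fourier transform of Gaussians. *)
Definition in_cone (l : R[i]) := `|complex.Im l| < complex.Re l.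

Lemma in_cone_neq0 l : in_cone l -> l != 0.
Proof. by apply: contraTneq => ->; rewrite /in_cone /= normr0 ltxx. Qed.

Lemma in_coneV l : in_cone l -> in_cone l^-1.
Proof.
case: l => a b; rewrite /in_cone /= => ab.
have a0 : 0 < a by exact: le_lt_trans ab.
have N0 : 0 < a ^+ 2 + b ^+ 2 by rewrite ltr_pwDl ?exprn_gt0 ?sqr_ge0.
by rewrite normrN normrM [`|_^-1|]gtr0_norm ?invr_gt0// ltr_pM2r ?invr_gt0.
Qed.

Lemma gaussian_integral n (l b : 'I_n -> R[i]) : (forall i, in_cone (l i)) ->
  cintegrable (lebesgue_rV n) (gaussian l b) /\
  complex_integral (lebesgue_rV n) (gaussian l b) =
  (Num.sqrt (2 * pi))%:C ^+ n * \prod_(i < n) ((l i)^-1 * cexp (b i ^+ 2 / (2 * l i ^+ 2))).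
Proof.
move=> lc.
have [h1 h2] := cintegrable_rV_prod (fun i => (gaussian_transform (b i) (lc i)).1).
split => //; rewrite [LHS]h2.
rewrite -[X in _ ^+ X]card_ord -prodr_const -big_split/=; apply: eq_bigr => i _.
by rewrite [RHS]mulrA; exact: (gaussian_transform (b i) (lc i)).2.
Qed.

Lemma powR2pi n : (2 * pi : R) `^ (- (n%:R / 2)) = (Num.sqrt (2 * pi)) ^- n.
Proof.
have p0 : 0 <= 2 * pi :> R by rewrite mulr_ge0 ?pi_ge0.
by rewrite powRN (mulrC n%:R) powRrM powR12_sqrt// powR_mulrn ?sqrtr_ge0.
Qed.

Lemma sqrt2pi_neq0 n : ((Num.sqrt (2 * pi : R)) ^+ n)%:C != 0 :> R[i].
Proof.
rewrite fmorph_eq0 expf_eq0 negb_and; apply/orP; right.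
by rewrite gt_eqF// sqrtr_gt0 mulr_gt0// pi_gt0.
Qed.

(** A plane wave only adds an imaginary amount to the linear coefficient. The real [e] is -1 for the
    Fourier transform and 1 for its inverse. *)
Lemma expi_gaussian n (xi : 'rV[R]_n) (l b : 'I_n -> R[i]) (x : 'rV[R]_n) (e : R) :
  expi (e * dotv x xi) * gaussian l b x =
  gaussian l (fun i => b i + 'i%C * (e * xi ord0 i)%:C) x.
Proof.
rewrite expiE /dotv /gaussian.
have -> : 0 +i* (e * \sum_(i < n) x ord0 i * xi ord0 i) =
   \sum_(i < n) 'i%C * (e * (x ord0 i * xi ord0 i))%:C.
  by rewrite -mulr_sumr -(rmorph_sum (real_complex R)) -mulr_sumr; simpc.
rewrite cexp_sum -big_split/=; apply: eq_bigr => i _.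
by rewrite -cexpD; congr cexp; rewrite !rmorphM/=; ring.
Qed.

Lemma fourier_gaussian n (l b : 'I_n -> R[i]) c (xi : 'rV[R]_n) :
  (forall i, in_cone (l i)) ->
  fourier (fun x => c * gaussian l b x) xi =
  c * \prod_(i < n) ((l i)^-1 *
      cexp ((b i - 'i%C * (xi ord0 i)%:C) ^+ 2 / (2 * l i ^+ 2))).
Proof.
move=> lc; rewrite /fourier.
have [h1 h2] := gaussian_integral (fun i => b i + 'i%C * (-1 * xi ord0 i)%:C) lc.
under eq_complex_integral => x.
  rewrite mulrCA -mulN1r expi_gaussian.
  over.
rewrite complex_integralZ// h2 powR2pi fmorphV rmorphXn/= mulrCA; congr (_ * _).
rewrite mulKf//; last by rewrite -rmorphXn; exact: sqrt2pi_neq0.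
by apply: eq_bigr => i _; rewrite mulN1r rmorphN/= mulrN.
Qed.

Lemma dotvC n (x y : 'rV[R]_n) : dotv x y = dotv y x.
Proof. by apply: eq_bigr => i _; rewrite mulrC. Qed.

Lemma inverse_fourier_gaussian n (l b : 'I_n -> R[i]) c (x : 'rV[R]_n) :
  (forall i, in_cone (l i)) ->
  inverse_fourier (fun xi => c * gaussian l b xi) x =
  c * \prod_(i < n) ((l i)^-1 *
      cexp ((b i + 'i%C * (x ord0 i)%:C) ^+ 2 / (2 * l i ^+ 2))).
Proof.
move=> lc; rewrite /inverse_fourier.
have [h1 h2] := gaussian_integral (fun i => b i + 'i%C * (1 * x ord0 i)%:C) lc.
have dC y : dotv x y = 1 * dotv y x by rewrite mul1r dotvC.
under eq_complex_integral => y.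
  rewrite mulrCA dC expi_gaussian.
  over.
rewrite complex_integralZ// h2 powR2pi fmorphV rmorphXn/= mulrCA; congr (_ * _).
rewrite mulKf//; last by rewrite -rmorphXn; exact: sqrt2pi_neq0.
by apply: eq_bigr => i _; rewrite mul1r.
Qed.

Lemma cintegrable_phase n (f : 'rV[R]_n -> R[i]) (theta : 'rV[R]_n -> R) :
  cintegrable (lebesgue_rV n) f ->
  measurable_fun [set: 'rV[R]_n] theta ->
  cintegrable (lebesgue_rV n) (fun x => expi (theta x) * f x).
Proof.
move=> /[dup] /cintegrable_measurable mf /cintegrable_normc fi mt.
apply: cintegrable_dominated fi _.
  apply: cmeasurableM => //; under eq_fun do rewrite expiE.
  by apply: cmeasurable_cexp; split => //=; exact: measurable_cst.
by move=> x; rewrite Normc.normcM expiE normc_cexp expR0 mul1r.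
Qed.

Lemma measurable_dotv n (y : 'rV[R]_n) :
  measurable_fun [set: 'rV[R]_n] (fun x => dotv x y).
Proof.
rewrite /dotv; apply: measurable_sum => i; apply: measurable_funM => //.
exact: measurable_rV_coord.
Qed.

Lemma measurable_dotvv n : measurable_fun [set: 'rV[R]_n] (fun x => dotv x x).
Proof.
rewrite /dotv; apply: measurable_sum => i; apply: measurable_funM;
  exact: measurable_rV_coord.
Qed.

Lemma fourier_sum n I (r : seq I) (c : I -> R[i]) (f : I -> 'rV[R]_n -> R[i]) xi :
  (forall i, cintegrable (lebesgue_rV n) (f i)) ->
  fourier (fun x => \sum_(i <- r) c i * f i x) xi =
  \sum_(i <- r) c i * fourier (f i) xi.
Proof.
move=> fi; rewrite /fourier.
have hi i : cintegrable (lebesgue_rV n) (fun x => expi (- dotv x xi) * f i x).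
  by apply: cintegrable_phase => //; apply: measurableT_comp => //; exact: measurable_dotv.
under eq_complex_integral => x.
  rewrite mulr_sumr; under eq_bigr do rewrite mulrCA.
  over.
rewrite complex_integral_sum; last by move=> i; exact: cintegrableZ.
rewrite mulr_sumr; apply: eq_bigr => i _.
by rewrite complex_integralZ// mulrCA.
Qed.

Lemma inverse_fourier_sum n I (r : seq I) (c : I -> R[i]) (f : I -> 'rV[R]_n -> R[i]) x :
  (forall i, cintegrable (lebesgue_rV n) (f i)) ->
  inverse_fourier (fun xi => \sum_(i <- r) c i * f i xi) x =
  \sum_(i <- r) c i * inverse_fourier (f i) x.
Proof.
move=> fi; rewrite /inverse_fourier.
have hi i : cintegrable (lebesgue_rV n) (fun y => expi (dotv x y) * f i y).
  apply: cintegrable_phase => //.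
  by rewrite (_ : dotv x = fun y => dotv y x); [exact: measurable_dotv|exact/funext/dotvC].
under eq_complex_integral => y.
  rewrite mulr_sumr; under eq_bigr do rewrite mulrCA.
  over.
rewrite complex_integral_sum; last by move=> i; exact: cintegrableZ.
rewrite mulr_sumr; apply: eq_bigr => i _.
by rewrite complex_integralZ// mulrCA.
Qed.

End gaussian_rV.

(** * Polynomial growth against Gaussian decay *)

Section growth.
Context {R : realType}.

Lemma exprn_le_expR (e : R) m : 0 < e -> exists2 C : R, 0 < C &
  forall y, 0 <= y -> (1 + y) ^+ m <= C * expR (e * y).
Proof.
(* With d <= 1 one has d (1 + y) <= 1 + d y <= exp(d y), and d m <= e bounds the m-th power. *)
move=> e0; pose d := Num.min 1 (e / m.+1%:R).
have d0 : 0 < d by rewrite lt_min ltr01 divr_gt0.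
have d1 : d <= 1 by rewrite ge_min lexx.
have dm : d * m%:R <= e.
  apply: (@le_trans _ _ (e / m.+1%:R * m.+1%:R)); last by rewrite divfK// pnatr_eq0.
  by rewrite ler_pM ?ler0n ?ler_nat ?(ltW d0)// ge_min lexx orbT.
exists (d ^- m); first by rewrite invr_gt0 exprn_gt0.
move=> y y0; apply: (@le_trans _ _ ((d^-1 * expR (d * y)) ^+ m)).
  rewrite lerXn2r ?nnegrE ?addr_ge0 ?mulr_ge0 ?invr_ge0 ?expR_ge0 ?(ltW d0)//.
  rewrite ler_pdivlMl// mulrDr mulr1; apply: le_trans (expR_ge1Dx _).
  by rewrite lerD2r.
rewrite exprMn exprVn -expRM_natl ler_wpM2l ?invr_ge0 ?exprn_ge0 ?(ltW d0)//.
by rewrite ler_expR mulrA ler_wpM2r// mulrC.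
Qed.

Lemma powR_le_expR (e a : R) : 0 < e -> 0 <= a -> exists2 C : R, 0 < C &
  forall y, 0 <= y -> (1 + y) `^ a <= C * expR (e * y).
Proof.
move=> e0 a0; have [C C0 hC] := exprn_le_expR (Num.truncn a).+1 e0.
exists C => // y y0; apply: le_trans (hC y y0).
have y1 : 1 <= 1 + y by rewrite lerDl.
rewrite -powR_mulrn; last exact: le_trans y1.
by rewrite ler_powR// ltW// truncnS_gt.
Qed.

Lemma dotvv_ge0 n (x : 'rV[R]_n) : 0 <= dotv x x.
Proof. by apply: sumr_ge0 => i _; exact: sqr_ge0. Qed.

Lemma enorm_sqr n (x : 'rV[R]_n) : enorm x ^+ 2 = dotv x x.
Proof. by rewrite sqr_sqrtr// dotvv_ge0. Qed.

Lemma enorm_ge0 n (x : 'rV[R]_n) : 0 <= enorm x.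
Proof. exact: sqrtr_ge0. Qed.

Lemma measurable_enorm n : measurable_fun [set: 'rV[R]_n] (@enorm R n).
Proof.
apply: (measurableT_comp (continuous_measurable_fun (@sqrt_continuous R))).
exact: measurable_dotvv.
Qed.

Lemma enorm_powR_le (e a : R) : 0 < e -> 0 <= a -> exists2 C : R, 0 < C &
  forall n (x : 'rV[R]_n), enorm x `^ a <= C * expR (e * dotv x x).
Proof.
move=> e0 a0; have [C C0 hC] := powR_le_expR e0 a0; exists C => // n x.
rewrite -enorm_sqr; apply: (le_trans _ (hC _ (sqr_ge0 _))).
have : enorm x <= 1 + enorm x ^+ 2.
  have := enorm_ge0 x; move: (enorm x) => y y0; nra.
by move=> h; apply: ge0_ler_powR => //; rewrite nnegrE ?enorm_ge0 ?addr_ge0 ?sqr_ge0.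
Qed.

Lemma normc_gaussian n (l b : 'I_n -> R[i]) (x : 'rV[R]_n) :
  Normc.normc (gaussian l b x) =
  expR (\sum_(i < n) (- complex.Re (l i ^+ 2) / 2 * x ord0 i ^+ 2 +
                      complex.Re (b i) * x ord0 i)).
Proof.
rewrite normc_prod expR_sum; apply: eq_bigr => i _; rewrite normc_cexp; congr expR.
have -> : (2 : R[i])^-1 = (2^-1)%:C by rewrite fmorphV rmorph_nat.
case: (l i ^+ 2) (b i) => [a c] [p q]; rewrite expr2 /=; simpc.
by rewrite expr2.
Qed.

Lemma integrable_expR_dotv n (c : R) : 0 < c ->
  (lebesgue_rV n).-integrable [set: 'rV[R]_n]
    (EFin \o (fun x => expR (- c * dotv x x))).
Proof.
move=> c0; pose l := (Num.sqrt (2 * c))%:C.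
have lc (i : 'I_n) : in_cone l.
  by rewrite /in_cone /= normr0 sqrtr_gt0 mulr_gt0.
have [[h _] _] := gaussian_integral (fun=> 0) lc.
apply: eq_integrable h => // x _ /=; congr _%:E.
transitivity (complex.Re (expR (- c * dotv x x))%:C) => //; congr complex.Re.
rewrite /gaussian /dotv mulr_sumr; symmetry.
transitivity (cexp (\sum_(i < n) (- c * (x ord0 i * x ord0 i))%:C)).
  by rewrite -rmorph_sum cexp_real.
rewrite cexp_sum; apply: eq_bigr => i _; congr cexp.
rewrite mul0r addr0 -rmorphXn/= sqr_sqrtr ?mulr_ge0 ?(ltW c0)//.
have -> : (2 : R[i])^-1 = (2^-1)%:C by rewrite fmorphV rmorph_nat.
rewrite -[(x ord0 i)%:C ^+ 2]rmorphXn -[- _%:C](rmorphN (real_complex R)).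
by rewrite -!(rmorphM (real_complex R)) /=; apply: (congr1 (real_complex R)); field.
Qed.

End growth.

Section cone_root.
Context {R : realType}.

(* The square root in the right half-plane. *)
Definition croot (a : R[i]) : R[i] :=
  if 0 < complex.Re (sqrtc a) then sqrtc a else - sqrtc a.

Lemma croot_sqr a : croot a ^+ 2 = a.
Proof. by rewrite /croot; case: ifP => _; rewrite ?sqrrN sqr_sqrtc. Qed.

(** For a root u + i v, Re a = u^2 - v^2 > 0 means |v| < |u|; the choice of sign does the rest. *)
Lemma croot_cone a : 0 < complex.Re a -> in_cone (croot a).
Proof.
move=> a0; have : complex.Re (sqrtc a ^+ 2) = complex.Re a by rewrite sqr_sqrtc.
rewrite /in_cone /croot; case: (sqrtc a) => u v; rewrite expr2 /= => h.
have uv : v ^+ 2 < u ^+ 2 by rewrite -subr_gt0 !expr2 h.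
have : `|v| < `|u| by rewrite -(ltr_pXn2r (n := 2)) ?nnegrE// !real_normK ?num_real.
case: ifPn => [u0|]; first by rewrite (gtr0_norm u0).
by rewrite -leNgt => u0 /=; rewrite normrN (ler0_norm u0).
Qed.

End cone_root.

(** * Wave packets and their restriction to the diagonal *)

Section packets.
Context {R : realType} {n : nat}.
Implicit Types (t h : R) (w : 'rV[R]_(n + (n + n))).

(* The symbol |xi|^2 + |eta|^2 - |zeta|^2 has signature (+, +, -). *)
Definition sgn3 (j : 'I_(n + (n + n))) : R :=
  match fintype.split j with
  | inl _ => 1
  | inr k => match fintype.split k with inl _ => 1 | inr _ => -1 end
  end.

Definition width t : R[i] := croot (1 +i* t).

Lemma width_cone t : in_cone (width t).
Proof. by apply: croot_cone; rewrite /= ltr01. Qed.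

Lemma width_sqr t : width t ^+ 2 = 1 +i* t.
Proof. exact: croot_sqr. Qed.

(* The free evolution, at time t, of exp(- |w - (h, ..., h)|^2 / 2). *)
Definition packet t h w : R[i] :=
  \prod_j ((width (sgn3 j * t))^-1 *
    cexp (- ((w ord0 j - h)%:C) ^+ 2 / (2 * width (sgn3 j * t) ^+ 2))).

(** The Fourier transform of [packet t h]. The evolution multiplies exp(- |xi|^2 / 2) by quadratic
    phases, turning each coefficient 1 into 1 + i t or 1 - i t according to [sgn3]; the centre h
    gives the imaginary linear term. *)
Definition packet_hat t h : 'rV[R]_(n + (n + n)) -> R[i] :=
  gaussian (fun j => width (sgn3 j * t)) (fun=> - ('i%C * h%:C)).

Lemma sqr_iM (a : R[i]) : ('i%C * a) ^+ 2 = - a ^+ 2.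
Proof. by rewrite exprMn sqr_i mulN1r. Qed.

(** This and [fourier_packet] are two explicit computations, so Fourier inversion is not invoked. *)
Lemma inverse_fourier_packet t h : inverse_fourier (packet_hat t h) = packet t h.
Proof.
apply/funext => w.
have -> : packet_hat t h = (fun xi => 1 * packet_hat t h xi).
  by apply/funext => xi; rewrite mul1r.
rewrite inverse_fourier_gaussian; last by move=> j; exact: width_cone.
rewrite mul1r /packet; apply: eq_bigr => j _.
rewrite (_ : - _ + _ = 'i%C * (w ord0 j - h)%:C); first by rewrite sqr_iM.
by rewrite rmorphB/=; ring.
Qed.

Lemma packetE t h w : packet t h w =
  (\prod_j ((width (sgn3 j * t))^-1 * cexp (- h%:C ^+ 2 / (2 * width (sgn3 j * t) ^+ 2)))) *
  gaussian (fun j => (width (sgn3 j * t))^-1)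
    (fun j => h%:C / width (sgn3 j * t) ^+ 2) w.
Proof.
rewrite /packet /gaussian -big_split/=; apply: eq_bigr => j _.
have := in_cone_neq0 (width_cone (sgn3 j * t)); move: (width _) => l l0.
rewrite -[RHS]mulrA -cexpD; congr *%R; congr cexp.
by rewrite rmorphB/=; field.
Qed.

Lemma cintegrable_packet t h : cintegrable (lebesgue_rV _) (packet t h).
Proof.
have /funext -> := packetE t h; apply: cintegrableZ.
by apply: (gaussian_integral _ _).1 => j; exact/in_coneV/width_cone.
Qed.

Lemma cintegrable_packet_hat t h : cintegrable (lebesgue_rV _) (packet_hat t h).
Proof. by apply: (gaussian_integral _ _).1 => j; exact: width_cone. Qed.

Lemma fourier_packet t h : fourier (packet t h) = packet_hat t h.
Proof.
apply/funext => xi; have /funext -> := packetE t h.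
rewrite fourier_gaussian; last by move=> j; exact/in_coneV/width_cone.
rewrite /packet_hat /gaussian -big_split/=; apply: eq_bigr => j _.
have := in_cone_neq0 (width_cone (sgn3 j * t)); move: (width _) => l l0.
rewrite invrK mulrACA mulVf// mul1r -cexpD; congr cexp.
have i2 := @sqr_i R; move: ('i%C : R[i]) i2 => i i2.
transitivity (- i * h%:C * (xi ord0 j)%:C + i ^+ 2 * (l ^+ 2 * (xi ord0 j)%:C ^+ 2) / 2).
  by field.
by rewrite i2; ring.
Qed.

Lemma sum_sgn3 (F : 'I_(n + (n + n)) -> R) :
  \sum_j sgn3 j * F j = \sum_i F (lshift _ i) + \sum_i F (rshift _ (lshift _ i))
    - \sum_i F (rshift _ (rshift _ i)).
Proof.
have s1 i : sgn3 (lshift _ i) = 1 by rewrite /sgn3 (unsplitK (inl i)).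
have s2 i : sgn3 (rshift _ (lshift _ i)) = 1.
  by rewrite /sgn3 (unsplitK (inr (lshift _ i))) (unsplitK (inl i)).
have s3 i : sgn3 (rshift _ (rshift _ i)) = -1.
  by rewrite /sgn3 (unsplitK (inr (rshift _ i))) (unsplitK (inr i)).
rewrite -sumrN [LHS]big_split_ord /= [X in _ + X = _]big_split_ord /= addrA.
congr (_ + _ + _).
- by apply: eq_bigr => i _; rewrite s1 mul1r.
- by apply: eq_bigr => i _; rewrite s2 mul1r.
- by apply: eq_bigr => i _; rewrite s3 mulN1r.
Qed.

(** The phase of the symbol is added to the quadratic coefficient, so the flow merely translates the
    parameter t. A packet with parameter -T therefore refocuses at time T. *)
Lemma schrodinger_symbol_packet t s h w :
  schrodinger_symbol s w * packet_hat t h w = packet_hat (t + s) h w.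
Proof.
rewrite /schrodinger_symbol !enorm_sqr.
have -> : dotv (lsubmx w) (lsubmx w) + dotv (lsubmx (rsubmx w)) (lsubmx (rsubmx w))
   - dotv (rsubmx (rsubmx w)) (rsubmx (rsubmx w)) =
   \sum_j sgn3 j * (w ord0 j ^+ 2).
  rewrite sum_sgn3 /dotv; congr (_ + _ - _); apply: eq_bigr => i _;
  by rewrite !mxE expr2.
rewrite expiE (_ : 0 +i* _ =
    \sum_j (- 'i%C * (s * sgn3 j * w ord0 j ^+ 2 / 2)%:C)); last first.
  rewrite -mulr_sumr -(rmorph_sum (real_complex R)) /=; simpc; congr (_ +i* _).
  rewrite mulr_sumr mulr_suml; congr (- _); apply: eq_bigr => j _; ring.
rewrite cexp_sum -big_split/=; apply: eq_bigr => j _; rewrite -cexpD; congr cexp.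
rewrite !width_sqr.
have -> : 1 +i* (sgn3 j * (t + s)) = 1 +i* (sgn3 j * t) + 'i%C * (sgn3 j * s)%:C :> R[i].
  by simpc; rewrite mulrDr.
have -> : (s * sgn3 j * w ord0 j ^+ 2 / 2)%:C = (sgn3 j * s)%:C * (w ord0 j)%:C ^+ 2 / 2 :> R[i].
  rewrite rmorphM/= fmorphV/= rmorph_nat; congr (_ / _).
  by rewrite -rmorphXn -rmorphM/= [s * _]mulrC.
by field.
Qed.

Lemma schrodinger_flow_packets I (r : seq I) (c : I -> R[i]) (t h : I -> R) (s : R) :
  schrodinger_flow s (fun w => \sum_(k <- r) c k * packet (t k) (h k) w) =
  (fun w => \sum_(k <- r) c k * packet (t k + s) (h k) w).
Proof.
apply/funext => w; rewrite /schrodinger_flow /fourier_multiplier.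
have -> : (fun xi => schrodinger_symbol s xi *
     fourier (fun w => \sum_(k <- r) c k * packet (t k) (h k) w) xi) =
   (fun xi => \sum_(k <- r) c k * packet_hat (t k + s) (h k) xi).
  apply/funext => xi; rewrite fourier_sum; last by move=> k; exact: cintegrable_packet.
  rewrite mulr_sumr; apply: eq_bigr => k _.
  by rewrite fourier_packet mulrCA schrodinger_symbol_packet.
rewrite inverse_fourier_sum; last by move=> k; exact: cintegrable_packet_hat.
by apply: eq_bigr => k _; rewrite inverse_fourier_packet.
Qed.

(** Both t and h enter through phases only, since the real part of [width t ^+ 2] is 1. All packets
    thus have the same Sobolev norm. *)
Lemma normc_packet_hat t h w : Normc.normc (packet_hat t h w) = expR (- dotv w w / 2).
Proof.
rewrite normc_gaussian; congr expR; rewrite /dotv -sumrN mulr_suml.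
apply: eq_bigr => j _; rewrite width_sqr; simpc => /=; rewrite expr2; lra.
Qed.

End packets.

(** * Restriction to the diagonal *)

Section diagonal.
Context {R : realType} {n : nat}.
Implicit Types (t h : R) (x xi : 'rV[R]_n).

(* 2 / (1 + i t) + 1 / (1 - i t): restricted to the diagonal, the packet is a
   Gaussian with this quadratic coefficient. *)
Definition diag_quad t : R[i] :=
  (3 / (1 + t ^+ 2)) +i* (- t / (1 + t ^+ 2)).

Lemma den1_gt0 t : 0 < 1 + t ^+ 2.
Proof. by rewrite ltr_pwDl ?sqr_ge0. Qed.

Lemma den9_gt0 t : 0 < 9 + t ^+ 2.
Proof. by rewrite ltr_pwDl ?sqr_ge0. Qed.

Lemma diag_quadE t :
  diag_quad t = 2 / width t ^+ 2 + (width (- t) ^+ 2)^-1.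
Proof.
rewrite !width_sqr /diag_quad; have := den1_gt0 t => t0.
have h1 : (1 +i* t) * (1 +i* (- t)) = (1 + t ^+ 2)%:C :> R[i].
  by apply/eqP; rewrite eq_complex /=; apply/andP; split; apply/eqP; ring.
have n1 : (1 + t ^+ 2)%:C != 0 :> R[i] by rewrite fmorph_eq0 gt_eqF.
have p1 : 1 +i* t != 0 :> R[i] by apply: contraNneq n1 => p; rewrite -h1 p mul0r.
have p2 : 1 +i* (- t) != 0 :> R[i] by apply: contraNneq n1 => p; rewrite -h1 p mulr0.
transitivity ((3 +i* (- t)) / (1 + t ^+ 2)%:C).
  by rewrite -fmorphV; simpc.
rewrite -h1 (_ : 3 +i* (- t) = 2 * (1 +i* (- t)) + (1 +i* t)); last first.
  rewrite (_ : (2 : R[i]) = 2%:C); last by rewrite rmorph_nat.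
  simpc; congr (_ +i* _); ring.
by field; rewrite p1 p2.
Qed.

Definition diag_width t : R[i] := croot (diag_quad t).

Lemma diag_width_cone t : in_cone (diag_width t).
Proof. by apply: croot_cone; rewrite /= divr_gt0// den1_gt0. Qed.

Lemma diag_width_sqr t : diag_width t ^+ 2 = diag_quad t.
Proof. exact: croot_sqr. Qed.

Lemma diag_widthV_sqr t : (diag_width t)^-1 ^+ 2 =
  (3 * (1 + t ^+ 2) / (9 + t ^+ 2)) +i* (t * (1 + t ^+ 2) / (9 + t ^+ 2)).
Proof.
rewrite exprVn diag_width_sqr; apply: mulr1_eq; rewrite /diag_quad; simpc.
have h1 := den1_gt0 t; have h9 := den9_gt0 t.
by apply/eqP; rewrite eq_complex /=; apply/andP; split; apply/eqP; field; rewrite !gt_eqF.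
Qed.

(** The amplitude per coordinate of the Fourier transform of the restricted packet: three roots come
    from the packet in x, y and z, the fourth from the transform of the resulting Gaussian. *)
Definition diag_amp t : R[i] :=
  (width t ^+ 2 * width (- t) * diag_width t)^-1.

Lemma prod_triple (F : R -> R -> R[i]) x :
  \prod_j F (sgn3 j) (triple x x x ord0 j) =
  \prod_(i < n) (F 1 (x ord0 i) * F 1 (x ord0 i) * F (-1) (x ord0 i)).
Proof.
rewrite big_split_ord /= [X in _ * X = _]big_split_ord /= mulrA !big_split /=.
rewrite /triple; congr (_ * _ * _); apply: eq_bigr => i _.
- by rewrite row_mxEl /sgn3 (unsplitK (inl i)).
- by rewrite row_mxEr row_mxEl /sgn3 (unsplitK (inr (lshift _ i))) (unsplitK (inl i)).
- by rewrite !row_mxEr /sgn3 (unsplitK (inr (rshift _ i))) (unsplitK (inr i)).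
Qed.

(** The quadratic coefficients in x, y and z add up to [diag_quad t]. The factor [diag_width t]
    compensates the root in [diag_amp] that only the Fourier transform produces. *)
Lemma packet_triple t h x : packet t h (triple x x x) =
  \prod_(i < n) (diag_amp t * diag_width t * cexp (- h%:C ^+ 2 / 2 * diag_quad t)) *
  gaussian (fun=> diag_width t) (fun=> h%:C * diag_quad t) x.
Proof.
rewrite /packet (prod_triple (fun s a => (width (s * t))^-1 *
    cexp (- ((a - h)%:C) ^+ 2 / (2 * width (s * t) ^+ 2)))).
rewrite /gaussian -big_split; apply: eq_bigr => i _.
rewrite mul1r mulN1r diag_width_sqr diag_quadE /diag_amp.
have := in_cone_neq0 (diag_width_cone t); move: (diag_width t) => k k0.
have := in_cone_neq0 (width_cone t); move: (width t) => l l0.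
have := in_cone_neq0 (width_cone (- t)); move: (width (- t)) => m m0.
rewrite -[RHS]mulrA -cexpD (mulrACA l^-1) (mulrACA (l^-1 * l^-1)) -!cexpD.
congr *%R; first by field; rewrite l0 m0 k0.
by congr cexp; rewrite rmorphB/=; field; rewrite l0 m0.
Qed.

Definition diag_hat t h xi : R[i] :=
  diag_amp t ^+ n * gaussian (fun=> (diag_width t)^-1) (fun=> - ('i%C * h%:C)) xi.

Lemma cintegrable_packet_triple t h :
  cintegrable (lebesgue_rV n) (fun x => packet t h (triple x x x)).
Proof.
have /funext -> := packet_triple t h; apply: cintegrableZ.
by apply: (gaussian_integral _ _).1 => j; exact: diag_width_cone.
Qed.

Lemma fourier_packet_triple t h :
  fourier (fun x => packet t h (triple x x x)) = diag_hat t h.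
Proof.
apply/funext => xi; have /funext -> := packet_triple t h.
rewrite fourier_gaussian; last by move=> j; exact: diag_width_cone.
rewrite /diag_hat /gaussian.
have -> : diag_amp t ^+ n = \prod_(i < n) diag_amp t by rewrite prodr_const card_ord.
rewrite -!big_split/=.
apply: eq_bigr => j _; rewrite exprVn diag_width_sqr.
have d0 : diag_quad t != 0 by rewrite -diag_width_sqr expf_neq0// in_cone_neq0// diag_width_cone.
have := in_cone_neq0 (diag_width_cone t); move: (diag_width t) => k k0.
rewrite mulrACA mulfK// -cexpD; congr *%R; congr cexp.
have i2 := @sqr_i R; move: ('i%C : R[i]) i2 => i i2.
transitivity (- i * h%:C * (xi ord0 j)%:C + i ^+ 2 * (xi ord0 j)%:C ^+ 2 / (2 * diag_quad t)).
  by field.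
by rewrite i2; field.
Qed.

End diagonal.

(** * Size of the amplitude and of the frequency profile *)

Section diagonal_bounds.
Context {R : realType}.
Implicit Types (t : R).

(** Squaring removes the choice of roots, and (1 + i t)^2 (1 - i t) (3 - i t) / (1 + t^2)
    simplifies. *)
Lemma diag_amp_sqr t : diag_amp t ^+ 2 = ((1 +i* t) * (3 -i* t))^-1.
Proof.
rewrite /diag_amp exprVn; congr (_^-1).
rewrite !exprMn diag_width_sqr !width_sqr /diag_quad.
have h1 := den1_gt0 t; apply/eqP; rewrite eq_complex expr2 /=.
by apply/andP; split; apply/eqP; field; rewrite gt_eqF.
Qed.

Lemma normc_diag_amp t :
  Normc.normc (diag_amp t) ^+ 4 = ((1 + t ^+ 2) * (9 + t ^+ 2))^-1.
Proof.
have nX (z : R[i]) : Normc.normc (z ^+ 2) = Normc.normc z ^+ 2.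
  by rewrite !expr2 Normc.normcM.
rewrite (exprM _ 2 2) -nX diag_amp_sqr Normc.normcV Normc.normcM exprVn exprMn.
by rewrite !normcE_sqr /= sqrrN; congr (_ * _)^-1; rewrite !expr2; ring.
Qed.

Lemma normc_diag_amp_le1 t : Normc.normc (diag_amp t) <= 1.
Proof.
have := normc_diag_amp t; have := normc_ge0 (diag_amp t).
move: (Normc.normc _) => x x0 hx.
have h : x ^+ 4 <= 1.
  rewrite hx invf_le1; last by rewrite mulr_gt0 ?den1_gt0 ?den9_gt0.
  by have := sqr_ge0 t; move: (t ^+ 2) => u u0; nra.
by move: h; rewrite -[X in _ <= X](expr1n _ 4) ler_pXn2r ?nnegrE.
Qed.

Lemma normc_diag_amp_small (e : R) : 0 < e -> exists2 M : R, 0 < M &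
  forall t, M <= `|t| -> Normc.normc (diag_amp t) <= e.
Proof.
(* The modulus decays like 1 / |t|; the cruder bound (1 + u) (9 + u) >= u with u = t^2 suffices and
   gives this threshold. *)
move=> e0; exists (e ^- 2); first by rewrite invr_gt0 exprn_gt0.
move=> t ht; rewrite -(ler_pXn2r (n := 4)) ?nnegrE ?normc_ge0 ?(ltW e0)//.
rewrite normc_diag_amp -[leRHS]invrK lef_pV2 ?posrE; last 2 first.
- by rewrite mulr_gt0 ?den1_gt0 ?den9_gt0.
- by rewrite invr_gt0 exprn_gt0.
have e20 : 0 < e ^- 2 by rewrite invr_gt0 exprn_gt0.
have h : e ^- 4 <= t ^+ 2.
  rewrite -[t ^+ 2]real_normK ?num_real// (exprM _ 2 2) -exprVn.
  by rewrite lerXn2r ?nnegrE ?(ltW e20)// (le_trans (ltW e20)).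
apply: (le_trans h); have := sqr_ge0 t; move: (t ^+ 2) => u u0; nra.
Qed.

Lemma normc_diag_amp_ge t : `|t| <= 1 -> 20^-1 <= Normc.normc (diag_amp t).
Proof.
move=> t1; have := normc_diag_amp t.
have := normc_ge0 (diag_amp t); have := normc_diag_amp_le1 t.
move: (Normc.normc _) => x x1 x0 hx.
(* Here x^4 <= x because x <= 1, and 20 = (1 + 1) (9 + 1) is the largest value of the denominator
   for |t| <= 1. *)
apply: (@le_trans _ _ (x ^+ 4)); last by rewrite exprS ler_piMr// exprn_ile1.
have t2 : t ^+ 2 <= 1 by rewrite -[t ^+ 2]real_normK ?num_real// exprn_ile1.
rewrite hx lef_pV2 ?posrE ?mulr_gt0 ?den1_gt0 ?den9_gt0//.
by have := sqr_ge0 t; move: (t ^+ 2) t2 => u u1 u0; nra.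
Qed.

(* [decay] + i [twist] is the inverse of [diag_quad]. *)
Definition decay t : R := 3 * (1 + t ^+ 2) / (9 + t ^+ 2).
Definition twist t : R := t * (1 + t ^+ 2) / (9 + t ^+ 2).

(** The minimum is attained at t = 0. Being uniform over all t, it also controls the packets far
    from their focal time. *)
Lemma decay_ge t : 3^-1 <= decay t.
Proof.
rewrite /decay ler_pdivlMr ?den9_gt0//; have := sqr_ge0 t.
by move: (t ^+ 2) => u u0; lra.
Qed.

Lemma decay_le1 t : `|t| <= 1 -> decay t <= 1.
Proof.
move=> t1; have t2 : t ^+ 2 <= 1 by rewrite -[t ^+ 2]real_normK ?num_real// exprn_ile1.
by rewrite /decay ler_pdivrMr ?den9_gt0// mul1r; move: (t ^+ 2) t2 => u ?; lra.
Qed.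

Lemma twist_le t : `|t| <= 1 -> `|twist t| <= `|t|.
Proof.
move=> t1; have t2 : t ^+ 2 <= 1 by rewrite -[t ^+ 2]real_normK ?num_real// exprn_ile1.
rewrite /twist -mulrA normrM ler_piMr// ger0_norm; last first.
  by rewrite divr_ge0// ltW// ?den1_gt0 ?den9_gt0.
by rewrite ler_pdivrMr ?den9_gt0// mul1r; move: (t ^+ 2) t2 => u ?; lra.
Qed.

Context {n : nat}.

Lemma diag_gaussianE t (xi : 'rV[R]_n) :
  gaussian (fun=> (diag_width t)^-1) (fun=> 0) xi =
  cexp ((- decay t * dotv xi xi / 2) +i* (- twist t * dotv xi xi / 2)).
Proof.
rewrite /gaussian (_ : _ +i* _ = \sum_(i < n)
   (- decay t * (xi ord0 i ^+ 2) / 2) +i* (- twist t * (xi ord0 i ^+ 2) / 2)); last first.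
  apply/eqP; rewrite eq_complex /dotv; apply/andP; split; apply/eqP => /=.
    rewrite (big_morph (@complex.Re R) (@cReD R) (erefl : @complex.Re R 0 = 0)) /=.
    by rewrite mulr_sumr mulr_suml; apply: eq_bigr => i _; rewrite expr2.
  rewrite (big_morph (@complex.Im R) (@cImD R) (erefl : @complex.Im R 0 = 0)) /=.
  by rewrite mulr_sumr mulr_suml; apply: eq_bigr => i _; rewrite expr2.
rewrite cexp_sum; apply: eq_bigr => i _; congr cexp.
rewrite mul0r addr0 diag_widthV_sqr -/(decay t) -/(twist t).
rewrite (_ : (2 : R[i])^-1 = (2^-1)%:C); last by rewrite fmorphV rmorph_nat.
by rewrite -rmorphXn; simpc; congr (_ +i* _); ring.
Qed.

Lemma normc_diag_gaussian t (xi : 'rV[R]_n) :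
  Normc.normc (gaussian (fun=> (diag_width t)^-1) (fun=> 0) xi) =
  expR (- decay t * dotv xi xi / 2).
Proof. by rewrite diag_gaussianE normc_cexp. Qed.

Lemma normc_diag_gaussian_le t (xi : 'rV[R]_n) :
  Normc.normc (gaussian (fun=> (diag_width t)^-1) (fun=> 0) xi) <=
  expR (- 6^-1 * dotv xi xi).
Proof.
rewrite normc_diag_gaussian ler_expR; have := decay_ge t; have := dotvv_ge0 xi.
by move: (dotv _ _) (decay t) => d c d0 c0; nra.
Qed.

(** The modulation carried by h is a translation of the kernel by (h, ..., h). *)
Lemma diag_gaussian_shift t (h : R) (x xi : 'rV[R]_n) :
  expi (dotv x xi) * gaussian (fun=> (diag_width t)^-1) (fun=> - ('i%C * h%:C)) xi =
  expi (dotv (x - const_mx h) xi) * gaussian (fun=> (diag_width t)^-1) (fun=> 0) xi.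
Proof.
rewrite ![dotv _ xi]dotvC -[dotv xi x]mul1r -[dotv xi (x - _)]mul1r !expi_gaussian.
apply: eq_bigr => i _; congr cexp; congr (_ + _); congr (_ * _).
by rewrite !mxE !mul1r add0r rmorphB/=; ring.
Qed.

End diagonal_bounds.

(** * Translation invariance of Lebesgue measure on R^n *)

Section translation.
Context {R : realType}.
Notation mu := (@lebesgue_measure R).

Lemma lebesgue_measure_translation (a : R) (A : set (measurableTypeR R)) :
  measurable A -> mu ((fun x => x + a) @^-1` A) = mu A.
Proof.
have mf : measurable_fun [set: measurableTypeR R]
    (fun x : measurableTypeR R => x + a : measurableTypeR R).
  exact: measurable_funD.
move=> mA; symmetry.
apply: (@lebesgue_measure_unique R (pushforward mu
    (fun x : measurableTypeR R => x + a : measurableTypeR R))) => //.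
move=> _ [[u v] _ <-] /=; rewrite /pushforward.
rewrite (_ : _ @^-1` _ = `](u - a), (v - a)]%classic); last first.
  by apply/seteqP; split => x /=; rewrite !in_itv/= ltrBlDr lerBrDr.
rewrite !lebesgue_measure_itv /= !lte_fin ltrD2r; case: ifP => // _.
by rewrite -!EFinB; congr _%:E; ring.
Qed.

Lemma measurable_translation n (u : 'rV[R]_n) :
  measurable_fun [set: 'rV[R]_n] (fun x => x + u).
Proof.
apply: measurable_fun_rVP => i; under eq_fun do rewrite mxE.
by apply: measurable_funD => //; exact: measurable_rV_coord.
Qed.

(** Induction on n: the translated product measure agrees with the product measure on rectangles,
    and such a measure is unique. *)
Lemma lebesgue_rV_translation n (u : 'rV[R]_n) (A : set 'rV[R]_n) :
  measurable A -> lebesgue_rV n ((fun x => x + u) @^-1` A) = lebesgue_rV n A.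
Proof.
elim: n u A => [|n ih] u A mA.
  rewrite (_ : (fun x => x + u) = id) ?preimage_id//; apply/funext => x.
  by apply/rowP => -[].
pose a := u ord0 ord0; pose v : 'rV[R]_n := \row_i u ord0 (lift ord0 i).
pose phi (z : measurableTypeR R * 'rV[R]_n) : measurableTypeR R * 'rV[R]_n :=
  (z.1 + a, z.2 + v).
have mphi : measurable_fun [set: measurableTypeR R * 'rV[R]_n] phi.
  apply: measurable_fun_pair; first exact: measurable_funD.
  exact: (measurableT_comp (measurable_translation v)).
have mB : measurable (@rV_cons R n @^-1` A : set (measurableTypeR R * 'rV[R]_n)).
  by rewrite -[X in measurable X]setTI; exact: measurable_rV_cons.
transitivity ((mu \x lebesgue_rV n)%E (phi @^-1` (@rV_cons R n @^-1` A))).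
  rewrite [LHS]/= /lebesgue_rV_step /pushforward; congr ((_ \x _)%E _).
  apply/seteqP; split => z /=; rewrite (_ : rV_cons z + u = rV_cons (phi z))//;
  apply/rowP => i; rewrite mxE; have [j ->|->] := unliftP ord0 i;
  by rewrite ?rV_consS ?rV_cons0 /phi/= ?mxE.
symmetry; apply: (@product_measure_unique _ _ _ _ R mu (lebesgue_rV n)
  (pushforward (mu \x lebesgue_rV n)%E phi)) => // B C mB' mC.
transitivity ((mu \x lebesgue_rV n)%E
    (((fun x : measurableTypeR R => x + a) @^-1` B) `*` ((fun x => x + v) @^-1` C))).
  by [].
rewrite product_measure1E//; last 2 first.
- rewrite -[X in measurable X]setTI.
  by apply: (@measurable_funD _ (measurableTypeR R) R setT id (cst a)).
- by rewrite -[X in measurable X]setTI; exact: measurable_translation.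
by congr *%E; [exact: lebesgue_measure_translation|exact: ih].
Qed.

Lemma Rintegral_translation n (u : 'rV[R]_n) (f : 'rV[R]_n -> R) :
  (lebesgue_rV n).-integrable [set: 'rV[R]_n] (EFin \o f) ->
  (lebesgue_rV n).-integrable [set: 'rV[R]_n] (EFin \o (fun x => f (x + u))) /\
  \int[lebesgue_rV n]_x f (x + u) = \int[lebesgue_rV n]_x f x.
Proof.
move=> fi; have mf : measurable_fun [set: 'rV[R]_n] (EFin \o f) by exact: measurable_int fi.
have mphi := measurable_translation u.
have fi' : (lebesgue_rV n).-integrable [set: 'rV[R]_n] (EFin \o (fun x => f (x + u))).
  apply/integrableP; split; first exact: (measurableT_comp mf).
  have /integrableP[_] := fi; congr (_ < _)%E.
  transitivity (\int[pushforward (lebesgue_rV n) (fun x => (x + u)%R)]_x `|(f x)%:E|)%E.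
    apply: eq_measure_integral => A mA _; symmetry.
    exact: lebesgue_rV_translation.
  rewrite (@ge0_integral_pushforward _ _ _ _ R _ mphi (lebesgue_rV n) setT (fun x => `|(f x)%:E|%E))//.
  exact: measurableT_comp.
split => //; congr fine; symmetry.
transitivity (\int[pushforward (lebesgue_rV n) (fun x => (x + u)%R)]_x (f x)%:E)%E.
  apply: eq_measure_integral => A mA _; symmetry.
  exact: lebesgue_rV_translation.
by rewrite (@integral_pushforward _ _ _ _ R _ mphi (lebesgue_rV n) setT (EFin \o f) mf fi' measurableT).
Qed.

Lemma complex_integral_translation n (u : 'rV[R]_n) (f : 'rV[R]_n -> R[i]) :
  cintegrable (lebesgue_rV n) f ->
  cintegrable (lebesgue_rV n) (fun x => f (x + u)) /\
  complex_integral (lebesgue_rV n) (fun x => f (x + u)) =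
  complex_integral (lebesgue_rV n) f.
Proof.
move=> [f1 f2]; have [a1 a2] := Rintegral_translation u f1.
have [b1 b2] := Rintegral_translation u f2.
by split; [split|rewrite /complex_integral a2 b2].
Qed.

End translation.

(** * The kernel |nabla|^alpha of a Gaussian *)

Section kernel_bounds.
Context {R : realType} {n : nat}.
Variable alpha : R.
Hypothesis alpha_ge0 : 0 <= alpha.
Implicit Types (t : R) (y xi : 'rV[R]_n).
Notation nu := (lebesgue_rV n).

Definition diag_symbol t xi : R[i] :=
  (enorm xi `^ alpha)%:C * gaussian (fun=> (diag_width t)^-1) (fun=> 0) xi.

Definition diag_kernel t : 'rV[R]_n -> R[i] := inverse_fourier (diag_symbol t).

Lemma measurable_weight :
  measurable_fun [set: 'rV[R]_n] (fun xi => enorm xi `^ alpha).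
Proof. exact: (measurableT_comp (@measurable_powR R alpha) (@measurable_enorm R n)). Qed.

Lemma cmeasurable_gaussian (l b : 'I_n -> R[i]) : cmeasurable (gaussian l b).
Proof.
apply: (cmeasurable_prod_rV (F := fun i z =>
  cexp (- l i ^+ 2 / 2 * z%:C ^+ 2 + b i * z%:C))) => i.
have mr : cmeasurable (fun z : R => z%:C).
  by apply: (@cmeasurable_real _ _ _ (fun z : R => z)); exact: measurable_id.
apply: cmeasurable_cexp; apply: cmeasurableD; apply: cmeasurableM => //; try exact: cmeasurable_cst.
exact: (cmeasurableM mr mr).
Qed.

Lemma cmeasurable_diag_symbol t : cmeasurable (diag_symbol t).
Proof.
apply: cmeasurableM; last exact: cmeasurable_gaussian.
exact: (@cmeasurable_real _ _ _ (fun xi => enorm xi `^ alpha) measurable_weight).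
Qed.

(** Half of the rate 1/6 of the profile absorbs |xi|^alpha; the remaining 1/12 does not depend on
    t. *)
Lemma normc_diag_symbol_le : exists2 C : R, 0 < C &
  forall t xi, Normc.normc (diag_symbol t xi) <= C * expR (- 12^-1 * dotv xi xi).
Proof.
have [C C0 hC] := @enorm_powR_le R 12^-1 alpha ltac:(by rewrite invr_gt0) alpha_ge0.
exists C => // t xi.
rewrite /diag_symbol Normc.normcM normc_real ger0_norm ?powR_ge0//.
apply: (le_trans (ler_pM (powR_ge0 _ _) (normc_ge0 _) (hC n xi) (normc_diag_gaussian_le t xi))).
by rewrite -mulrA -expRD ler_wpM2l ?(ltW C0)// ler_expR; have := dotvv_ge0 xi; lra.
Qed.

Lemma integrable_scaled_expR_dotv (C c : R) : 0 < c ->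
  nu.-integrable [set: 'rV[R]_n] (EFin \o (fun xi => C * expR (- c * dotv xi xi))).
Proof.
move=> c0; have := integrableZl measurableT C (@integrable_expR_dotv R n c c0).
exact: eq_integrable.
Qed.

Lemma cintegrable_diag_symbol t : cintegrable nu (diag_symbol t).
Proof.
have [C C0 hC] := normc_diag_symbol_le.
apply: (cintegrable_dominated (cmeasurable_diag_symbol t) _ (hC t)).
by apply: integrable_scaled_expR_dotv; rewrite invr_gt0.
Qed.

Lemma cintegrable_phase_diag_symbol t y :
  cintegrable nu (fun xi => expi (dotv y xi) * diag_symbol t xi).
Proof.
apply: cintegrable_phase; first exact: cintegrable_diag_symbol.
by rewrite (_ : dotv y = fun xi => dotv xi y); [exact: measurable_dotv|exact/funext/dotvC].
Qed.

Lemma normc_expi (a : R) : Normc.normc (expi a) = 1.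
Proof. by rewrite expiE normc_cexp expR0. Qed.

Let N : R := (2 * pi) `^ (- (n%:R / 2)).

Let N_gt0 : 0 < N.
Proof. by rewrite powR_gt0// mulr_gt0// pi_gt0. Qed.

Let normc_N : Normc.normc (N%:C) = N.
Proof. by rewrite normc_real gtr0_norm. Qed.

(** The L^1 norm of the symbol, bounded uniformly in t. It serves for packets away from their focal
    time, whose smallness comes from the amplitude. *)
Lemma diag_kernel_bounded : exists2 K : R, 0 < K & forall t y, Normc.normc (diag_kernel t y) <= K.
Proof.
have [C C0 hC] := normc_diag_symbol_le.
pose J := \int[nu]_xi (C * expR (- 12^-1 * dotv xi xi)).
have J0 : 0 <= J by apply: Rintegral_ge0 => xi _; rewrite mulr_ge0 ?expR_ge0 ?(ltW C0).
exists (N * (2 * J) + 1); first by rewrite ltr_wpDl// mulr_ge0 ?(ltW N_gt0)// mulr_ge0.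
move=> t y; rewrite /diag_kernel /inverse_fourier Normc.normcM -/N normc_N.
apply: (@le_trans _ _ (N * (2 * J))); last by rewrite lerDl.
rewrite ler_wpM2l ?(ltW N_gt0)//; apply: normc_complex_integral.
- exact: cintegrable_phase_diag_symbol.
- by apply: integrable_scaled_expR_dotv; rewrite invr_gt0.
- by move=> xi; rewrite Normc.normcM normc_expi mul1r.
Qed.

Lemma abs_grad_packets I (r : seq I) (c : I -> R[i]) (t h : I -> R) :
  abs_grad alpha (fun x => \sum_(k <- r) c k * packet (t k) (h k) (triple x x x)) =
  (fun x => \sum_(k <- r) c k * (diag_amp (t k) ^+ n * diag_kernel (t k) (x - const_mx (h k)))).
Proof.
apply/funext => x; rewrite /abs_grad /fourier_multiplier.
pose sym k xi := (enorm xi `^ alpha)%:C *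
  gaussian (fun=> (diag_width (t k))^-1) (fun=> - ('i%C * (h k)%:C)) xi.
have -> : (fun xi => (enorm xi `^ alpha)%:C *
     fourier (fun x => \sum_(k <- r) c k * packet (t k) (h k) (triple x x x)) xi) =
   (fun xi => \sum_(k <- r) (c k * diag_amp (t k) ^+ n) * sym k xi).
  apply/funext => xi; rewrite fourier_sum; last by move=> k; exact: cintegrable_packet_triple.
  rewrite mulr_sumr; apply: eq_bigr => k _.
  by rewrite fourier_packet_triple /diag_hat /sym; ring.
have E k y : expi (dotv y x) * sym k x = expi (dotv y x) * sym k x by [].
have [C C0 hC] := normc_diag_symbol_le.
have symE k xi : expi (dotv x xi) * sym k xi =
    expi (dotv (x - const_mx (h k)) xi) * diag_symbol (t k) xi.
  by rewrite /sym mulrCA diag_gaussian_shift mulrCA.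
have isym k : cintegrable nu (sym k).
  apply: (@cintegrable_dominated _ _ _ _ _ (fun xi => C * expR (- 12^-1 * dotv xi xi))).
  - apply: cmeasurableM; last exact: cmeasurable_gaussian.
    exact: (@cmeasurable_real _ _ _ (fun xi => enorm xi `^ alpha) measurable_weight).
  - by apply: integrable_scaled_expR_dotv; rewrite invr_gt0.
  (* The shift identity at x = 0 relates [sym k] to [diag_symbol] through factors of modulus one. *)
  - move=> xi; have := congr1 (@Normc.normc R) (diag_gaussian_shift (t k) (h k) 0 xi).
    rewrite !Normc.normcM !normc_expi !mul1r => e.
    by rewrite e -Normc.normcM; exact: hC.
rewrite inverse_fourier_sum//; apply: eq_bigr => k _; rewrite -mulrA; congr (_ * (_ * _)).
rewrite /diag_kernel /inverse_fourier; congr (_ * _).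
by apply: eq_complex_integral => xi; exact: symE.
Qed.

End kernel_bounds.

Lemma cintegrableB d (T : measurableType d) (R : realType)
    (mu : {measure set T -> \bar R}) (f g : T -> R[i]) :
  cintegrable mu f -> cintegrable mu g -> cintegrable mu (fun x => f x - g x).
Proof.
move=> fi gi; have := cintegrableD fi (cintegrableZ (-1) gi).
by rewrite (_ : (fun x => _) = fun x => f x - g x)//; apply/funext => x; rewrite mulN1r.
Qed.

(** * Limits along sequences *)

Section real_continuity.
Context {R : realType}.

Lemma cvgn_powR (a x : R) (u : nat -> R) : 0 <= a -> (forall k, 0 <= u k) ->
  u k @[k --> \oo] --> x -> u k `^ a @[k --> \oo] --> x `^ a.
Proof.
rewrite le_eqVlt => /predU1P[<- _ _|a0 u0 ux].
  by under eq_fun do rewrite powRr0; rewrite powRr0; exact: cvg_cst.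
have x0 : 0 <= x.
  rewrite -(cvg_lim _ ux)//; apply: limr_ge; first by apply: cvgP ux.
  exact: nearW.
move: x0; rewrite le_eqVlt => /predU1P[x0|x0]; last first.
  have cp : {for x, continuous (fun z : R => z `^ a)}.
    apply: differentiable_continuous; apply/derivable1_diffP.
    by apply: derivable_powR; rewrite in_itv/= x0.
  exact: (cvg_comp u (fun z : R => z `^ a) ux cp).
rewrite -x0 powR0 ?gt_eqF// in ux *; apply/cvgr0Pnorm_le => e e0.
have ea : 0 < e `^ a^-1 by rewrite powR_gt0.
move/cvgr0Pnorm_le : ux => /(_ _ ea); apply: filterS => k /= uk.
rewrite ger0_norm ?powR_ge0//.
have -> : e = (e `^ a^-1) `^ a by rewrite -powRrM mulVf ?gt_eqF// powRr1// ltW.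
apply: ge0_ler_powR; rewrite ?nnegrE ?u0 ?powR_ge0//; first exact: ltW.
by rewrite -(ger0_norm (u0 k)).
Qed.

Lemma cos_ge_1Bnorm (x : R) : 1 - `|x| <= cos x.
Proof.
wlog x0 : x / 0 < x => [h|].
  have [x0|x0|->] := ltrgt0P x; last by rewrite cos0 subr0.
  - by have := h x x0; rewrite gtr0_norm.
  - by rewrite -cosN; have := h (- x); rewrite oppr_gt0 x0 normrN ltr0_norm//; exact.
have [|c _] := @MVT R cos (fun z => - sin z) 0 x x0.
  exact/continuous_subspaceT/continuous_cos.
rewrite cos0 subr0 gtr0_norm// => h.
have : sin c * x <= x by rewrite -[leRHS]mul1r ler_wpM2r ?sin_le1// ltW.
by move: h; lra.
Qed.

Lemma cvgn_normc_1Bcexp (z : nat -> R[i]) (d : nat -> R) :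
  (forall k, `|complex.Re (z k)| <= d k) -> (forall k, `|complex.Im (z k)| <= d k) ->
  d k @[k --> \oo] --> 0 ->
  Normc.normc (1 - cexp (z k)) @[k --> \oo] --> 0.
Proof.
move=> hr hi d0.
have r0 : complex.Re (z k) @[k --> \oo] --> 0.
  apply/norm_cvg0P; apply: (squeeze_cvgr _ (cvg_cst (0 : R)) d0).
  by apply: nearW => k; rewrite normr_ge0 hr.
have i0 : complex.Im (z k) @[k --> \oo] --> 0.
  apply/norm_cvg0P; apply: (squeeze_cvgr _ (cvg_cst (0 : R)) d0).
  by apply: nearW => k; rewrite normr_ge0 hi.
have er : expR (complex.Re (z k)) @[k --> \oo] --> (1 : R).
  by rewrite -expR0; exact: (cvg_comp _ expR r0 (@continuous_expR R 0)).
have ec : cos (complex.Im (z k)) @[k --> \oo] --> (1 : R).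
  by rewrite -cos0; exact: (cvg_comp _ cos i0 (@continuous_cos R 0)).
have es : sin (complex.Im (z k)) @[k --> \oo] --> 0.
  by rewrite -sin0; exact: (cvg_comp _ sin i0 (@continuous_sin R 0)).
have a1 : 1 - expR (complex.Re (z k)) * cos (complex.Im (z k)) @[k --> \oo] --> 0.
  rewrite -[X in _ --> X](subrr (1 : R)) -[X in _ --> _ - X](mulr1 (1 : R)).
  by apply: cvgB; [exact: cvg_cst|exact: cvgM].
have a2 : expR (complex.Re (z k)) * sin (complex.Im (z k)) @[k --> \oo] --> 0.
  by rewrite -[X in _ --> X](mulr0 (1 : R)); exact: cvgM.
have a3 : `|1 - expR (complex.Re (z k)) * cos (complex.Im (z k))| +
   `|expR (complex.Re (z k)) * sin (complex.Im (z k))| @[k --> \oo] --> 0.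
  by rewrite -[X in _ --> X](addr0 (0 : R)); apply: cvgD; apply/norm_cvg0P.
apply: (squeeze_cvgr _ (cvg_cst (0 : R)) a3); apply: nearW => k.
apply/andP; split; first exact: normc_ge0.
apply: (le_trans (normc_le_ReIm _)).
by rewrite /cexp /=; case: (z k) => a b /=; rewrite sub0r normrN.
Qed.

End real_continuity.

(** * Decay of the kernel in space *)

Section kernel_decay.
Local Opaque diag_symbol.
Context {R : realType} {n : nat}.
Variable alpha : R.
Hypothesis alpha_ge0 : 0 <= alpha.
Implicit Types (t : R) (y xi : 'rV[R]_n).
Notation nu := (lebesgue_rV n).
Let N : R := (2 * pi) `^ (- (n%:R / 2)).

Let N_gt0 : 0 < N.
Proof. by rewrite powR_gt0// mulr_gt0// pi_gt0. Qed.

Lemma dotvDl (x y z : 'rV[R]_n) : dotv (x + y) z = dotv x z + dotv y z.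
Proof. by rewrite -big_split; apply: eq_bigr => i _; rewrite mxE mulrDl. Qed.

Lemma dotvDr (x y z : 'rV[R]_n) : dotv z (x + y) = dotv z x + dotv z y.
Proof. by rewrite dotvC dotvDl !(dotvC z). Qed.

Lemma cintegrable_expi_dotv y (f : 'rV[R]_n -> R[i]) : cintegrable nu f ->
  cintegrable nu (fun xi => expi (dotv y xi) * f xi).
Proof.
move=> fi; apply: cintegrable_phase; first exact: fi.
by rewrite (_ : dotv y = fun xi => dotv xi y); [exact: measurable_dotv|exact/funext/dotvC].
Qed.

(* Translating the frequency by u with y.u = pi flips the sign of exp(i y.xi). *)
Lemma diag_kernel_shift t y u : dotv y u = pi ->
  nu.-integrable [set: 'rV[R]_n] (EFin \o (fun xi =>
     Normc.normc (diag_symbol alpha t xi - diag_symbol alpha t (xi + u)))) /\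
  Normc.normc (diag_kernel alpha t y) <=
  N * \int[nu]_xi Normc.normc (diag_symbol alpha t xi - diag_symbol alpha t (xi + u)).
Proof.
have half_le (a b : R) : 2 * a <= 2 * b -> a <= b by move=> ?; lra.
move=> yu; pose g xi := expi (dotv y xi) * diag_symbol alpha t xi.
have ig : cintegrable nu g by exact: cintegrable_phase_diag_symbol.
have is0 : cintegrable nu (diag_symbol alpha t) by exact: cintegrable_diag_symbol.
have [ig' eg] := complex_integral_translation u ig.
have [is1 _] := complex_integral_translation u is0.
have idiff : cintegrable nu (fun xi => diag_symbol alpha t xi - diag_symbol alpha t (xi + u)).
  exact: (cintegrableB is0 is1).
have intd := cintegrable_normc idiff.
split; first exact: intd.
have -> : diag_kernel alpha t y = N%:C * complex_integral nu g by [].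
rewrite Normc.normcM normc_real (gtr0_norm N_gt0); apply: ler_wpM2l; first exact: ltW.
have E2 xi : g (xi + u) = -1 * (expi (dotv y xi) * diag_symbol alpha t (xi + u)).
  rewrite /g dotvDr yu (_ : expi (_ + pi) = - expi (dotv y xi)); first by ring.
  by rewrite /expi cosDpi sinDpi; simpc.
(* Averaging the two forms of the integral; the factor 2 gained here cancels the one lost in
   [normc_complex_integral]. *)
have h2 : 2 * complex_integral nu g = complex_integral nu (fun xi => expi (dotv y xi) *
     (diag_symbol alpha t xi - diag_symbol alpha t (xi + u))).
  rewrite mulr_natl mulr2n -[X in _ + X]eg -(complex_integralD ig ig').
  apply: eq_complex_integral => xi; rewrite E2 /g; ring.
have : Normc.normc (2 * complex_integral nu g) <=
    2 * \int[nu]_xi Normc.normc (diag_symbol alpha t xi - diag_symbol alpha t (xi + u)).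
  rewrite h2; apply: normc_complex_integral; [exact: cintegrable_expi_dotv|exact: intd|].
  by move=> xi; rewrite Normc.normcM normc_expi mul1r.
rewrite Normc.normcM (_ : (2 : R[i]) = 2%:C); last by rewrite rmorph_nat.
by rewrite normc_real (ger0_norm (ler0n R 2)) => h; exact: half_le h.
Qed.

End kernel_decay.

Section kernel_limit.
Context {R : realType} {n : nat}.
Variable alpha : R.
Hypothesis alpha_ge0 : 0 <= alpha.
Implicit Types (t : R) (y xi : 'rV[R]_n).
Notation nu := (lebesgue_rV n).

Let dotv_shift (x u : 'rV[R]_n) : dotv x x <= 2 * dotv (x + u) (x + u) + 2 * dotv u u.
Proof.
rewrite /dotv !mulr_sumr -big_split; apply: ler_sum => i _ /=.
rewrite !mxE; move: (x _ _) (u _ _) => a b.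
(* The difference of the two sides is (a + 2 b)^2. *)
by have := sqr_ge0 (a + 2 * b); rewrite expr2; nra.
Qed.

(** Since |xi + u|^2 >= |xi|^2 / 2 - B, halving the rate 1/12 to 1/24 absorbs the shift. The bound
    serves all t and all such u at once. *)
Lemma diag_symbol_shift_dominated (B : R) : exists G : 'rV[R]_n -> R,
  nu.-integrable [set: 'rV[R]_n] (EFin \o G) /\
  forall t xi u, dotv u u <= B ->
    Normc.normc (diag_symbol alpha t xi - diag_symbol alpha t (xi + u)) <= G xi.
Proof.
have [C C0 hC] := @normc_diag_symbol_le R n alpha alpha_ge0.
exists (fun xi => C * (1 + expR (B / 12)) * expR (- 24^-1 * dotv xi xi)); split.
  by apply: integrable_scaled_expR_dotv; rewrite invr_gt0.
move=> t xi u uB; apply: (le_trans (le_normcD _ _)); rewrite normcN.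
apply: (le_trans (lerD (hC _ _) (hC _ _))).
rewrite -mulrDr -mulrA ler_wpM2l ?(ltW C0)// mulrDl mul1r; apply: lerD.
  by rewrite ler_expR; have := dotvv_ge0 xi; lra.
rewrite -expRD ler_expR; have := dotv_shift xi u.
by move: (dotv xi xi) (dotv (_ + _) _) (dotv u u) uB => a b c ? ?; lra.
Qed.

Lemma dotv_delta (i : 'I_n) (s : R) y : dotv y (s *: delta_mx 0 i) = y ord0 i * s.
Proof.
rewrite /dotv (bigD1 i)//= !mxE eqxx mulr1 big1 ?addr0// => j ji.
by rewrite !mxE (negbTE ji) andbF !mulr0.
Qed.

(** The times [t k] need not converge: the shift multiplies the Gaussian by [cexp (w k)], and
    [decay] and [twist] are bounded by 1 on [-1, 1], so [w k] is controlled by the change [d k] of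
    |xi|^2 alone. *)
Lemma diag_symbol_shift_cvg (i : 'I_n) (t s : nat -> R) xi :
  (forall k, `|t k| <= 1) -> s k @[k --> \oo] --> 0 ->
  Normc.normc (diag_symbol alpha (t k) xi -
    diag_symbol alpha (t k) (xi + s k *: delta_mx 0 i)) @[k --> \oo] --> 0.
Proof.
move=> t1 s0; pose u k : 'rV[R]_n := s k *: delta_mx 0 i.
pose d k := xi ord0 i * s k *+ 2 + s k ^+ 2.
have dE k : dotv (xi + u k) (xi + u k) = dotv xi xi + d k.
  rewrite dotvDl !dotvDr (dotvC (u k)) !dotv_delta !mxE !eqxx mulr1 /d mulr2n expr2.
  by rewrite -!addrA.
have d0 : d k @[k --> \oo] --> 0.
  have -> : 0 = xi ord0 i * 0 *+ 2 + 0 * 0 :> R by rewrite mulr0 mul0rn mulr0 addr0.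
  apply: cvgD.
    by rewrite /GRing.natmul /=; apply: cvgD; apply: cvgM => //; exact: cvg_cst.
  exact: (cvgM s0 s0).
have dn0 : `|d k| @[k --> \oo] --> 0 by apply/norm_cvg0P.
have dd : dotv (xi + u k) (xi + u k) @[k --> \oo] --> dotv xi xi.
  have /funext -> := dE.
  by rewrite -[X in _ --> X](addr0 (dotv xi xi)); apply: cvgD => //; exact: cvg_cst.
pose A k := enorm (xi + u k) `^ alpha.
have eA : A k @[k --> \oo] --> enorm xi `^ alpha.
  apply: cvgn_powR => // [k|]; first exact: enorm_ge0.
  exact: (cvg_comp _ Num.sqrt dd (@sqrt_continuous R _)).
pose w k : R[i] := (- decay (t k) * d k / 2) +i* (- twist (t k) * d k / 2).
have shiftE k : diag_symbol alpha (t k) (xi + u k) =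
    gaussian (fun=> (diag_width (t k))^-1) (fun=> 0) xi * ((A k)%:C * cexp (w k)).
  rewrite /diag_symbol !diag_gaussianE dE mulrCA -cexpD; congr (_ * cexp _).
  by rewrite /w; simpc; congr (_ +i* _); ring.
have bnd k : Normc.normc (diag_symbol alpha (t k) xi - diag_symbol alpha (t k) (xi + u k)) <=
   `|enorm xi `^ alpha - A k| + A k * Normc.normc (1 - cexp (w k)).
  rewrite shiftE /diag_symbol mulrC -mulrBr Normc.normcM.
  apply: (@le_trans _ _ (1 * Normc.normc ((enorm xi `^ alpha)%:C - (A k)%:C * cexp (w k)))).
    apply: ler_wpM2r; first exact: normc_ge0.
    rewrite normc_diag_gaussian -[leRHS]expR0 ler_expR.
    have := dotvv_ge0 xi; have := decay_ge (t k); move: (decay _) (dotv _ _) => a b ? ?.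
    nra.
  rewrite mul1r (_ : _ - _ = (enorm xi `^ alpha - A k)%:C + (A k)%:C * (1 - cexp (w k))).
    apply: (le_trans (le_normcD _ _)); rewrite Normc.normcM !normc_real.
    by rewrite (ger0_norm (powR_ge0 _ _)).
  by rewrite rmorphB/=; ring.
have half (a b : R) : a <= 1 -> 0 <= b -> a * b / 2 <= b by nra.
have w1 k : `|complex.Re (w k)| <= `|d k|.
  rewrite /w /= !normrM normrN [`|_^-1|]ger0_norm//.
  rewrite (ger0_norm (_ : 0 <= decay (t k))); last by apply: le_trans (decay_ge _).
  exact: half (decay_le1 (t1 k)) _.
have w2 k : `|complex.Im (w k)| <= `|d k|.
  rewrite /w /= !normrM normrN [`|_^-1|]ger0_norm//.
  exact: half (le_trans (twist_le (t1 k)) (t1 k)) _.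
have c0 := cvgn_normc_1Bcexp w1 w2 dn0.
have lim : `|enorm xi `^ alpha - A k| + A k * Normc.normc (1 - cexp (w k)) @[k --> \oo] --> 0.
  rewrite -[X in _ --> X](addr0 (0 : R)); apply: cvgD.
    apply/norm_cvg0P; rewrite -[X in _ --> X](subrr (enorm xi `^ alpha)).
    by apply: cvgB => //; exact: cvg_cst.
  by rewrite -[X in _ --> X](mulr0 (enorm xi `^ alpha)); exact: cvgM.
apply: (squeeze_cvgr _ (cvg_cst (0 : R)) lim); apply: nearW => k.
by apply/andP; split; [exact: normc_ge0|exact: bnd].
Qed.

(** Arguing by contradiction along a sequence of bad points makes dominated convergence applicable
    and yields uniformity in t. *)
Lemma diag_kernel_decay (i : 'I_n) (e : R) : 0 < e -> exists2 M : R, 0 < M &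
  forall t y, `|t| <= 1 -> M <= `|y ord0 i| -> Normc.normc (diag_kernel alpha t y) <= e.
Proof.
move=> e0; apply: contrapT => nM.
have bad (k : nat) : exists p : R * 'rV[R]_n,
    [/\ `|p.1| <= 1, k.+1%:R <= `|p.2 ord0 i| & e < Normc.normc (diag_kernel alpha p.1 p.2)].
  apply: contrapT => nP; apply: nM; exists k.+1%:R => // t y t1 yk.
  by rewrite leNgt; apply/negP => ke; apply: nP; exists (t, y).
have {bad}[f hf] := choice bad.
(* The shift by pi / y_i along direction i has scalar product pi with y, and it tends to 0 because
   |y_i| >= k + 1. *)
pose t k := (f k).1; pose y k := (f k).2; pose s k := pi / y k ord0 i.
have t1 k : `|t k| <= 1 by have [] := hf k.
have yk k : k.+1%:R <= `|y k ord0 i| by have [] := hf k.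
have y0 k : y k ord0 i != 0.
  by rewrite -normr_gt0; apply: lt_le_trans (yk k).
have sk k : `|s k| <= pi * k.+1%:R^-1.
  rewrite normrM normfV (ger0_norm (pi_ge0 R)) ler_wpM2l ?pi_ge0//.
  by rewrite lef_pV2 ?posrE ?normr_gt0.
have s0 : s k @[k --> \oo] --> 0.
  have h : pi * k.+1%:R^-1 @[k --> \oo] --> (0 : R).
    rewrite -[X in _ --> X](mulr0 (pi : R)); apply: cvgM; first exact: cvg_cst.
    exact: cvg_harmonic.
  apply/norm_cvg0P; apply: (squeeze_cvgr _ (cvg_cst (0 : R)) h).
  by apply: nearW => k; rewrite normr_ge0 sk.
pose u k : 'rV[R]_n := s k *: delta_mx 0 i.
have uB k : dotv (u k) (u k) <= pi ^+ 2.
  rewrite dotv_delta !mxE !eqxx mulr1 -expr2 -[s k ^+ 2]real_normK ?num_real//.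
  rewrite lerXn2r ?nnegrE ?pi_ge0//; apply: (le_trans (sk k)).
  by rewrite ler_piMr ?pi_ge0// invf_le1// ler1n.
have yu k : dotv (y k) (u k) = pi by rewrite dotv_delta mulrCA mulfV ?mulr1.
have [G [intG hG]] := diag_symbol_shift_dominated (pi ^+ 2).
pose g k xi := Normc.normc (diag_symbol alpha (t k) xi - diag_symbol alpha (t k) (xi + u k)).
have ig k : nu.-integrable [set: 'rV[R]_n] (EFin \o g k) by have [] := diag_kernel_shift alpha_ge0 (t k) (yu k).
have [||||_ _ lim] := @dominated_convergence _ _ R nu setT measurableT
   (fun k => EFin \o g k) (cst 0%E) (EFin \o G) _ _ _ intG.
- by move=> k; exact: measurable_int (ig k).
- exact: measurable_cst.
- apply: nearW => xi _ /=; apply: cvg_EFin; first exact: nearW.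
  exact: diag_symbol_shift_cvg.
- apply: nearW => xi k _ /=; rewrite lee_fin ger0_norm ?normc_ge0//.
  by apply: hG; exact: uB.
pose N : R := (2 * pi) `^ (- (n%:R / 2)).
have N0 : 0 < N by rewrite powR_gt0// mulr_gt0// pi_gt0.
have lim' : \int[nu]_xi g k xi @[k --> \oo] --> 0.
  rewrite integral0 in lim.
  exact: (fine_cvg lim).
have : \forall k \near \oo, \int[nu]_xi g k xi < e / N.
  by move/cvgrPdist_lt : lim' => /(_ (e / N)); rewrite divr_gt0// => /(_ isT);
     apply: filterS => k; rewrite sub0r normrN; apply: le_lt_trans; exact: ler_norm.
case=> k _ /(_ k (leqnn k)) /=; rewrite ltr_pdivlMr// => small.
have [_ _ big] := hf k; have [_ kb] := diag_kernel_shift alpha_ge0 (t k) (yu k).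
have := lt_le_trans big kb; rewrite mulrC => /lt_trans/(_ small).
by rewrite ltxx.
Qed.

End kernel_limit.

(** * Lower bound for the kernel near the origin *)

Section kernel_lower.
Context {R : realType} {n : nat}.
Variable alpha : R.
Hypothesis alpha_ge0 : 0 <= alpha.
Implicit Types (t : R) (y xi : 'rV[R]_n).
Notation nu := (lebesgue_rV n).

Let norm_le_1Dsqr (a : R) : `|a| <= 1 + a * a.
Proof.
rewrite -expr2 -[a ^+ 2]real_normK ?num_real//; move: `|a| (normr_ge0 a) => b b0.
nra.
Qed.

(* For small t and y the phase of the integrand defining the kernel is small, so
   the kernel stays close to the integral of a positive function. *)
Lemma diag_kernel_lower (n_gt0 : (0 < n)%N) : exists2 d : R, 0 < d <= 1 & exists2 c : R, 0 < c &
  forall t y, `|t| <= d -> (forall i, `|y ord0 i| <= d) ->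
    c <= Normc.normc (diag_kernel alpha t y).
Proof.
pose W xi : R := enorm xi `^ alpha.
have W0 xi : 0 <= W xi by exact: powR_ge0.
have mW : measurable_fun [set: 'rV[R]_n] W by exact: measurable_weight.
have [C C0 hC] := @enorm_powR_le R 12^-1 alpha ltac:(by rewrite invr_gt0) alpha_ge0.
have [C2 C20 hC2] := @exprn_le_expR R 24^-1 1 ltac:(by rewrite invr_gt0).
(* [lo] uses the largest rate, [decay t <= 1]; [hi] times d bounds the loss due to the phase. Its
   rate is 1/6, minus 1/12 for |xi|^alpha, minus 1/24 for the growth of the phase. *)
pose lo xi := W xi * expR (- 2^-1 * dotv xi xi).
pose hi xi := (n%:R + 2) * C2 * C * expR (- 24^-1 * dotv xi xi).
have ihi : nu.-integrable [set: 'rV[R]_n] (EFin \o hi).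
  by apply: integrable_scaled_expR_dotv; rewrite invr_gt0.
have mlo : measurable_fun [set: 'rV[R]_n] lo.
  apply: measurable_funM => //; apply: (measurableT_comp (@measurable_expR R)).
  by apply: measurable_funM => //; exact: measurable_dotvv.
have WC xi : W xi <= C * expR (12^-1 * dotv xi xi) by exact: hC.
have ilo : nu.-integrable [set: 'rV[R]_n] (EFin \o lo).
  apply: (le_integrable measurableT _ _ (@integrable_scaled_expR_dotv R n C 12^-1 _)).
  - exact/measurable_EFinP.
  - move=> xi _ /=; rewrite lee_fin !ger0_norm ?mulr_ge0 ?expR_ge0 ?(ltW C0)//.
    rewrite /lo; apply: (le_trans (ler_wpM2r (expR_ge0 _) (WC xi))).
    rewrite -mulrA -expRD ler_wpM2l ?(ltW C0)// ler_expR.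
    by have := dotvv_ge0 xi; lra.
  - by rewrite invr_gt0.
pose J1 := \int[nu]_xi lo xi; pose J2 := \int[nu]_xi hi xi.
have J1gt0 : 0 < J1.
  (* On [1, 2]^n one has |xi| >= 1, as n >= 1, so the weight |xi|^alpha is at least 1; also |xi|^2
     <= 4 n. *)
  pose B := [set x : 'rV[R]_n | forall i, `[1, 2]%classic (x ord0 i)].
  have mB : measurable B.
    have -> : B = \bigcap_(i in [set: 'I_n]) ((fun x : 'rV[R]_n => x ord0 i) @^-1` `[1, 2]%classic).
      by apply/seteqP; split=> [x xA i _|x xA i] /=; [exact: xA|exact: (xA i)].
    apply: fin_bigcap_measurable => // i _.
    by rewrite -[X in measurable X]setTI; exact: measurable_rV_coord.
  have nuB : nu B = 1%E.
    rewrite /B (@lebesgue_rV_box R n (fun=> `[1, 2]%classic))// big1// => i _.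
    by rewrite lebesgue_measure_itv/= lte_fin ltr1n -EFinB; congr _%:E; ring.
  pose c := expR (- 2^-1 * (n%:R * 4)) : R.
  have cB xi : c * \1_B xi <= lo xi.
    rewrite indicE; case: (boolP (xi \in B)) => [|_]; last by rewrite mulr0 mulr_ge0 ?expR_ge0.
    rewrite inE => Bxi; rewrite mulr1 /lo -[leLHS]mul1r.
    have e1 : 1 <= dotv xi xi.
      rewrite /dotv (bigD1 (Ordinal n_gt0))//=; have := Bxi (Ordinal n_gt0).
      rewrite /= in_itv /= => /andP[x1 _]; rewrite -[leLHS]addr0; apply: lerD.
        by rewrite -expr2 exprn_ege1.
      by apply: sumr_ge0 => j _; exact: sqr_ge0.
    have e2 : dotv xi xi <= n%:R * 4.
      rewrite mulr_natl -[X in _ *+ X]card_ord -sumr_const; apply: ler_sum => j _.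
      have := Bxi j; rewrite /= in_itv /= => /andP[x1 x2].
      by rewrite -expr2 (_ : 4 = 2 ^+ 2 :> R) ?lerXn2r ?nnegrE//; [apply: le_trans x1|rewrite expr2; ring].
    apply: ler_pM => //; first exact: expR_ge0.
      apply: (@le_trans _ _ (1 `^ alpha)); first by rewrite powR1.
      apply: ge0_ler_powR => //; rewrite ?nnegrE ?enorm_ge0//.
      by rewrite -[leLHS]sqrtr1 ler_sqrt// (le_trans _ e1).
    by rewrite ler_expR; lra.
  apply: (@lt_le_trans _ _ c); first exact: expR_gt0.
  rewrite -lee_fin /J1 /Rintegral fineK; last exact: integrable_fin_num.
  apply: (@le_trans _ _ (\int[nu]_xi (c%:E * (\1_B xi)%:E))%E).
    rewrite ge0_integralZl//; last 2 first.
    - exact/measurable_EFinP/measurable_indic.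
    - by rewrite lee_fin expR_ge0.
    have -> : (\int[nu]_x (\1_B x)%:E = 1%:E)%E by rewrite integral_indic// setIT.
    by rewrite mule1.
  apply: ge0_le_integral => //.
  - by move=> xi _; rewrite -EFinM lee_fin mulr_ge0 ?expR_ge0.
  - by apply: measurable_funeM; exact/measurable_EFinP/measurable_indic.
  - exact/measurable_EFinP.
  - by move=> xi _; rewrite -EFinM lee_fin.
have J2ge0 : 0 <= J2.
  apply: Rintegral_ge0 => xi _; rewrite !mulr_ge0 ?expR_ge0 ?(ltW C0) ?(ltW C20)//.
(* Chosen so that d J2 <= J1 / 2: the loss is at most half of the main term. *)
pose d := Num.min 1 (J1 / (2 * (J2 + 1))).
have J21 : 0 < J2 + 1 by rewrite ltr_wpDl.
have d0 : 0 < d by rewrite lt_min ltr01 divr_gt0// mulr_gt0.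
have d1 : d <= 1 by rewrite ge_min lexx.
have dJ : d * J2 <= J1 / 2.
  apply: (@le_trans _ _ (d * (J2 + 1))); first by rewrite ler_wpM2l ?(ltW d0)// lerDl.
  rewrite -ler_pdivlMr//; apply: (@le_trans _ _ (J1 / (2 * (J2 + 1)))).
    by rewrite ge_min lexx orbT.
  by rewrite invfM mulrA.
pose N : R := (2 * pi) `^ (- (n%:R / 2)).
have N0 : 0 < N by rewrite powR_gt0// mulr_gt0// pi_gt0.
exists d; first by rewrite d0.
exists (N * (J1 / 2)); first by rewrite mulr_gt0// divr_gt0.
move=> t y td yd.
have t1 : `|t| <= 1 by apply: le_trans d1.
have [iRe iIm] := cintegrable_phase_diag_symbol alpha_ge0 t y.
(* From cos th >= 1 - |th|, where the phase satisfies |th| <= d (n + 2) (1 + |xi|^2). *)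
have key xi : lo xi - d * hi xi <= complex.Re (expi (dotv y xi) * diag_symbol alpha t xi).
  set D := dotv xi xi.
  have D0 : 0 <= D by exact: dotvv_ge0.
  pose th := dotv y xi + - twist t * D / 2.
  have -> : complex.Re (expi (dotv y xi) * diag_symbol alpha t xi) =
      W xi * expR (- decay t * D / 2) * cos th.
    rewrite /diag_symbol diag_gaussianE mulrCA expiE -cexpD; simpc => /=.
    by rewrite mulrA /th /D !mulNr.
  have thd : `|th| <= d * ((n%:R + 2) * (1 + D)).
    have dn : `|dotv y xi| <= d * (n%:R + D).
      rewrite /dotv; apply: (le_trans (ler_norm_sum _ _ _)).
      rewrite -[X in n%:R + X]/(dotv xi xi) /dotv -[X in X%:R]card_ord.
      rewrite -sum1_card natr_sum -big_split mulr_sumr.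
      apply: ler_sum => i _ /=; rewrite normrM.
      by apply: ler_pM; last exact: norm_le_1Dsqr.
    have dt : `|- twist t * D / 2| <= d * D.
      rewrite !normrM normrN [`|_^-1|]ger0_norm// (ger0_norm D0).
      have := le_trans (twist_le t1) td; have := normr_ge0 (twist t).
      by move: `|twist t| => a a0 ad; nra.
    apply: (le_trans (ler_normD _ _)); apply: (le_trans (lerD dn dt)).
    rewrite -mulrDr; apply: ler_wpM2l; first exact: ltW.
    have : 0 <= n%:R * D by rewrite mulr_ge0.
    by rewrite mulrDr mulr1 mulrDl; lra.
  have h1 : W xi * expR (- decay t * D / 2) * (1 - `|th|) <=
      W xi * expR (- decay t * D / 2) * cos th.
    by apply: ler_wpM2l; [rewrite mulr_ge0 ?expR_ge0|exact: cos_ge_1Bnorm].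
  apply: le_trans h1; rewrite mulrBr mulr1; apply: lerB.
    rewrite /lo -/D; apply: ler_wpM2l => //; rewrite ler_expR.
    by have := decay_le1 t1; move: (decay t) => a ?; nra.
  apply: (@le_trans _ _ ((C * expR (- 12^-1 * D)) * (d * ((n%:R + 2) * (C2 * expR (24^-1 * D)))))).
    apply: ler_pM => //; first by rewrite mulr_ge0 ?expR_ge0.
      apply: (@le_trans _ _ (C * expR (12^-1 * D) * expR (- 6^-1 * D))).
        apply: ler_pM => //.
        rewrite ler_expR; have := decay_ge t; move: (decay t) => a ?; nra.
      by rewrite -mulrA -expRD ler_wpM2l ?(ltW C0)// ler_expR; lra.
    apply: (le_trans thd); rewrite ler_wpM2l ?(ltW d0)// ler_wpM2l ?addr_ge0//.
    by have := hC2 D D0; rewrite expr1.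
  rewrite /hi -/D.
  have -> : expR (- 24^-1 * D) = expR (- 12^-1 * D) * expR (24^-1 * D).
    by rewrite -expRD; congr expR; field.
  by rewrite le_eqVlt; apply/orP; left; apply/eqP; ring.
have Nn : Normc.normc N%:C = N by rewrite normc_real gtr0_norm.
have -> : diag_kernel alpha t y = N%:C * complex_integral nu
   (fun xi => expi (dotv y xi) * diag_symbol alpha t xi) by [].
rewrite Normc.normcM Nn; apply: ler_wpM2l; first exact: ltW.
apply: le_trans (normr_Re_normc _); apply: le_trans (ler_norm _).
rewrite /complex_integral [leRHS]/=.
have idhi : nu.-integrable [set: 'rV[R]_n] (EFin \o (fun xi => d * hi xi)).
  by apply: eq_integrable (integrableZl measurableT d ihi).
apply: (@le_trans _ _ (\int[nu]_xi (lo xi - d * hi xi))).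
  rewrite RintegralB// RintegralZl// -/J1 -/J2.
  by move: (d * J2) dJ => a ?; lra.
apply: le_Rintegral => //.
have := integrableB measurableT ilo idhi.
exact: eq_integrable.
Qed.

End kernel_lower.

(** * Gaussian packets are Schwartz functions *)

Section schwartz_gaussians.
Context {R : realType} {m : nat}.
Notation V := 'rV[R]_m.
Implicit Types (f g A B u : V -> R) (i j : 'I_m).

(** Full differentiability is carried along with the partial derivatives: it gives continuity and
    makes the chain rule available. *)
Definition gradient_of f (df : 'I_m -> V -> R) := forall x,
  differentiable f x /\ forall i, 'D_(delta_mx ord0 i) f x = df i x.

Lemma gradient_cst c : gradient_of (fun=> c) (fun _ _ => 0).
Proof. by move=> x; split => [|i]; [exact: differentiable_cst|rewrite derive_cst]. Qed.

Lemma gradient_coord j : gradient_of (fun x => x ord0 j) (fun i _ => (i == j)%:R).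
Proof.
move=> x; split => [|i]; first exact: differentiable_coord.
rewrite /derive; apply: cvg_lim => //; apply: cvg_near_cst.
near=> h; rewrite /= !mxE eqxx /= addrK.
rewrite /GRing.scale /= [j == i]eq_sym mulrA mulVf ?mul1r//.
by near: h; exact: nbhs_dnbhs_neq.
Unshelve. all: by end_near. Qed.

Lemma gradientD f df g dg : gradient_of f df -> gradient_of g dg ->
  gradient_of (fun x => f x + g x) (fun i x => df i x + dg i x).
Proof.
move=> hf hg x; have [df1 df2] := hf x; have [dg1 dg2] := hg x.
split => [|i]; first exact: (differentiableD df1 dg1).
by rewrite (deriveD (diff_derivable df1) (diff_derivable dg1)) df2 dg2.
Qed.

Lemma gradientM f df g dg : gradient_of f df -> gradient_of g dg ->
  gradient_of (fun x => f x * g x) (fun i x => df i x * g x + f x * dg i x).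
Proof.
move=> hf hg x; have [df1 df2] := hf x; have [dg1 dg2] := hg x.
split => [|i]; first exact: (differentiableM df1 dg1).
rewrite (deriveM (diff_derivable df1) (diff_derivable dg1)) df2 dg2.
by rewrite /GRing.scale /= addrC mulrC.
Qed.

Lemma gradient_comp (h dh : R -> R) f df :
  (forall y : R, is_derive y (1 : R) h (dh y)) -> gradient_of f df ->
  gradient_of (fun x => h (f x)) (fun i x => dh (f x) * df i x).
Proof.
move=> hh hf x; have [df1 df2] := hf x.
have dhx : differentiable h (f x).
  by apply/derivable1_diffP; exact: (@ex_derive _ _ _ _ _ _ _ (hh (f x))).
split => [|i]; first exact: (differentiable_comp df1 dhx).
rewrite (deriveE _ (differentiable_comp df1 dhx)) (diff_comp df1 dhx) /=.
rewrite -(deriveE _ df1) df2 -[df i x in LHS]mulr1 -[df i x * 1]/(df i x *: (1 : R)).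
rewrite linearZ /= -(deriveE _ dhx) (@derive_val _ _ _ _ _ _ _ (hh (f x))).
by rewrite /GRing.scale /= mulrC.
Qed.

(** Polynomial functions are generated by rules, so that gradients and growth bounds follow by
    induction on the rules. *)
Inductive polyf : (V -> R) -> Prop :=
| polyf_cst c : polyf (fun=> c)
| polyf_coord j : polyf (fun x => x ord0 j)
| polyf_add f g : polyf f -> polyf g -> polyf (fun x => f x + g x)
| polyf_mul f g : polyf f -> polyf g -> polyf (fun x => f x * g x).

Lemma polyf_gradient f : polyf f ->
  exists2 df, (forall i, polyf (df i)) & gradient_of f df.
Proof.
elim=> [c|j|{}f g pf [df pdf gf] pg [dg pdg gg]|{}f g pf [df pdf gf] pg [dg pdg gg]].
- by exists (fun _ _ => 0); [move=> i; exact: polyf_cst|exact: gradient_cst].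
- by exists (fun i _ => (i == j)%:R); [move=> i; exact: polyf_cst|exact: gradient_coord].
- exists (fun i x => df i x + dg i x); last exact: gradientD.
  by move=> i; apply: polyf_add.
- exists (fun i x => df i x * g x + f x * dg i x); last exact: gradientM.
  by move=> i; apply: polyf_add; apply: polyf_mul.
Qed.

Lemma polyf_opp f : polyf f -> polyf (fun x => - f x).
Proof.
move=> pf; have := polyf_mul (polyf_cst (-1)) pf.
by rewrite (_ : (fun x => _) = fun x => - f x)//; apply/funext => x; rewrite mulN1r.
Qed.

Lemma polyf_exp f k : polyf f -> polyf (fun x => f x ^+ k).
Proof.
move=> pf; elim: k => [|k ih].
  have -> : (fun x => f x ^+ 0) = fun=> 1 by apply/funext.
  exact: polyf_cst.
have -> : (fun x => f x ^+ k.+1) = (fun x => f x * f x ^+ k).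
  by apply/funext => x; rewrite exprS.
exact: polyf_mul.
Qed.

Lemma polyf_sum I (r : seq I) (F : I -> V -> R) : (forall k, polyf (F k)) ->
  polyf (fun x => \sum_(k <- r) F k x).
Proof.
move=> pF; elim: r => [|k r ih].
  have -> : (fun x => \sum_(k <- [::]) F k x) = fun=> 0.
    by apply/funext => x; rewrite big_nil.
  exact: polyf_cst.
have -> : (fun x => \sum_(l <- k :: r) F l x) = (fun x => F k x + \sum_(l <- r) F l x).
  by apply/funext => x; rewrite big_cons.
exact: polyf_add.
Qed.

Lemma polyf_prod I (r : seq I) (F : I -> V -> R) : (forall k, polyf (F k)) ->
  polyf (fun x => \prod_(k <- r) F k x).
Proof.
move=> pF; elim: r => [|k r ih].
  have -> : (fun x => \prod_(k <- [::]) F k x) = fun=> 1.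
    by apply/funext => x; rewrite big_nil.
  exact: polyf_cst.
have -> : (fun x => \prod_(l <- k :: r) F l x) = (fun x => F k x * \prod_(l <- r) F l x).
  by apply/funext => x; rewrite big_cons.
exact: polyf_mul.
Qed.

Lemma polyf_growth f : polyf f -> forall e : R, 0 < e ->
  exists2 K : R, 0 <= K & forall x, `|f x| <= K * expR (e * dotv x x).
Proof.
elim=> [c|j|{}f g _ ihf _ ihg|{}f g _ ihf _ ihg] e e0.
- exists `|c| => // x; rewrite ler_peMr// -[leLHS]expR0 ler_expR.
  by rewrite mulr_ge0 ?dotvv_ge0// ltW.
- have [C C0 hC] := exprn_le_expR 1 e0; exists C; first exact: ltW.
  move=> x; apply: le_trans (hC _ (dotvv_ge0 x)); rewrite expr1.
  have h : x ord0 j * x ord0 j <= dotv x x.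
    rewrite /dotv (bigD1 j)//= lerDl; apply: sumr_ge0 => k _; exact: sqr_ge0.
  apply: (@le_trans _ _ (1 + x ord0 j * x ord0 j)); last by rewrite lerD2l.
  rewrite -expr2 -[_ ^+ 2]real_normK ?num_real//; move: `|_| (normr_ge0 (x ord0 j)) => b b0.
  nra.
- have [K K0 hK] := ihf e e0; have [L L0 hL] := ihg e e0.
  exists (K + L); first exact: addr_ge0.
  by move=> x; rewrite mulrDl; apply: (le_trans (ler_normD _ _)); exact: lerD.
(* Each factor of the product receives half of the exponential rate. *)
- have e20 : 0 < e / 2 by rewrite divr_gt0.
  have [K K0 hK] := ihf _ e20; have [L L0 hL] := ihg _ e20.
  exists (K * L); first exact: mulr_ge0.
  move=> x; rewrite normrM; apply: (le_trans (ler_pM _ _ (hK x) (hL x))) => //.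
  rewrite mulrACA -expRD ler_wpM2l ?mulr_ge0// ler_expR -mulrDl.
  by rewrite -splitr.
Qed.

(* A class of functions stable under partial derivatives; the growth bound on u
   makes its members rapidly decreasing. *)
Inductive gaussf : (V -> R) -> Prop :=
| gaussf_wave A B u th : polyf A -> polyf B -> polyf u -> polyf th ->
    (exists C, exists2 c, 0 < c & forall x, u x <= C - c * dotv x x) ->
    gaussf (fun x => expR (u x) * (A x * cos (th x) + B x * sin (th x)))
| gaussf_add f g : gaussf f -> gaussf g -> gaussf (fun x => f x + g x).

Lemma gaussf_gradient f : gaussf f ->
  exists2 df, (forall i, gaussf (df i)) & gradient_of f df.
Proof.
elim=> [A B u th pA pB pu pth hu|{}f g _ [df pf gf] _ [dg pg gg]]; last first.
  exists (fun i x => df i x + dg i x); last exact: gradientD.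
  by move=> i; exact: gaussf_add.
have [dA pdA gA] := polyf_gradient pA; have [dB pdB gB] := polyf_gradient pB.
have [du pdu gu] := polyf_gradient pu; have [dt pdt gt] := polyf_gradient pth.
(* Coefficients of the cosine and of the sine in the i-th derivative of exp(u) (A cos th + B sin
   th). *)
pose P i x := (dA i x + A x * du i x) + B x * dt i x.
pose Q i x := (dB i x + B x * du i x) + - (A x * dt i x).
exists (fun i x => expR (u x) * (P i x * cos (th x) + Q i x * sin (th x))).
  move=> i; apply: gaussf_wave => //; rewrite /P /Q.
    by apply: polyf_add; [apply: polyf_add|]; try apply: polyf_mul.
  by apply: polyf_add; [apply: polyf_add|apply: polyf_opp]; try apply: polyf_mul.
have ge := gradient_comp (@is_derive_expR R) gu.
have gc := gradient_comp (@is_derive_cos R) gt.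
have gs := gradient_comp (@is_derive_sin R) gt.
have := gradientM ge (gradientD (gradientM gA gc) (gradientM gB gs)).
move=> h x; have [h1 h2] := h x; split => // i; rewrite h2 /P /Q; ring.
Qed.

Lemma gaussf_bounded f A : gaussf f -> polyf A ->
  exists K : R, forall x, `|A x * f x| <= K.
Proof.
move=> gf pA; elim: gf => [P Q u th pP pQ _ _ [C [c c0 hu]]|{}f g _ [K hK] _ [L hL]]; last first.
  by exists (K + L) => x; rewrite mulrDr; apply: (le_trans (ler_normD _ _)); exact: lerD.
(* The polynomials are bounded with exactly the rate c at which exp(u) decays, so the exponentials
   cancel. *)
have [K K0 hK] := polyf_growth (polyf_mul pA pP) c0.
have [L L0 hL] := polyf_growth (polyf_mul pA pQ) c0.
exists (expR C * (K + L)) => x.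
have -> : A x * (expR (u x) * (P x * cos (th x) + Q x * sin (th x))) =
   expR (u x) * ((A x * P x) * cos (th x) + (A x * Q x) * sin (th x)) by ring.
have hc : `|cos (th x)| <= 1 by rewrite ler_norml cos_geN1 cos_le1.
have hs : `|sin (th x)| <= 1 by rewrite ler_norml sin_geN1 sin_le1.
rewrite normrM (ger0_norm (expR_ge0 _)).
apply: (@le_trans _ _ (expR (C - c * dotv x x) * ((K + L) * expR (c * dotv x x)))).
  apply: ler_pM => //; first by rewrite ler_expR.
  rewrite mulrDl; apply: (le_trans (ler_normD _ _)); rewrite !normrM.
  by apply: lerD; rewrite -[leRHS]mulr1 ler_pM// -normrM.
by rewrite mulrCA -expRD subrK mulrC.
Qed.

Lemma gaussf_iter_pderiv f s : gaussf f -> gaussf (iter_pderiv s f).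
Proof.
move=> gf; elim: s => //= i s ih; have [df gdf gr] := gaussf_gradient ih.
suff -> : pderiv i (iter_pderiv s f) = df i by [].
by apply/funext => x; have [_ h] := gr x; exact: h.
Qed.

Lemma real_schwartz_gaussf f : gaussf f -> real_schwartz f.
Proof.
move=> gf; split=> [s|b s].
  have [df gdf gr] := gaussf_gradient (gaussf_iter_pderiv s gf).
  split=> [x|i x]; have [d _] := gr x.
    exact: differentiable_continuous.
  exact: diff_derivable.
apply: gaussf_bounded; first exact: gaussf_iter_pderiv.
by apply: polyf_prod => i; apply: polyf_exp; exact: polyf_coord.
Qed.

Lemma polyf_dotv : polyf (fun x => dotv x x).
Proof. by apply: polyf_sum => i; apply: polyf_mul; exact: polyf_coord. Qed.

Lemma gaussf0 : gaussf (fun=> 0).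
Proof.
have -> : (fun=> 0) = (fun x : V => expR (- dotv x x) * (0 * cos 0 + 0 * sin 0)) :> (V -> R).
  by apply/funext => x; rewrite !mul0r addr0 mulr0.
apply: gaussf_wave; try exact: polyf_cst; first exact/polyf_opp/polyf_dotv.
by exists 0, 1 => // x; rewrite sub0r mul1r.
Qed.

Lemma gaussf_sum I (r : seq I) (F : I -> V -> R) : (forall k, gaussf (F k)) ->
  gaussf (fun x => \sum_(k <- r) F k x).
Proof.
move=> gF; elim: r => [|k r ih].
  have -> : (fun x => \sum_(k <- [::]) F k x) = fun=> 0.
    by apply/funext => x; rewrite big_nil.
  exact: gaussf0.
have -> : (fun x => \sum_(l <- k :: r) F l x) = (fun x => F k x + \sum_(l <- r) F l x).
  by apply/funext => x; rewrite big_cons.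
exact: gaussf_add.
Qed.

Lemma gaussf_cexp (K : R[i]) (u th : V -> R) : polyf u -> polyf th ->
  (exists C, exists2 c, 0 < c & forall x, u x <= C - c * dotv x x) ->
  gaussf (fun x => complex.Re (K * cexp (u x +i* th x))) /\
  gaussf (fun x => complex.Im (K * cexp (u x +i* th x))).
Proof.
move=> pu pth hu; case: K => a b; split.
  have -> : (fun x => complex.Re ((a +i* b) * cexp (u x +i* th x))) =
     (fun x => expR (u x) * (a * cos (th x) + - b * sin (th x))).
    by apply/funext => x; rewrite /cexp; simpc => /=; ring.
  by apply: gaussf_wave => //; exact: polyf_cst.
have -> : (fun x => complex.Im ((a +i* b) * cexp (u x +i* th x))) =
   (fun x => expR (u x) * (b * cos (th x) + a * sin (th x))).
  by apply/funext => x; rewrite /cexp; simpc => /=; ring.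
by apply: gaussf_wave => //; exact: polyf_cst.
Qed.

End schwartz_gaussians.

(** * Packets are Schwartz functions *)

Section schwartz_packets.
Context {R : realType} {n : nat}.
Notation V := 'rV[R]_(n + (n + n)).

(** The exponent is a quadratic polynomial whose real part has leading coefficient - 1 / (2 (1 +
    t^2)) in every coordinate, because [sgn3] squares to 1. *)
Let packet_cexp (c : R[i]) (t h : R) : exists K (u th : V -> R),
  [/\ polyf u, polyf th,
      exists C, exists2 c, 0 < c & forall x, u x <= C - c * dotv x x &
      forall x, c * packet t h x = K * cexp (u x +i* th x)].
Proof.
pose T (j : 'I_(n + (n + n))) : R := sgn3 j * t.
pose a := (1 + t ^+ 2)^-1.
have a0 : 0 < a by rewrite invr_gt0 den1_gt0.
have T2 j : T j ^+ 2 = t ^+ 2.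
  rewrite /T /sgn3; case: fintype.split => [?|k]; first by rewrite mul1r.
  by case: fintype.split => ?; rewrite ?mul1r// mulN1r sqrrN.
have lE j : (width (T j))^-1 ^+ 2 = a +i* (- (T j * a)).
  rewrite exprVn width_sqr; apply: mulr1_eq; apply/eqP; rewrite eq_complex /=.
  have := den1_gt0 t; rewrite /a -(T2 j) => d0.
  by apply/andP; split; apply/eqP; field; rewrite gt_eqF.
pose u (x : V) := \sum_j (- a / 2 * (x ord0 j * x ord0 j) + h * a * x ord0 j).
pose th (x : V) := \sum_j (T j * a / 2 * (x ord0 j * x ord0 j) + - (h * (T j * a)) * x ord0 j).
have pol (A B : 'I_(n + (n + n)) -> R) :
    polyf (fun x : V => \sum_j (A j * (x ord0 j * x ord0 j) + B j * x ord0 j)).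
  apply: polyf_sum => j; apply: polyf_add; apply: polyf_mul; try exact: polyf_cst.
    by apply: polyf_mul; exact: polyf_coord.
  exact: polyf_coord.
eexists _, u, th; split.
- exact: pol.
- exact: pol.
- exists (\sum_(j < n + (n + n)) a * h ^+ 2), (a / 4); first by rewrite divr_gt0.
  move=> x; rewrite /u /dotv mulr_sumr -sumrB; apply: ler_sum => j _.
  (* Expanded, this trades the linear term a h z for a z^2 / 4 + a h^2. *)
  have : 0 <= a * (x ord0 j / 2 - h) ^+ 2 by rewrite mulr_ge0 ?sqr_ge0// ltW.
  rewrite !expr2; move: (x _ _) => z; nra.
move=> x; rewrite packetE mulrA; congr (_ * _).
rewrite /gaussian (_ : u x +i* th x = \sum_j
   ((- a / 2 * (x ord0 j * x ord0 j) + h * a * x ord0 j) +i*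
   (T j * a / 2 * (x ord0 j * x ord0 j) + - (h * (T j * a)) * x ord0 j))); last first.
  apply/eqP; rewrite eq_complex /=; apply/andP; split; apply/eqP.
    by rewrite (big_morph (@complex.Re R) (@cReD R) (erefl : @complex.Re R 0 = 0)).
  by rewrite (big_morph (@complex.Im R) (@cImD R) (erefl : @complex.Im R 0 = 0)).
rewrite cexp_sum; apply: eq_bigr => j _; congr cexp.
rewrite -/(T j) -exprVn lE (_ : (2 : R[i])^-1 = (2^-1)%:C); last by rewrite fmorphV rmorph_nat.
rewrite -rmorphXn; simpc; rewrite expr2; congr (_ +i* _); ring.
Qed.

Lemma schwartz_packets I (r : seq I) (c : I -> R[i]) (t h : I -> R) :
  schwartz (fun w : V => \sum_(k <- r) c k * packet (t k) (h k) w).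
Proof.
split; apply: real_schwartz_gaussf.
  have -> : (fun w : V => complex.Re (\sum_(k <- r) c k * packet (t k) (h k) w)) =
      (fun w => \sum_(k <- r) complex.Re (c k * packet (t k) (h k) w)).
    apply/funext => w.
    by rewrite (big_morph (@complex.Re R) (@cReD R) (erefl : @complex.Re R 0 = 0)).
  apply: gaussf_sum => k; have [K [u [th [pu pth hu /funext e]]]] := packet_cexp (c k) (t k) (h k).
  have -> : (fun w => complex.Re (c k * packet (t k) (h k) w)) =
      (fun w => complex.Re (K * cexp (u w +i* th w))).
    by apply/funext => w; rewrite -(congr1 (@^~ w) e).
  exact: (gaussf_cexp K pu pth hu).1.
have -> : (fun w : V => complex.Im (\sum_(k <- r) c k * packet (t k) (h k) w)) =
    (fun w => \sum_(k <- r) complex.Im (c k * packet (t k) (h k) w)).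
  apply/funext => w.
  by rewrite (big_morph (@complex.Im R) (@cImD R) (erefl : @complex.Im R 0 = 0)).
apply: gaussf_sum => k; have [K [u [th [pu pth hu /funext e]]]] := packet_cexp (c k) (t k) (h k).
have -> : (fun w => complex.Im (c k * packet (t k) (h k) w)) =
    (fun w => complex.Im (K * cexp (u w +i* th w))).
  by apply/funext => w; rewrite -(congr1 (@^~ w) e).
exact: (gaussf_cexp K pu pth hu).2.
Qed.

End schwartz_packets.

(** * Norm estimates *)

Section Lnorm_lower.
Local Open Scope ereal_scope.
Context d (T : measurableType d) {R : realType} (mu : {measure set T -> \bar R}).

(* The integral of a nonnegative function is a supremum over simple functions,
   so monotonicity needs no measurability. *)
Lemma ge0_le_integralT (f g : T -> \bar R) : (forall x, 0 <= f x) ->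
  (forall x, f x <= g x) -> \int[mu]_x f x <= \int[mu]_x g x.
Proof.
move=> f0 fg; have g0 x : 0 <= g x by exact: le_trans (fg x).
rewrite !ge0_integralTE//; apply: ereal_sup_le => _ [h /= hf <-].
by exists h => // x; exact: le_trans (hf x) (fg x).
Qed.

(* For p = +oo the exponent is 0, since fine +oo = 0 and 0^-1 = 0. *)
Lemma Lnorm_lower (p : \bar R) (A : set T) (a c : R) (f : T -> \bar R) :
  1 <= p -> measurable A -> mu A = a%:E -> (0 < a)%R -> (0 <= c)%R ->
  (forall x, A x -> c%:E <= f x) ->
  (c * a `^ (fine p)^-1)%:E <= Lnorm mu p f.
Proof.
move=> p1 mA muA a0 c0 cf.
have mT0 : 0 < mu [set: T].
  have : mu A <= mu [set: T] by apply: le_measure; rewrite ?inE.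
  by apply: lt_le_trans; rewrite muA lte_fin.
case: p p1 => [r|_|//]; last first.
  (* For p = +oo, an essential bound below c would place A inside a null set. *)
  rewrite unlock /= mT0 invr0 powRr0 mulr1; apply/ereal_infP => y /= fy.
  rewrite leNgt; apply/negP => yc.
  have [N [mN N0 sN]] := fy.
  have AN : A `<=` N.
    move=> x Ax; apply: sN => /=; apply/negP; rewrite -ltNge; apply: (lt_le_trans yc).
    by rewrite gee0_abs ?cf// (le_trans _ (cf x Ax))// lee_fin.
  have : mu A <= mu N by apply: le_measure; rewrite ?inE//; exact: AN.
  by rewrite N0 muA lee_fin leNgt a0.
rewrite lee_fin => r1; rewrite unlock /=.
have r0 : (0 < r)%R by exact: lt_le_trans r1.
(* The left side is the r-norm of c times the indicator of A. *)
have E : (c * a `^ r^-1)%:E = ((c `^ r)%:E * mu A) `^ r^-1.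
  rewrite muA -EFinM poweR_EFin powRM ?powR_ge0 ?(ltW a0)// -powRrM mulfV ?gt_eqF//.
  by rewrite powRr1.
have in0y (x : \bar R) : 0 <= x -> x \in `[0, +oo].
  by move=> x0; rewrite in_itv /= x0 leey.
rewrite E; apply: gt0_ler_poweR.
- by rewrite invr_ge0 ltW.
- by apply: in0y; rewrite mule_ge0// lee_fin powR_ge0.
- by apply: in0y; apply: integral_ge0 => x _; exact: poweR_ge0.
rewrite -(setIT A) -integral_indic// -ge0_integralZl//; last 2 first.
- exact/measurable_EFinP/measurable_indic.
- by rewrite lee_fin powR_ge0.
apply: ge0_le_integralT => x; first by rewrite -EFinM lee_fin mulr_ge0 ?powR_ge0.
rewrite indicE; case: (boolP (x \in A)) => [|_]; last first.
  by rewrite mule0 poweR_ge0.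
rewrite inE mule1 => Ax; rewrite -poweR_EFin; apply: gt0_ler_poweR.
- exact: ltW.
- by apply: in0y; rewrite lee_fin.
- by apply: in0y; exact: abse_ge0.
- by apply: le_trans (cf x Ax) _; exact: lee_abs.
Qed.

End Lnorm_lower.

(** * Signs with small Sobolev norm *)

Section sobolev_signs.
Context {R : realType} {n : nat}.
Notation nu := (lebesgue_rV (n + (n + n))).
Notation V := 'rV[R]_(n + (n + n)).
Variable s : R.
Hypothesis s_ge0 : 0 <= s.

Let W (xi : V) : R := (1 + enorm xi ^+ 2) `^ (s / 2).

(** The squared modulus of [packet_hat] is exp(- |xi|^2), of which this uses half. *)
Let W_sqr_le : exists2 C : R, 0 < C & forall xi, W xi ^+ 2 <= C * expR (2^-1 * dotv xi xi).
Proof.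
have [C C0 hC] := @powR_le_expR R 2^-1 s ltac:(by rewrite invr_gt0) s_ge0.
exists C => // xi; rewrite /W enorm_sqr; apply: le_trans (hC _ (dotvv_ge0 xi)).
by rewrite -powR_mulrn ?powR_ge0// -powRrM divfK.
Qed.

Let mW : measurable_fun [set: V] W.
Proof.
apply: (measurableT_comp (@measurable_powR R (s / 2))).
apply: measurable_funD => //; apply: measurable_funX; exact: measurable_enorm.
Qed.

Let energy_integrable I (r : seq I) (c : I -> R[i]) (t h : I -> R) :
  nu.-integrable [set: V] (EFin \o (fun xi =>
    (W xi * Normc.normc (\sum_(k <- r) c k * packet_hat (t k) (h k) xi)) ^+ 2)).
Proof.
have [C C0 hC] := W_sqr_le.
pose S := \sum_(k <- r) Normc.normc (c k).
have hsum (xi : V) : Normc.normc (\sum_(k <- r) c k * packet_hat (t k) (h k) xi) <=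
    S * expR (- dotv xi xi / 2).
  apply: (le_trans (normc_sum _ _ _)); rewrite mulr_suml; apply: ler_sum => k _.
  by rewrite Normc.normcM normc_packet_hat.
have S0 : 0 <= S by apply: sumr_ge0 => k _; exact: normc_ge0.
apply: (le_integrable measurableT _ _
   (@integrable_scaled_expR_dotv R (n + (n + n)) (C * S ^+ 2) 2^-1 _)).
- apply/measurable_EFinP; apply: measurable_funX; apply: measurable_funM => //.
  apply: measurable_normc; apply: cmeasurable_sum => k.
  by apply: cmeasurableM; [exact: cmeasurable_cst|exact: cmeasurable_gaussian].
- move=> xi _ /=; rewrite lee_fin !ger0_norm ?sqr_ge0//; last first.
    by rewrite !mulr_ge0 ?expR_ge0 ?sqr_ge0 ?(ltW C0).
  rewrite exprMn; apply: (@le_trans _ _ ((C * expR (2^-1 * dotv xi xi)) *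
      (S * expR (- dotv xi xi / 2)) ^+ 2)).
    apply: ler_pM; [exact: sqr_ge0|exact: sqr_ge0|exact: hC|].
    by rewrite lerXn2r ?nnegrE ?normc_ge0 ?mulr_ge0 ?expR_ge0.
  rewrite exprMn mulrACA -[expR (- _ / 2) ^+ 2]expRM_natl -expRD.
  apply: ler_wpM2l; first by rewrite mulr_ge0 ?sqr_ge0 ?(ltW C0).
  by rewrite ler_expR; lra.
- by rewrite invr_gt0.
Qed.

Let energy (v : V -> R[i]) : R := \int[nu]_xi (W xi * Normc.normc (v xi)) ^+ 2.

Let S : R := \int[nu]_xi (W xi * expR (- dotv xi xi / 2)) ^+ 2.

Let normc_parallelogram (a b : R[i]) : Normc.normc (a + b) ^+ 2 + Normc.normc (a - b) ^+ 2 =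
  2 * Normc.normc a ^+ 2 + 2 * Normc.normc b ^+ 2.
Proof. by case: a b => [a b] [c d]; simpc; rewrite !normcE_sqr /=; ring. Qed.

(* The signs are chosen one at a time: by the parallelogram law one of v + u and
   v - u has energy at most the sum of those of v and u. *)
Lemma sobolev_signs_energy (t h : nat -> R) N : exists2 e : nat -> R,
  forall k, `|e k| = 1 &
  energy (fun xi => \sum_(0 <= k < N) (e k)%:C * packet_hat (t k) (h k) xi) <= N%:R * S.
Proof.
elim: N => [|N [e e1 ih]].
  exists (fun=> 1) => [_|]; first by rewrite normr1.
  rewrite mul0r /energy; under eq_Rintegral do rewrite big_nil Normc.normc0 mulr0 expr2 mulr0.
  by rewrite Rintegral_cst// mul0r.
pose v (xi : V) := \sum_(0 <= k < N) (e k)%:C * packet_hat (t k) (h k) xi.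
pose u : V -> R[i] := packet_hat (t N) (h N).
pose es (b : R) (k : nat) := if k == N then b else e k.
have esv b (xi : V) : \sum_(0 <= k < N.+1) (es b k)%:C * packet_hat (t k) (h k) xi =
    v xi + b%:C * u xi.
  rewrite big_nat_recr//= /es eqxx; congr (_ + _); apply: eq_big_nat => k /andP[_ kN].
  by rewrite (ltn_eqF kN).
have es1 b : `|b| = 1 -> forall k, `|es b k| = 1.
  by move=> b1 k; rewrite /es; case: ifP.
have iv := energy_integrable (index_iota 0 N) (fun k => (e k)%:C) t h.
have iu : nu.-integrable [set: V] (EFin \o (fun xi => (W xi * Normc.normc (u xi)) ^+ 2)).
  have := energy_integrable [:: N] (fun=> 1) t h.
  by apply: eq_integrable => // xi _ /=; rewrite big_seq1 mul1r.
have ip b : nu.-integrable [set: V] (EFin \o (fun xi =>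
    (W xi * Normc.normc (v xi + b%:C * u xi)) ^+ 2)).
  have := energy_integrable (index_iota 0 N.+1) (fun k => (es b k)%:C) t h.
  by apply: eq_integrable => // xi _ /=; rewrite esv.
have uS : energy u = S.
  by apply: eq_Rintegral => xi _; rewrite normc_packet_hat.
have sumE : energy (fun xi => v xi + 1%:C * u xi) + energy (fun xi => v xi + (-1)%:C * u xi) =
    2 * (energy v + S).
  rewrite -uS /energy -RintegralD//; try exact: ip.
  rewrite -RintegralD// -RintegralZl//; last first.
    have := integrableD measurableT iv iu; exact: eq_integrable.
  apply: eq_Rintegral => xi _; rewrite !exprMn -mulrDr.
  rewrite mul1r (_ : (-1)%:C * u xi = - u xi); last by rewrite rmorphN1 mulN1r.
  by rewrite normc_parallelogram; ring.
have [le1|gt1] := lerP (energy (fun xi => v xi + 1%:C * u xi)) (energy v + S).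
  exists (es 1); first by apply: es1; rewrite normr1.
  rewrite (_ : (fun xi => _) = (fun xi => v xi + 1%:C * u xi)); last exact/funext/esv.
  by apply: (le_trans le1); rewrite -natr1 mulrDl mul1r lerD2r.
exists (es (-1)); first by apply: es1; rewrite normrN1.
rewrite (_ : (fun xi => _) = (fun xi => v xi + (-1)%:C * u xi)); last exact/funext/esv.
apply: (@le_trans _ _ (energy v + S)).
  by move: sumE gt1; move: (energy _) (energy _) => a b; lra.
by rewrite -natr1 mulrDl mul1r lerD2r.
Qed.

(** The same S serves every N and all parameters t and h, so the packets can be moved apart at no
    cost in H^s. Only the signs depend on them. *)
Lemma sobolev_signs : exists2 S : R, 0 <= S & forall N (t h : nat -> R),
  exists2 e : nat -> R, forall k, `|e k| = 1 &
  (sobolev_norm s (fun w : V => (\sum_(0 <= k < N) (e k)%:C * packet (t k) (h k) w)%R) <=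
   (Num.sqrt (N%:R * S))%:E)%E.
Proof.
have S0 : 0 <= S by apply: Rintegral_ge0 => xi _; exact: sqr_ge0.
exists S => // N t h; have [e e1 he] := sobolev_signs_energy t h N.
exists e => //; rewrite /sobolev_norm.
pose v (xi : V) := \sum_(0 <= k < N) (e k)%:C * packet_hat (t k) (h k) xi.
have -> : (fun xi : V => ((1 + enorm xi ^+ 2) `^ (s / 2) *
    Normc.normc (fourier (fun w : V => \sum_(0 <= k < N) (e k)%:C * packet (t k) (h k) w) xi))%:E) =
    (fun xi => (W xi * Normc.normc (v xi))%:E).
  apply/funext => xi; rewrite fourier_sum; last by move=> k; exact: cintegrable_packet.
  by congr (_ * Normc.normc _)%:E; apply: eq_bigr => k _; rewrite fourier_packet.
rewrite unlock /=.
have ie := energy_integrable (index_iota 0 N) (fun k => (e k)%:C) t h.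
have -> : (\int[nu]_xi (`|W xi * Normc.normc (v xi)|%R%:E `^ 2) = (energy v)%:E)%E.
  rewrite /energy /Rintegral fineK; last exact: integrable_fin_num ie.
  apply: eq_integral => xi _; rewrite poweR_EFin powR_mulrn ?normr_ge0//.
  by rewrite real_normK ?num_real.
rewrite poweR_EFin powR12_sqrt; last by apply: Rintegral_ge0 => xi _; exact: sqr_ge0.
by rewrite lee_fin ler_wsqrtr.
Qed.

End sobolev_signs.

(** * Separated packets and growth in N *)

Section separation.
Context {R : realType}.
Implicit Types (d M : R) (N : nat).

(** The terms other than j number fewer than N and add up to at most c / 2, whatever the signs. *)
Lemma normc_signed_sum_ge N (e : nat -> R) (f : nat -> R[i]) (c : R) j :
  (forall k, `|e k| = 1) -> (j < N)%N -> c <= Normc.normc (f j) ->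
  (forall k, k != j -> Normc.normc (f k) <= c / (2 * N%:R)) ->
  c / 2 <= Normc.normc (\sum_(0 <= k < N) (e k)%:C * f k).
Proof.
move=> e1 jN fj fk.
have N0 : (0 : R) < N%:R by rewrite ltr0n (leq_trans _ jN).
have ef k : Normc.normc ((e k)%:C * f k) = Normc.normc (f k).
  by rewrite Normc.normcM normc_real e1 mul1r.
(* The smallness hypothesis covers all indices other than j, so j + 1 may be used even if it equals
   N. *)
have c0 : 0 <= c / (2 * N%:R).
  by apply: le_trans (fk j.+1 _); rewrite ?normc_ge0// gtn_eqF.
rewrite big_mkord (bigD1 (Ordinal jN))//=.
set r := \sum_(_ | _) _.
have hr : Normc.normc r <= c / 2.
  apply: (le_trans (normc_sum _ _ _)).
  apply: (@le_trans _ _ (\sum_(i < N) c / (2 * N%:R))).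
    rewrite [leRHS](bigD1 (Ordinal jN))//= -[leLHS]add0r; apply: lerD => //.
    by apply: ler_sum => i ij; rewrite ef; exact: fk.
  by rewrite sumr_const card_ord -[leLHS]mulr_natr invfM mulrA mulfVK ?gt_eqF.
have : Normc.normc ((e j)%:C * f j) <= Normc.normc ((e j)%:C * f j + r) + Normc.normc r.
  rewrite -[X in _ <= _ + X]normcN; apply: le_trans (le_normcD _ _).
  by rewrite addrK.
by rewrite ef; lra.
Qed.

(** Nodes are M + 1 apart and u lies within d <= 1 to the right of node j. *)
Lemma progression_gap d M u (j k : nat) : 0 < M -> d <= 1 ->
  0 <= u - (M + 1) * j%:R <= d -> k != j -> M <= `|u - (M + 1) * k%:R|.
Proof.
move=> M_gt0 d1; set L := M + 1; have LE : L = M + 1 by []; clearbody L.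
move=> /andP[u0 ud]; rewrite neq_ltn => /orP[kj|jk].
  have h : L * k%:R + L <= L * j%:R.
    by rewrite -[X in _ + X]mulr1 -mulrDr natr1 ler_wpM2l ?ler_nat//; lra.
  by rewrite ger0_norm; lra.
have h : L * j%:R + L <= L * k%:R.
  by rewrite -[X in _ + X]mulr1 -mulrDr natr1 ler_wpM2l ?ler_nat//; lra.
by rewrite ler0_norm; lra.
Qed.

(** If r < 2, the hypothesis would keep N^(1/r - 1/2) bounded. *)
Lemma powR_growth (C a K S r : R) : 0 < C -> 0 < a -> 0 < r ->
  (forall N, (0 < N)%N -> C * (N%:R * a) `^ r^-1 <= K * Num.sqrt (N%:R * S)) ->
  2 <= r.
Proof.
move=> C0 a0 r0 H; rewrite leNgt; apply/negP => r2.
pose b := r^-1 - 2^-1; have b0 : 0 < b by rewrite subr_gt0 ltf_pV2 ?posrE.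
pose D := C * a `^ r^-1; have D0 : 0 < D by rewrite mulr_gt0 ?powR_gt0.
pose B := `|K * Num.sqrt S| / D.
have B0 : 0 <= B by rewrite divr_ge0 ?normr_ge0 ?(ltW D0).
(* Beyond B^(1/b), the power N^b exceeds the bound B. *)
pose N := (Num.bound (B `^ b^-1)).+1.
have N0 : (0 : R) < N%:R by rewrite ltr0n.
have hN : B < N%:R `^ b.
  have -> : B = (B `^ b^-1) `^ b by rewrite -powRrM mulVf ?powRr1 ?gt_eqF.
  apply: gt0_ltr_powR => //; rewrite ?nnegrE ?powR_ge0 ?ler0n//.
  apply: (lt_trans (archi_boundP _)); first exact: powR_ge0.
  by rewrite ltr_nat.
have := H N isT; rewrite sqrtrM ?ler0n// powRM ?ler0n ?(ltW a0)//.
have -> : N%:R `^ r^-1 = N%:R `^ b * Num.sqrt (N%:R : R).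
  rewrite -powR12_sqrt ?ler0n// -powRD ?subrK//.
  by rewrite (gt_eqF N0) implybT.
move=> h.
have s0 : 0 < Num.sqrt (N%:R : R) by rewrite sqrtr_gt0.
have : D * N%:R `^ b <= K * Num.sqrt S.
  rewrite -(ler_pM2r s0); apply: (le_trans _ (le_trans h _)).
    by rewrite le_eqVlt; apply/orP; left; apply/eqP; rewrite /D; ring.
  by rewrite le_eqVlt; apply/orP; left; apply/eqP; ring.
apply/negP; rewrite -ltNge; apply: (le_lt_trans (ler_norm _)).
by move: hN; rewrite /B ltr_pdivrMr// [ltRHS]mulrC.
Qed.

End separation.

Section boxes.
Context {R : realType} {n : nat}.

Definition cube (h d : R) : set 'rV[R]_n := [set x | forall i, h <= x ord0 i <= h + d].

Lemma measurable_cube h d : measurable (cube h d).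
Proof.
have -> : cube h d = \bigcap_(i in [set: 'I_n])
    ((fun x : 'rV[R]_n => x ord0 i) @^-1` `[h, h + d]).
  apply/seteqP; split=> [x xA i _|x xA i] /=; first by rewrite in_itv; exact: xA.
  by have := xA i I; rewrite /= in_itv.
apply: fin_bigcap_measurable => // i _.
by rewrite -[X in measurable X]setTI; apply: measurable_rV_coord.
Qed.

Lemma lebesgue_itv (h d : R) : 0 < d -> lebesgue_measure `[h, h + d] = d%:E.
Proof.
by move=> d0; rewrite lebesgue_measure_itv /= lte_fin ltrDl d0 -EFinD addrAC subrr add0r.
Qed.

Lemma lebesgue_cube h d : 0 < d -> lebesgue_rV n (cube h d) = (d ^+ n)%:E.
Proof.
move=> d0; have -> : cube h d = [set x | forall i, `[h, h + d]%classic (x ord0 i)].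
  by apply/seteqP; split=> x xA i /=; have := xA i; rewrite /= in_itv.
rewrite [LHS](@lebesgue_rV_box R n (fun=> `[h, h + d]%classic))//.
under eq_bigr do rewrite lebesgue_itv//.
by rewrite prodEFin prodr_const card_ord.
Qed.

End boxes.

Lemma measure_bigsetU_const d (T : measurableType d) (R : realType)
    (mu : {measure set T -> \bar R}) (F : nat -> set T) (a : R) N :
  (forall k, measurable (F k)) -> trivIset [set: nat] F ->
  (forall k, mu (F k) = a%:E) ->
  mu (\big[setU/set0]_(k < N) F k) = (N%:R * a)%:E.
Proof.
move=> mF tF muF; rewrite measure_bigsetU// (eq_bigr (fun=> a%:E)); last by move=> k _; exact: muF.
by rewrite sumEFin sumr_const card_ord mulr_natl.
Qed.

(** A point common to two windows would be within d of one node and, by [progression_gap], at least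
    M away from it. *)
Lemma trivIset_progression (R : realType) T (F : nat -> set T) (u : T -> R) (d M : R) :
  0 < M -> d <= 1 -> (forall k x, F k x -> 0 <= u x - (M + 1) * k%:R <= d) ->
  d < M -> trivIset [set: nat] F.
Proof.
move=> M0 d1 Fu dM; apply/trivIsetP => j k _ _ jk; apply/seteqP; split=> // x [Fj Fk].
have := progression_gap M0 d1 (Fu _ _ Fj); move=> /(_ k).
rewrite eq_sym => /(_ jk); have /andP[h0 h1] := Fu _ _ Fk.
by rewrite ger0_norm//; lra.
Qed.

(** * Spreading the focal points in time and in space *)

Section spreading.
Context {R : realType} {n : nat}.
Hypothesis n_gt0 : (0 < n)%N.
Variables (p q : \bar R).
Hypotheses (p_ge1 : (1 <= p)%E) (q_ge1 : (1 <= q)%E).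
Variable alpha : R.
Hypothesis alpha_ge0 : 0 <= alpha.

Definition signed_packets N (e t h : nat -> R) (w : 'rV[R]_(n + (n + n))) : R[i] :=
  \sum_(0 <= k < N) (e k)%:C * packet (t k) (h k) w.

Definition diag_output (G : 'rV[R]_(n + (n + n)) -> R[i]) : R -> 'rV[R]_n -> R[i] :=
  fun t => abs_grad alpha (fun x => schrodinger_flow t G (triple x x x)).

Let term (t : R) (y : 'rV[R]_n) : R[i] := diag_amp t ^+ n * diag_kernel alpha t y.

Let outputE N e t h tau x : diag_output (signed_packets N e t h) tau x =
  \sum_(0 <= k < N) (e k)%:C * term (t k + tau) (x - const_mx (h k)).
Proof. by rewrite /diag_output /signed_packets schrodinger_flow_packets abs_grad_packets. Qed.

Let normc_term t y : Normc.normc (term t y) =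
  Normc.normc (diag_amp t) ^+ n * Normc.normc (diag_kernel alpha t y).
Proof.
rewrite /term Normc.normcM; congr *%R; elim: n => [|m ih].
  by rewrite !expr0 Normc.normc1.
by rewrite !exprS Normc.normcM ih.
Qed.

(** The factor 1/20 is the amplitude bound of [normc_diag_amp_ge]. The ranges are one-sided to match
    windows of the form [h, h + d]. *)
Let term_lower : exists2 d : R, 0 < d <= 1 & exists2 c : R, 0 < c &
  forall t (y : 'rV[R]_n), 0 <= t <= d -> (forall i, 0 <= y ord0 i <= d) ->
  c <= Normc.normc (term t y).
Proof.
have [d /andP[d0 d1] [c c0 hc]] := @diag_kernel_lower R n alpha alpha_ge0 n_gt0.
exists d; first exact/andP.
exists (20^-1 ^+ n * c) => [|t y /andP[t0 td] yd]; first by rewrite mulr_gt0// exprn_gt0.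
rewrite normc_term; apply: ler_pM.
- by rewrite exprn_ge0.
- exact: ltW.
- rewrite lerXn2r ?nnegrE ?normc_ge0//; apply: normc_diag_amp_ge.
  by rewrite ger0_norm// (le_trans td).
- by apply: hc => [|i]; [rewrite ger0_norm|have /andP[? ?] := yd i; rewrite ger0_norm].
Qed.

(* The packets meet the diagonal at widely separated times; at each of these
   times the others have dispersed. *)
Lemma time_spread : exists2 C : R, 0 < C & exists2 a : R, 0 < a &
  forall N, (0 < N)%N -> exists t : nat -> R, forall e, (forall k, `|e k| = 1%R) ->
  ((C * (N%:R * a) `^ (fine p)^-1)%:E <=
   mixed_norm p q (diag_output (signed_packets N e t (fun=> 0%R))))%E.
Proof.
have [d /andP[d0 d1] [c c0 hc]] := term_lower.
have [Kb Kb0 hKb] := @diag_kernel_bounded R n alpha alpha_ge0.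
have C0 : 0 < c / 2 * (d ^+ n) `^ (fine q)^-1.
  by rewrite mulr_gt0 ?powR_gt0 ?exprn_gt0// divr_gt0.
exists (c / 2 * (d ^+ n) `^ (fine q)^-1) => //; exists d => // N N0.
have NR0 : (0 : R) < N%:R by rewrite ltr0n.
(* The amplitude threshold, multiplied by the kernel bound [Kb], gives the c / (2 N) required of
   each other packet. *)
have [M0' M0'0 hM] := @normc_diag_amp_small R (c / (2 * N%:R) / Kb)
  ltac:(by rewrite !divr_gt0// mulr_gt0).
(* Adding 1 makes d < [M0], so that the windows are disjoint; [M] is the spacing in
   [progression_gap]. *)
pose M0 := M0' + 1; pose M := M0 + 1.
have M00 : 0 < M0 by rewrite /M0; lra.
(* The packet with parameter - M k refocuses at time M k. *)
exists (fun k => - (M * k%:R)) => e e1.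
pose F (k : nat) : set R := `[M * k%:R, M * k%:R + d]%classic.
have FE k t : F k t -> 0 <= t - M * k%:R <= d.
  by rewrite /F /= in_itv /= => /andP[? ?]; lra.
rewrite /mixed_norm; apply: (@Lnorm_lower _ _ R (@lebesgue_measure R) p
  (\big[setU/set0]_(k < N) F k) (N%:R * d)
  (c / 2 * (d ^+ n) `^ (fine q)^-1)) => //.
- by apply: bigsetU_measurable => k _; exact: measurable_itv.
- apply: measure_bigsetU_const => [k||k]; first exact: measurable_itv.
    apply: (@trivIset_progression R R F id d M0) => //.
    by rewrite /M0; lra.
  exact: lebesgue_itv.
- by rewrite mulr_gt0.
- exact: ltW.
move=> t; rewrite -bigcup_mkord => -[j jN /FE tj].
apply: (@Lnorm_lower _ _ R (lebesgue_rV n) q (cube 0 d) (d ^+ n) (c / 2)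
  (fun x => (Normc.normc (diag_output _ t x))%:E)) => //.
- exact: measurable_cube.
- exact: lebesgue_cube.
- exact: exprn_gt0.
- by rewrite divr_ge0 ?ltW.
move=> x xd; rewrite lee_fin outputE.
apply: (normc_signed_sum_ge (f := fun k => term (- (M * k%:R) + t) (x - const_mx 0)) e1 jN).
  apply: hc => [|i]; first by rewrite addrC.
  by rewrite !mxE subr0; have := xd i; rewrite add0r.
move=> k kj; rewrite normc_term -[leRHS](mulfVK (lt0r_neq0 Kb0)).
apply: ler_pM; rewrite ?exprn_ge0 ?normc_ge0//.
(* As n >= 1 and the amplitude is at most 1, its n-th power is at most its first. *)
apply: (@le_trans _ _ (Normc.normc (diag_amp (- (M * k%:R) + t)) ^+ 1)).
  by apply: ler_wiXn2l; rewrite ?normc_ge0 ?normc_diag_amp_le1.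
rewrite expr1; apply: hM; rewrite addrC.
have := progression_gap M00 d1 tj kj; rewrite /M0; lra.
Qed.

(* The packets meet the diagonal at the same time and at widely separated
   places. *)
Lemma space_spread : exists2 C : R, 0 < C & exists2 a : R, 0 < a &
  forall N, (0 < N)%N -> exists h : nat -> R, forall e, (forall k, `|e k| = 1%R) ->
  ((C * (N%:R * a) `^ (fine q)^-1)%:E <=
   mixed_norm p q (diag_output (signed_packets N e (fun=> 0%R) h)))%E.
Proof.
have [d /andP[d0 d1] [c c0 hc]] := term_lower.
have C0 : 0 < c / 2 * d `^ (fine p)^-1 by rewrite mulr_gt0 ?powR_gt0// divr_gt0.
exists (c / 2 * d `^ (fine p)^-1) => //; exists (d ^+ n); first exact: exprn_gt0.
move=> N N0; have NR0 : (0 : R) < N%:R by rewrite ltr0n.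
(* The centres lie on the line (h, ..., h), so a single coordinate separates them. *)
pose i0 := Ordinal n_gt0.
have [M0' M0'0 hM] := @diag_kernel_decay R n alpha alpha_ge0 i0 (c / (2 * N%:R))
  ltac:(by rewrite divr_gt0// mulr_gt0).
pose M0 := M0' + 1; pose M := M0 + 1.
have M00 : 0 < M0 by rewrite /M0; lra.
exists (fun k => M * k%:R) => e e1.
pose F (k : nat) : set 'rV[R]_n := cube (M * k%:R) d.
have FE k x i : F k x -> 0 <= x ord0 i - M * k%:R <= d.
  by move=> /(_ i) /andP[? ?]; lra.
(* The outer norm now sees a single time window of length d, and the N cubes enter through the inner
   norm. *)
rewrite mulrAC; apply: (@Lnorm_lower _ _ R (@lebesgue_measure R) p `[0, 0 + d]%classic d
  (c / 2 * (N%:R * d ^+ n) `^ (fine q)^-1)) => //.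
- exact: lebesgue_itv.
- by rewrite mulr_ge0 ?powR_ge0 ?divr_ge0 ?ltW.
move=> t tI; have {tI}td : 0 <= t <= d by move: tI; rewrite /= in_itv /= add0r.
apply: (@Lnorm_lower _ _ R (lebesgue_rV n) q (\big[setU/set0]_(k < N) F k)
  (N%:R * d ^+ n) (c / 2) (fun x => (Normc.normc (diag_output _ t x))%:E)) => //.
- by apply: bigsetU_measurable => k _; exact: measurable_cube.
- apply: measure_bigsetU_const => [k||k]; first exact: measurable_cube.
    apply: (@trivIset_progression R _ F (fun x => x ord0 i0) d M0) => //.
      by move=> k x; exact: FE.
    by rewrite /M0; lra.
  exact: lebesgue_cube.
- by rewrite mulr_gt0// exprn_gt0.
- by rewrite divr_ge0 ?ltW.
move=> x; rewrite -bigcup_mkord => -[j jN Fj].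
rewrite lee_fin outputE.
apply: (normc_signed_sum_ge (f := fun k => term (0 + t) (x - const_mx (M * k%:R))) e1 jN).
  by apply: hc => [|i]; rewrite ?add0r// !mxE; exact: FE.
move=> k kj; rewrite normc_term -[leRHS]mul1r.
apply: ler_pM; rewrite ?exprn_ge0 ?normc_ge0//.
  (* No dispersion helps at a common time: the amplitude is only bounded by 1, and smallness comes
     from the kernel. *)
  by apply: exprn_ile1; rewrite ?normc_ge0 ?normc_diag_amp_le1.
apply: hM; first by rewrite add0r; have /andP[? ?] := td; rewrite ger0_norm; lra.
have := progression_gap M00 d1 (FE _ _ i0 Fj) kj; rewrite !mxE /M0; lra.
Qed.

End spreading.

(** For finite p this is [powR_growth]; for p = +oo, where [fine p] is 0, the conclusion holds
    trivially. *)
Lemma fine_exponent_ge2 (R : realType) (p : \bar R) (C a K S : R) :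
  (1 <= p)%E -> 0 < C -> 0 < a ->
  (forall N, (0 < N)%N -> C * (N%:R * a) `^ (fine p)^-1 <= K * Num.sqrt (N%:R * S)) ->
  (2%:E <= p)%E.
Proof.
case: p => [r|_ _ _ _|//]; last exact: leey.
by rewrite !lee_fin => r1 C0 a0; apply: powR_growth => //; exact: lt_le_trans r1.
Qed.

Local Open Scope ereal_scope.

Theorem theorem1p3 (R : realType) (n : nat) (n_ge1 : (1 <= n)%N)
    (p q : \bar R) (p_ge1 : 1 <= p) (q_ge1 : 1 <= q)
    (alpha s : R) (alpha_ge0 : (0 <= alpha)%R) (s_ge0 : (0 <= s)%R) :
  (exists K : R, forall G0 : 'rV[R]_(n + (n + n)) -> R[i], schwartz G0 ->
    mixed_norm p q
      (fun t => abs_grad alpha (fun x => schrodinger_flow t G0 (triple x x x)))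
    <= K%:E * sobolev_norm s G0) ->
  2%:E <= p /\ 2%:E <= q.
Proof.
move=> [K hK].
have [S S0 hS] := @sobolev_signs R n s s_ge0.
have bound N t h : exists2 e : nat -> R, (forall k, `|e k|%R = 1%R) &
    mixed_norm p q (diag_output alpha (@signed_packets R n N e t h)) <=
    (`|K| * Num.sqrt (N%:R * S))%R%:E.
  have [e e1 he] := hS N t h; exists e => //.
  apply: (le_trans (hK _ (schwartz_packets _ (fun k => (e k)%:C)%C t h))).
  (* No sign is assumed for K, and monotonicity in the second factor needs a nonnegative
     constant. *)
  apply: (@le_trans _ _ (`|K|%R%:E * sobolev_norm s (@signed_packets R n N e t h))).
    by apply: lee_wpmul2r; [exact: Lnorm_ge0|rewrite lee_fin ler_norm].
  by rewrite EFinM; apply: lee_wpmul2l => //; rewrite lee_fin.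
split.
  have [C C0 [a a0 low]] := time_spread n_ge1 p_ge1 q_ge1 alpha_ge0.
  apply: (@fine_exponent_ge2 _ _ C a `|K|%R S p_ge1 C0 a0) => N N0.
  (* The times are fixed first; [bound] then supplies signs adapted to them, and [ht] holds for any
     signs. *)
  have [t ht] := low N N0; have [e e1 he] := bound N t (fun=> 0%R).
  by rewrite -lee_fin; exact: le_trans (ht e e1) he.
have [C C0 [a a0 low]] := space_spread n_ge1 p_ge1 q_ge1 alpha_ge0.
apply: (@fine_exponent_ge2 _ _ C a `|K|%R S q_ge1 C0 a0) => N N0.
have [h hh] := low N N0; have [e e1 he] := bound N (fun=> 0%R) h.
by rewrite -lee_fin; exact: le_trans (hh e e1) he.
Qed.
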